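(* Let $M$ be a simply connected oriented Riemannian surface and $E\to M$ an oriented real vector bundle of rank two with fibre metric and compatible connection, such that $TM$ and $E$ are both flat. Let $\vec H\in\Gamma(E)$, let $\varphi\in\Gamma(\Sigma)$ satisfy $D\varphi=\vec H\cdot\varphi$ and $H(\varphi,\varphi)=1$, and let $g=[\varphi]:M\to S^3_{\mathcal A}$ be the coordinates of $\varphi$ in a global parallel section $\tilde s$ of $\tilde Q$. Assume that the Gauss map $G:M\to S^2_{\mathcal A}$ of the immersion defined by $\varphi$ is regular (i.e. $dG_x$ is injective at every $x\in M$), and endow $M$ with the Lorentz structure induced by $G$. Then: 1. The map $g:M\to S^3_{\mathcal A}\subset\mathbb H^{\mathcal A}$ is a conformal map, and, at each point of $M$, there is a local chart $a:\mathcal U\subset\mathcal A\to M$ (of the Lorentz structure), unique up to the action of the group $\mathbb G=\{a\mapsto\pm a+b,\ b\in\mathcal A\}$, which is compatible with the orientation of $M$ and such that $g:\mathcal U\subset\mathcal A\to S^3_{\mathcal A}$ satisfies $H(g',g')\equiv 1$, where $g':\mathcal U\subset\mathcal A\to\mathbb H^{\mathcal A}$ is such that $dg=g'\,da$. 2. There exists a conformal map $\psi:\mathcal U\subset\mathcal A\to\mathcal A$ such that $$g'g^{-1}=\cos\psi\ J+\sin\psi\ K,$$ where $a:\mathcal U\subset\mathcal A\to M$ is a chart as in 1.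
   Context: Algebra. $\mathcal A=\{x+\sigma y:\ x,y\in\mathbb R\}$ is the algebra of Lorentz numbers, $\sigma^2=1$, with conjugation $\overline{x+\sigma y}=x-\sigma y$; $\cos$ and $\sin$ on $\mathcal A$ are defined by the usual power series. $\mathbb H^{\mathcal A}=\{\xi=a_0 1+a_1I+a_2J+a_3K:\ a_i\in\mathcal A\}$ are the quaternions with coefficients in $\mathcal A$ ($I^2=J^2=K^2=-1$, $IJ=-JI=K$). Write $\overline\xi=a_01-a_1I-a_2J-a_3K$ and $\hat\xi=\overline{a_0}1+\overline{a_1}I+\overline{a_2}J+\overline{a_3}K$; $\langle\langle\xi,\xi'\rangle\rangle=\overline{\xi'}\xi\in\mathbb H^{\mathcal A}$ and $H(\xi,\xi')=\sum_i a_ia_i'\in\mathcal A$. $S^3_{\mathcal A}=\{\xi\in\mathbb H^{\mathcal A}:H(\xi,\xi)=1\}\ (\simeq Spin(4))$ and $S^2_{\mathcal A}=\{\xi\in S^3_{\mathcal A}:a_0=0\}$. $\mathbb R^4$ is identified with $\{\sigma x_01+x_1I+x_2J+x_3K:\ x_i\in\mathbb R\}\subset\mathbb H^{\mathcal A}$, with Euclidean metric the restriction of $H$. Twisted spinors. $Q_E,Q_M$ are the bundles of positively oriented orthonormal frames of $E$ and $TM$, $\tilde Q_E\to Q_E$, $\tilde Q_M\to Q_M$ are spin structures and $\tilde Q=\tilde Q_E\times_M\tilde Q_M$, a principal $Spin(2)\times Spin(2)$-bundle. The element with parameters $(\theta_2,\theta_1)$ of $Spin(2)\times Spin(2)$ (covering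 the rotation of angle $2\theta_2$ in $E$ and $2\theta_1$ in $TM$) acts on $\mathbb H^{\mathcal A}$ by left multiplication by $(\cos\theta_2+\sigma\sin\theta_2 I)(\cos\theta_1+\sin\theta_1I)$; call this representation $\rho$. $\Sigma=\tilde Q\times\mathbb H^{\mathcal A}/\rho$ ($\simeq\Sigma E\otimes\Sigma M$), with the connection $\nabla$ induced by those of $E$ and $TM$. In a local section $\tilde s$ of $\tilde Q$ lying over the frame $(e_0,e_1,e_2,e_3)$, with $(e_0,e_1)$ a frame of $E$ and $(e_2,e_3)$ a frame of $TM$, a section $\varphi$ is written $\varphi=[\tilde s,[\varphi]]$ with $[\varphi]\in\mathbb H^{\mathcal A}$; vectors $X\in E\oplus TM$ have coordinates $[X]$, real-linear in $X$, with $[e_0]=\sigma 1,[e_1]=I,[e_2]=J,[e_3]=K$; Clifford multiplication is $[X\cdot\varphi]=[X]\widehat{[\varphi]}$. The pairings $\langle\langle\cdot,\cdot\rangle\rangle$ and $H$ on $\Sigma$ are computed on coordinates. The Dirac operator is $D\varphi=e_2\cdot\nabla_{e_2}\varphi+e_3\cdot\nabla_{e_3}\varphi$. Flatness of $TM$ and $E$ means $K=K_N=0$ (curvatures of the two connections); since $M$ is simply connected, $\tilde Q$ then has a global parallel section. Immersion and Gauss map. If $D\varphi=\vec H\cdot\varphi$ and $H(\varphi,\varphi)=1$, then $\xi(X)=\langle\langle X\cdot\varphi,\varphi\rangle\rangle$ is a closed 1-form with values in $\mathbb R^4\subset\mathbb H^{\mathcal A}$ and $F=\int\xi:M\to\mathbb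 R^4$ is an isometric immersion with normal bundle $E$ and mean curvature vector $\vec H$ (known fact); it is called the immersion defined by $\varphi$. Its Gauss map is $G=v_2\,\widehat{v_3}:M\to S^2_{\mathcal A}$, where $v_j=\xi(e_j)$ for $(e_2,e_3)$ a positively oriented orthonormal tangent frame (this is the bivector $v_2\wedge v_3$ viewed in the even Clifford algebra $\simeq\mathbb H^{\mathcal A}$). Lorentz structure. When $K=K_N=0$ and $G$ is regular, there is a unique smooth family of endomorphisms $\sigma_x$ of $T_xM$ with $\sigma_x^2=\mathrm{id}$, $\sigma_x\neq\pm\mathrm{id}$, and $dG_x(\sigma_xu)=\sigma\,dG_x(u)$ for all $u\in T_xM$; this is the Lorentz structure on $M$ induced by $G$. A map between open subsets of $M$, $\mathcal A$, $\mathcal A^n$ (e.g. $\mathbb H^{\mathcal A}\simeq\mathcal A^4$) is conformal if its differential commutes with the structures $\sigma$. A local chart $a:\mathcal U\subset\mathcal A\to M$ is a conformal diffeomorphism from an open set onto an open subset of $M$; in it a conformal map $f$ satisfies $df=f'\,da$, $da=dx+\sigma dy$. It is compatible with the orientation if it preserves orientation, $\mathcal A$ being oriented by $(\partial_x,\partial_y)$. *)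

(* Defs.v *)
From HB Require Import structures.
From mathcomp Require Import all_boot all_order all_algebra.
From mathcomp Require Import all_classical all_reals all_analysis.
From mathcomp Require Import ring lra.
Set Implicit Arguments.
Unset Strict Implicit.
Unset Printing Implicit Defensive.
Import Order.TTheory GRing.Theory Num.Theory numFieldNormedType.Exports.
Local Open Scope classical_set_scope.
Local Open Scope ring_scope.

(* The pair (x, y) stands for x + sigma y.  The type is an alias of R * R, so
   that it carries the product topology and normed R-module structure, but its
   multiplication is not the componentwise one. *)
Definition lorentz (R : realType) : Type := (R * R)%type.

HB.instance Definition _ (R : realType) :=
  NormedModule.copy (lorentz R) (R * R)%type.

Section LorentzRing.
Variable R : realType.
Implicit Types a b c : lorentz R.

Definition mkL (x y : R) : lorentz R := (x, y).
Definition lmul a b : lorentz R :=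
  mkL (a.1 * b.1 + a.2 * b.2) (a.1 * b.2 + a.2 * b.1).
Definition lone : lorentz R := mkL 1 0.
Definition lnorm a : R := a.1 ^+ 2 - a.2 ^+ 2.
Definition lunit : pred (lorentz R) := fun a => lnorm a != 0.
Definition linv a : lorentz R :=
  if lunit a then mkL (a.1 / lnorm a) (- a.2 / lnorm a) else a.

Lemma lorentz_ext a b : a.1 = b.1 -> a.2 = b.2 -> a = b.
Proof. by case: a b => [? ?] [? ?] /= -> ->. Qed.

Lemma lmulA : associative lmul.
Proof. by move=> a b c; apply: lorentz_ext => /=; ring. Qed.
Lemma lmulC : commutative lmul.
Proof. by move=> a b; apply: lorentz_ext => /=; ring. Qed.
Lemma lmul1 : left_id lone lmul.
Proof. by move=> a; apply: lorentz_ext => /=; ring. Qed.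
Lemma lmulDl : left_distributive lmul +%R.
Proof. by move=> a b c; apply: lorentz_ext => /=; ring. Qed.
Lemma lone_neq0 : lone != 0.
Proof. by apply/eqP => -[/eqP]; rewrite oner_eq0. Qed.

HB.instance Definition _ := GRing.Zmodule_isComNzRing.Build (lorentz R)
  lmulA lmulC lmul1 lmulDl lone_neq0.

Lemma lmulVr : {in lunit, left_inverse 1 linv *%R}.
Proof.
move=> a; rewrite unfold_in => ua; rewrite /linv /lunit ua.
by move: ua; rewrite /lnorm => ua; apply: lorentz_ext => /=; field.
Qed.
Lemma lunitP a b : b * a = 1 -> lunit a.
Proof.
move=> ba; suff: lnorm b * lnorm a = 1.
  by move=> e; apply/eqP => a0; move/eqP: e; rewrite a0 mulr0 eq_sym oner_eq0.
have e1 : b.1 * a.1 + b.2 * a.2 = 1 by have := congr1 fst ba.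
have e2 : b.1 * a.2 + b.2 * a.1 = 0 by have := congr1 snd ba.
have -> : lnorm b * lnorm a =
  (b.1 * a.1 + b.2 * a.2) ^+ 2 - (b.1 * a.2 + b.2 * a.1) ^+ 2.
  by rewrite /lnorm; ring.
by rewrite e1 e2; ring.
Qed.
Lemma linv_out : {in [predC lunit], linv =1 id}.
Proof. by move=> a; rewrite !inE /linv unfold_in /lunit => /negbTE ->. Qed.

HB.instance Definition _ := GRing.ComNzRing_hasMulInverse.Build (lorentz R)
  lmulVr lunitP linv_out.

Definition lsigma : lorentz R := mkL 0 1.
Definition lconj a : lorentz R := mkL a.1 (- a.2).

Definition lcos (z : lorentz R) : lorentz R :=
  limn (fun n => \sum_(0 <= k < n)
    ((-1) ^+ k / ((2 * k)`!)%:R : R) *: z ^+ (2 * k)).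
Definition lsin (z : lorentz R) : lorentz R :=
  limn (fun n => \sum_(0 <= k < n)
    ((-1) ^+ k / ((2 * k).+1`!)%:R : R) *: z ^+ (2 * k).+1).

End LorentzRing.

Arguments lsigma {R}.

(* As for [lorentz], only the normed R-module structure is the product one. *)
Definition lquat (R : realType) : Type :=
  (lorentz R * lorentz R * lorentz R * lorentz R)%type.

HB.instance Definition _ (R : realType) := NormedModule.copy (lquat R)
  (lorentz R * lorentz R * lorentz R * lorentz R)%type.

Section LquatRing.
Variable R : realType.
Local Notation A := (lorentz R).
Implicit Types p q r : lquat R.

Definition mkQ (a0 a1 a2 a3 : A) : lquat R := (a0, a1, a2, a3).
Definition qc0 q : A := q.1.1.1.
Definition qc1 q : A := q.1.1.2.
Definition qc2 q : A := q.1.2.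
Definition qc3 q : A := q.2.

Definition qmul p q : lquat R := mkQ
  (qc0 p * qc0 q - qc1 p * qc1 q - qc2 p * qc2 q - qc3 p * qc3 q)
  (qc0 p * qc1 q + qc1 p * qc0 q + qc2 p * qc3 q - qc3 p * qc2 q)
  (qc0 p * qc2 q - qc1 p * qc3 q + qc2 p * qc0 q + qc3 p * qc1 q)
  (qc0 p * qc3 q + qc1 p * qc2 q - qc2 p * qc1 q + qc3 p * qc0 q).
Definition qone : lquat R := mkQ 1 0 0 0.
Definition qI : lquat R := mkQ 0 1 0 0.
Definition qJ : lquat R := mkQ 0 0 1 0.
Definition qK : lquat R := mkQ 0 0 0 1.

Definition qscale (a : A) q : lquat R :=
  mkQ (a * qc0 q) (a * qc1 q) (a * qc2 q) (a * qc3 q).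
Definition qbar q : lquat R := mkQ (qc0 q) (- qc1 q) (- qc2 q) (- qc3 q).
Definition qhat q : lquat R :=
  mkQ (lconj (qc0 q)) (lconj (qc1 q)) (lconj (qc2 q)) (lconj (qc3 q)).
Definition qform p q : A :=
  qc0 p * qc0 q + qc1 p * qc1 q + qc2 p * qc2 q + qc3 p * qc3 q.

Definition qunit : pred (lquat R) := fun q => qform q q \is a GRing.unit.
Definition qinv q : lquat R :=
  if qunit q then qscale (qform q q)^-1 (qbar q) else q.

Lemma lquat_ext p q :
  qc0 p = qc0 q -> qc1 p = qc1 q -> qc2 p = qc2 q -> qc3 p = qc3 q -> p = q.
Proof.
move: p q => [[[? ?] ?] ?] [[[? ?] ?] ?].
by rewrite /qc0 /qc1 /qc2 /qc3 /= => -> -> -> ->.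
Qed.

Lemma qD p q : p + q =
  mkQ (qc0 p + qc0 q) (qc1 p + qc1 q) (qc2 p + qc2 q) (qc3 p + qc3 q).
Proof. by []. Qed.

Lemma qmulA : associative qmul.
Proof.
move=> p q r; apply: lquat_ext;
  rewrite /qmul /mkQ /qc0 /qc1 /qc2 /qc3 /=; ring.
Qed.
Lemma qmul1l : left_id qone qmul.
Proof.
move=> p; apply: lquat_ext; rewrite /qmul /qone /mkQ /qc0 /qc1 /qc2 /qc3 /=; ring.
Qed.
Lemma qmul1r : right_id qone qmul.
Proof.
move=> p; apply: lquat_ext; rewrite /qmul /qone /mkQ /qc0 /qc1 /qc2 /qc3 /=; ring.
Qed.
Lemma qmulDl : left_distributive qmul +%R.
Proof.
move=> p q r; rewrite !qD; apply: lquat_ext;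
  rewrite /qmul /mkQ /qc0 /qc1 /qc2 /qc3 /=; ring.
Qed.
Lemma qmulDr : right_distributive qmul +%R.
Proof.
move=> p q r; rewrite !qD; apply: lquat_ext;
  rewrite /qmul /mkQ /qc0 /qc1 /qc2 /qc3 /=; ring.
Qed.
Lemma qone_neq0 : qone != 0.
Proof. by apply/eqP => -[/eqP]; rewrite oner_eq0. Qed.

HB.instance Definition _ := GRing.Zmodule_isNzRing.Build (lquat R)
  qmulA qmul1l qmul1r qmulDl qmulDr qone_neq0.

Lemma qmulE p q : p * q = qmul p q. Proof. by []. Qed.

Lemma qmulVr : {in qunit, left_inverse 1 qinv *%R}.
Proof.
move=> q; rewrite unfold_in => uq; rewrite /qinv /qunit uq qmulE.
have e : (qform q q)^-1 * qform q q = 1 by exact: mulVr.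
by apply: lquat_ext;
  rewrite /qmul /qscale /qbar /mkQ [in RHS]/GRing.one /= /qc0 /qc1 /qc2 /qc3 /=
    -?e /qform /qc0 /qc1 /qc2 /qc3; ring.
Qed.
Lemma qmulrV : {in qunit, right_inverse 1 qinv *%R}.
Proof.
move=> q; rewrite unfold_in => uq; rewrite /qinv /qunit uq qmulE.
have e : (qform q q)^-1 * qform q q = 1 by exact: mulVr.
by apply: lquat_ext;
  rewrite /qmul /qscale /qbar /mkQ [in RHS]/GRing.one /= /qc0 /qc1 /qc2 /qc3 /=
    -?e /qform /qc0 /qc1 /qc2 /qc3; ring.
Qed.
Lemma qunitP p q : q * p = 1 /\ p * q = 1 -> qunit p.
Proof.
case=> /(congr1 (fun r => qform r r)) + _; rewrite qmulE => e.
rewrite /qunit; apply/unitrP; exists (qform q q).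
suff h : qform q q * qform p p = 1 by split; last rewrite mulrC.
rewrite (_ : qform (1 : lquat R) 1 = 1) in e; last first.
  by rewrite /qform /qc0 /qc1 /qc2 /qc3 /=; ring.
by rewrite -e /qform /qmul /mkQ /qc0 /qc1 /qc2 /qc3 /=; ring.
Qed.
Lemma qinv_out : {in [predC qunit], qinv =1 id}.
Proof. by move=> q; rewrite !inE /qinv unfold_in /qunit => /negbTE ->. Qed.

HB.instance Definition _ := GRing.NzRing_hasMulInverse.Build (lquat R)
  qmulVr qmulrV qunitP qinv_out.

End LquatRing.

Arguments qI {R}.
Arguments qJ {R}.
Arguments qK {R}.

Fixpoint Ck (R : realType) (V W : normedModType R) (k : nat)
    (U : set V) (f : V -> W) : Prop :=
  match k with
  | 0%N => forall x, U x -> {for x, continuous f}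
  | k'.+1 => (forall x, U x -> differentiable f x) /\
             (forall v, Ck k' U (fun x => 'D_v f x))
  end.

(* Only meant for U open in a finite-dimensional V. *)
Definition smooth_on (R : realType) (V W : normedModType R)
    (U : set V) (f : V -> W) : Prop := forall k, Ck k U f.

Definition det2 (R : realType) (u v : R * R) : R := u.1 * v.2 - u.2 * v.1.

Record chart (R : realType) (M : topologicalType) := Chart {
  cdom : set M;
  cmap : M -> (R * R)%type;
  cinv : (R * R)%type -> M;
  cdom_open : open cdom;
  cimg_open : open (cmap @` cdom);
  cmapK : forall x, cdom x -> cinv (cmap x) = x;
  cmap_cont : forall x, cdom x -> {for x, continuous cmap};
  cinv_cont : forall z, (cmap @` cdom) z -> {for z, continuous cinv} }.

(* The orientation of M is the one in which all charts are positive. *)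
Record surface (R : realType) := Surface {
  spoint :> topologicalType;
  shausdorff : hausdorff_space spoint;
  scountable : @second_countable spoint;
  satlas : set (chart R spoint);
  schart : spoint -> chart R spoint;
  schart_atlas : forall x, satlas (schart x);
  schart_dom : forall x, cdom (schart x) x;
  strans_smooth : forall c c', satlas c -> satlas c' ->
    smooth_on (cmap c @` (cdom c `&` cdom c')) (cmap c' \o cinv c);
  strans_pos : forall c c' x, satlas c -> satlas c' -> cdom c x -> cdom c' x ->
    0 < det2 ('d (cmap c' \o cinv c) (cmap c x) (1, 0))
             ('d (cmap c' \o cinv c) (cmap c x) (0, 1)) }.

Definition simply_connected (R : realType) (M : topologicalType) : Prop :=
  let I01 : set R := [set t | 0 <= t <= 1] in
  (forall x y : M, exists c : R -> M,
     {within I01, continuous c} /\ c 0 = x /\ c 1 = y) /\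
  (forall c : R -> M, {within I01, continuous c} -> c 0 = c 1 ->
     exists h : R * R -> M,
       {within I01 `*` I01, continuous h} /\
       (forall t, I01 t -> h (0, t) = c t /\ h (1, t) = c 0) /\
       (forall r, I01 r -> h (r, 0) = c 0 /\ h (r, 1) = c 0)).

Section Surface.
Variables (R : realType) (M : surface R).

(* T_x M is R * R, a tangent vector at x being given by its coordinates in the
   chart [schart M x]. *)
Definition mdiff (W : normedModType R) (f : M -> W) (x : M) (u : R * R) : W :=
  'd (f \o cinv (schart x)) (cmap (schart x) x) u.

Definition msmooth (W : normedModType R) (U : set M) (f : M -> W) : Prop :=
  forall c, satlas c -> smooth_on (cmap c @` (cdom c `&` U)) (f \o cinv c).

(* Smooth vector fields on U: smooth components in every chart. *)
Definition tsmooth (U : set M) (X : M -> (R * R)%type) : Prop :=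
  forall c : chart R M, satlas c ->
    msmooth (U `&` cdom c) (fun x => mdiff (cmap c) x (X x)).

(* Z = [X, Y] on U. *)
Definition is_bracket (U : set M) (X Y Z : M -> (R * R)%type) : Prop :=
  forall (V : set M) (f : M -> R), open V -> V `<=` U -> msmooth V f ->
    forall x, V x ->
      mdiff f x (Z x) = mdiff (fun y => mdiff f y (Y y)) x (X x)
                      - mdiff (fun y => mdiff f y (X y)) x (Y x).

(* Every fibre is identified with R * R by some positive linear isomorphism,
   with no regularity in x; the smooth structure is carried by the local
   trivializations [vtriv i x], read in these identifications.  [vcompat] is
   the smoothness of the transition maps, expressed on sections. *)
Record vbundle := VBundle {
  vidx : Type;
  vdom : vidx -> set M;
  vtriv : vidx -> M -> R * R -> (R * R)%type;
  vdom_open : forall i, open (vdom i);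
  vcover : forall x, exists i, vdom i x;
  vlin : forall i x, vdom i x -> forall (a : R) u v,
    vtriv i x (a *: u + v) = a *: vtriv i x u + vtriv i x v;
  vpos : forall i x, vdom i x -> 0 < det2 (vtriv i x (1, 0)) (vtriv i x (0, 1));
  vcompat : forall i j (U : set M) (s : M -> (R * R)%type),
    open U -> U `<=` vdom i `&` vdom j ->
    msmooth U (fun x => vtriv i x (s x)) ->
    msmooth U (fun x => vtriv j x (s x)) }.

Definition vsmooth (E : vbundle) (U : set M) (s : M -> (R * R)%type) : Prop :=
  forall i, msmooth (U `&` @vdom E i) (fun x => @vtriv E i x (s x)).

(* The definitions below apply both to TM and to E; the bundle enters only
   through its predicate [sm] of smooth local sections. *)
Section Bundle.
Variable sm : set M -> (M -> (R * R)%type) -> Prop.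

Definition fibre_metric (h : M -> R * R -> R * R -> R) : Prop :=
  (forall x (a : R) u v w, h x (a *: u + v) w = a * h x u w + h x v w) /\
  (forall x u v, h x u v = h x v u) /\
  (forall x u, u != 0 -> 0 < h x u u) /\
  (forall U s t, open U -> sm U s -> sm U t ->
     msmooth U (fun x => h x (s x) (t x))).

(* [nabla x u s] is the covariant derivative at x, in the direction of the
   tangent vector u, of the section s; it is meaningful only when s is smooth
   near x. *)
Definition metric_connection (h : M -> R * R -> R * R -> R)
    (nabla : M -> R * R -> (M -> (R * R)%type) -> (R * R)%type) : Prop :=
  forall (U : set M) (s t : M -> (R * R)%type), open U -> sm U s -> sm U t ->
  (forall x (a : R) u v, U x ->
     nabla x (a *: u + v) s = a *: nabla x u s + nabla x v s) /\
  (forall x u, U x ->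
     nabla x u (fun y => s y + t y) = nabla x u s + nabla x u t) /\
  (forall (f : M -> R) x u, msmooth U f -> U x ->
     nabla x u (fun y => f y *: s y) = mdiff f x u *: s x + f x *: nabla x u s) /\
  ((forall y, U y -> s y = t y) -> forall x u, U x ->
     nabla x u s = nabla x u t) /\
  (forall X, tsmooth U X -> sm U (fun x => nabla x (X x) s)) /\
  (forall x u, U x -> mdiff (fun y => h y (s y) (t y)) x u =
     h x (nabla x u s) (t x) + h x (s x) (nabla x u t)).

Definition flat (nabla : M -> R * R -> (M -> (R * R)%type) -> (R * R)%type) :
    Prop :=
  forall (U : set M) (X Y Z s : M -> (R * R)%type), open U ->
    tsmooth U X -> tsmooth U Y -> tsmooth U Z -> is_bracket U X Y Z ->
    sm U s -> forall x, U x ->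
      nabla x (X x) (fun y => nabla y (Y y) s)
      - nabla x (Y x) (fun y => nabla y (X y) s) - nabla x (Z x) s = 0.

Definition pos_orthonormal (h : M -> R * R -> R * R -> R) (x : M)
    (e e' : R * R) : Prop :=
  h x e e = 1 /\ h x e' e' = 1 /\ h x e e' = 0 /\ 0 < det2 e e'.

(* A spin structure of the oriented Euclidean plane bundle.  Spin(2) is
   R / 2 pi Z and acts on the right through its parameter theta; theta covers
   the rotation of angle 2 theta, so that [sp_frame] is the two-fold covering
   of the bundle of positively oriented orthonormal frames.  [sp_triv] is local
   triviality: the bijection (y, theta) |-> (s y) theta from U x Spin(2) onto
   the part of the bundle over U is a homeomorphism. *)
Record spin_structure (h : M -> R * R -> R * R -> R) := SpinStructure {
  sp_tot :> topologicalType;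
  sp_proj : sp_tot -> M;
  sp_frame : sp_tot -> (R * R) * (R * R);
  sp_act : sp_tot -> R -> sp_tot;
  sp_frameP : forall q,
    pos_orthonormal h (sp_proj q) (sp_frame q).1 (sp_frame q).2;
  sp_act0 : forall q, sp_act q 0 = q;
  sp_actD : forall q a b, sp_act q (a + b) = sp_act (sp_act q a) b;
  sp_act_free : forall q a,
    sp_act q a = q <-> exists k : int, a = 2 * pi * k%:~R;
  sp_proj_act : forall q a, sp_proj (sp_act q a) = sp_proj q;
  sp_act_trans : forall q q', sp_proj q = sp_proj q' ->
    exists a, q' = sp_act q a;
  sp_frame_act : forall q a,
    sp_frame (sp_act q a) =
      (cos (2 * a) *: (sp_frame q).1 + sin (2 * a) *: (sp_frame q).2,
       - sin (2 * a) *: (sp_frame q).1 + cos (2 * a) *: (sp_frame q).2);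
  sp_triv : forall x, exists (U : set M) (s : M -> sp_tot),
    open U /\ U x /\ (forall y, U y -> sp_proj (s y) = y) /\
    sm U (fun y => (sp_frame (s y)).1) /\ sm U (fun y => (sp_frame (s y)).2) /\
    (forall z : M * R, U z.1 ->
       {for z, continuous (fun z : M * R => sp_act (s z.1) z.2)}) /\
    (forall W : set (M * R), open W -> W `<=` U `*` setT ->
       open ((fun z : M * R => sp_act (s z.1) z.2) @` W)) }.

(* A section is smooth iff it is a continuous lift of a smooth frame. *)
Definition spin_section (h : M -> R * R -> R * R -> R) (P : spin_structure h)
    (U : set M) (s : M -> P) : Prop :=
  (forall x, U x -> sp_proj (s x) = x) /\
  (forall x, U x -> {for x, continuous s}) /\
  sm U (fun x => (sp_frame (s x)).1) /\ sm U (fun x => (sp_frame (s x)).2).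

(* A section of the spin structure is parallel iff its frame is. *)
Definition parallel_section (h : M -> R * R -> R * R -> R)
    (nabla : M -> R * R -> (M -> (R * R)%type) -> (R * R)%type)
    (P : spin_structure h) (s : M -> P) : Prop :=
  spin_section setT s /\
  forall x u, nabla x u (fun y => (sp_frame (s y)).1) = 0 /\
              nabla x u (fun y => (sp_frame (s y)).2) = 0.

End Bundle.

Definition levi_civita (gM : M -> R * R -> R * R -> R)
    (nabla : M -> R * R -> (M -> (R * R)%type) -> (R * R)%type) : Prop :=
  metric_connection tsmooth gM nabla /\
  forall (U : set M) (X Y Z : M -> (R * R)%type), open U ->
    tsmooth U X -> tsmooth U Y -> tsmooth U Z -> is_bracket U X Y Z ->
    forall x, U x -> nabla x (X x) Y - nabla x (Y x) X = Z x.

Section Spinors.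
Variables (E : vbundle) (hE gM : M -> R * R -> R * R -> R).
Variables (nE nM : M -> R * R -> (M -> (R * R)%type) -> (R * R)%type).
Variables (PE : spin_structure (vsmooth E) hE) (PM : spin_structure tsmooth gM).

Definition rho (t2 t1 : R) : lquat R :=
  (cos t2 *: (1 : lquat R) + sin t2 *: qscale lsigma qI) *
  (cos t1 *: (1 : lquat R) + sin t1 *: qI).

(* A section phi of Sigma = (PE x_M PM) x H^A / rho, where (q u, xi) is
   identified with (q, rho(u) xi), is given by its coordinates
   phi (q2, q1) in all the spin frames (q2, q1) in PE x_M PM.  The values of
   phi at pairs which are not over the same point of M are irrelevant. *)
Definition spinor_section (phi : PE -> PM -> lquat R) : Prop :=
  (forall q2 q1, sp_proj q2 = sp_proj q1 -> forall t2 t1,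
     phi q2 q1 = rho t2 t1 * phi (sp_act q2 t2) (sp_act q1 t1)) /\
  (forall U (s2 : M -> PE) (s1 : M -> PM), open U ->
     spin_section U s2 -> spin_section U s1 ->
     msmooth U (fun x => phi (s2 x) (s1 x))).

(* Coordinates [X] in H^A, for X in E and for X in TM. *)
Definition coordE (q : PE) (X : R * R) : lquat R :=
  hE (sp_proj q) X (sp_frame q).1 *: qscale lsigma 1
  + hE (sp_proj q) X (sp_frame q).2 *: qI.
Definition coordM (q : PM) (X : R * R) : lquat R :=
  gM (sp_proj q) X (sp_frame q).1 *: qJ
  + gM (sp_proj q) X (sp_frame q).2 *: qK.

Definition clifford (X phi : lquat R) : lquat R := X * qhat phi.

(* Coordinates of nabla_u phi in the local section (s2, s1): the connection
   forms <nabla e_0, e_1> and <nabla e_2, e_3> act by the differential of rho,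
   one half coming from the double covering Spin(2) -> SO(2). *)
Definition spin_nabla (phi : PE -> PM -> lquat R) (s2 : M -> PE) (s1 : M -> PM)
    (x : M) (u : R * R) : lquat R :=
  mdiff (fun y => phi (s2 y) (s1 y)) x u
  + (hE x (nE x u (fun y => (sp_frame (s2 y)).1)) (sp_frame (s2 x)).2 / 2)
      *: (qscale lsigma qI * phi (s2 x) (s1 x))
  + (gM x (nM x u (fun y => (sp_frame (s1 y)).1)) (sp_frame (s1 x)).2 / 2)
      *: (qI * phi (s2 x) (s1 x)).

Definition dirac_eq (phi : PE -> PM -> lquat R) (Hv : M -> (R * R)%type) :
    Prop :=
  forall U (s2 : M -> PE) (s1 : M -> PM), open U ->
    spin_section U s2 -> spin_section U s1 -> forall x, U x ->
    let e2 := (sp_frame (s1 x)).1 in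
    let e3 := (sp_frame (s1 x)).2 in
    clifford (coordM (s1 x) e2) (spin_nabla phi s2 s1 x e2)
    + clifford (coordM (s1 x) e3) (spin_nabla phi s2 s1 x e3)
    = clifford (coordE (s2 x) (Hv x)) (phi (s2 x) (s1 x)).

Definition unit_spinor (phi : PE -> PM -> lquat R) : Prop :=
  forall q2 q1, sp_proj q2 = sp_proj q1 -> qform (phi q2 q1) (phi q2 q1) = 1.

Definition qpair (p q : lquat R) : lquat R := qbar q * p.

(* xi(X) = << X . phi, phi >>, computed in the spin frame (q2, q1). *)
Definition xi_form (phi : PE -> PM -> lquat R) (q2 : PE) (q1 : PM)
    (X : R * R) : lquat R :=
  qpair (clifford (coordM q1 X) (phi q2 q1)) (phi q2 q1).

(* The immersion F defined by phi satisfies dF = xi. *)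
Definition gauss_map (phi : PE -> PM -> lquat R) (G : M -> lquat R) : Prop :=
  forall q2 q1, sp_proj q2 = sp_proj q1 -> forall e2 e3,
    pos_orthonormal gM (sp_proj q1) e2 e3 ->
    G (sp_proj q1) = xi_form phi q2 q1 e2 * qhat (xi_form phi q2 q1 e3).

End Spinors.

Definition regular (G : M -> lquat R) : Prop :=
  forall x, injective (mdiff G x).

Definition induced_lorentz (G : M -> lquat R) (sig : M -> R * R -> (R * R)%type) :
    Prop :=
  (forall x (a : R) u v, sig x (a *: u + v) = a *: sig x u + sig x v) /\
  (forall x u, sig x (sig x u) = u) /\
  (forall x, sig x <> id /\ sig x <> -%R) /\
  (forall x u, mdiff G x (sig x u) = qscale lsigma (mdiff G x u)) /\
  (forall U X, open U -> tsmooth U X -> tsmooth U (fun x => sig x (X x))).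

Section LorentzCharts.
Variable sig : M -> R * R -> (R * R)%type.
Local Notation A := (lorentz R).

Definition conformal_on_surface (f : M -> lquat R) : Prop :=
  msmooth setT f /\
  forall x u, mdiff f x (sig x u) = qscale lsigma (mdiff f x u).

Definition conformal_on_lorentz (U : set A) (f : A -> A) : Prop :=
  smooth_on U f /\
  forall z, U z -> forall w : A, 'd f z (lsigma * w) = lsigma * 'd f z w.

Definition chart_diff (a : A -> M) (z : A) (w : A) : (R * R)%type :=
  'd (cmap (schart (a z)) \o a) z w.

Definition lorentz_chart (U : set A) (a : A -> M) : Prop :=
  open U /\ open (a @` U) /\
  (forall z, U z -> {for z, continuous a}) /\
  (forall c : chart R M, satlas c ->
     smooth_on (U `&` (a @^-1` cdom c)) (cmap c \o a)) /\
  (exists b : M -> A, (forall z, U z -> b (a z) = z) /\ msmooth (a @` U) b) /\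
  (forall z, U z -> forall w,
     chart_diff a z (lsigma * w) = sig (a z) (chart_diff a z w)).

Definition positive_chart (U : set A) (a : A -> M) : Prop :=
  forall z, U z -> 0 < det2 (chart_diff a z 1) (chart_diff a z lsigma).

(* df = f' da on U *)
Definition lorentz_deriv (U : set A) (f f' : A -> lquat R) : Prop :=
  forall z, U z -> differentiable f z /\
    forall w : A, 'd f z w = qscale w (f' z).

Definition adapted_chart (g : M -> lquat R) (U : set A) (a : A -> M)
    (g' : A -> lquat R) : Prop :=
  lorentz_chart U a /\ positive_chart U a /\
  lorentz_deriv U (g \o a) g' /\
  forall z, U z -> qform (g' z) (g' z) = 1.

End LorentzCharts.

Definition group_G : set (lorentz R -> lorentz R) :=
  [set t | exists b, (t = fun a => a + b) \/ (t = fun a => - a + b)].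

End Surface.

(* Main.v *)
Require Import Defs.
From HB Require Import structures.
From mathcomp Require Import all_boot all_order all_algebra.
From mathcomp Require Import all_classical all_reals all_analysis.
From mathcomp Require Import ring lra.
Set Implicit Arguments.
Unset Strict Implicit.
Unset Printing Implicit Defensive.
Import Order.TTheory GRing.Theory Num.Theory numFieldNormedType.Exports.
Local Open Scope classical_set_scope.
Local Open Scope ring_scope.

(* In the parallel spin frame the Dirac equation says that dg g^-1 = eta_1 J + eta_2 K
   with A-valued real-linear forms eta_i, and G = g^-1 I g gives
   dG = 2 g^-1 (eta_1 K - eta_2 J) g.  So G is regular exactly when g is an
   immersion, and g is conformal for the structure that makes G conformal.

   The two projections x + sigma y |-> x + y, x - y split A as R x R.  The
   corresponding components g_+ and g_- of g each depend on one null coordinate of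
   M only, and the condition H(g', g') = 1 says that these coordinates are the arc
   lengths of the curves g_+ and g_-, up to sign.  This gives the adapted charts;
   between two of them the transition map has differential t with t^2 = 1 and
   positive determinant, so t = 1 or t = -1.

   In an adapted chart g' g^-1 = p J + q K with p^2 + q^2 = 1.  The pair (p, q) is
   defined on M up to sign, hence (p^2 - q^2, 2 p q) is globally defined; its two
   circle-valued projections lift to real functions because M is simply connected,
   and psi is half of this lift, corrected by a sign. *)

(** * Smooth functions *)

(** The 1 and I parts of dg g^-1 vanish for different reasons: the former because g has constant
    norm, the latter because a normal vector has coordinates in the span of 1 and I, so that the J
    and K parts of the Dirac equation isolate the I parts of the two frame derivatives.

    The analytic core is to make coordinates of the surface out of the arc lengths. A null component
    of g is known only to have a differential that vanishes on a line field. Taking one coordinate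
    of g_+ and one of g_- as a map to the plane, the inverse function theorem straightens both line
    fields. A null component is then constant along segments in a ball, and translating it along
    them shows that its derivatives are constant there too; in that step first derivatives and the
    mean value theorem are enough.

    The angle psi is wanted on all of a chart domain, where loops may exist. Between charts (p, q)
    changes by a sign, which is why its square p + i q |-> (p + i q)^2 is lifted. The sign lost by
    halving is recovered as the scalar product of (p, q) with the halved direction, a continuous
    function on the domain. *)

Section Calculus.
Variable R : realType.
Implicit Types V W : normedModType R.

Lemma differentiable_near V W (f : V -> W) x : differentiable f x ->
  forall e : R, 0 < e ->
    \forall h \near (0 : V), `|f (h + x) - f x - 'd f x h| <= e * `|h|.
Proof.
move=> /diff_locally /eqaddoP df e e0.
by near=> h; rewrite -addrA -opprD; near: h; exact: df.
Unshelve. all: by end_near. Qed.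

Lemma is_diff_near V W (f : V -> W) x (L : {linear V -> W}) : continuous L ->
  (forall e : R, 0 < e ->
     \forall h \near (0 : V), `|f (h + x) - f x - L h| <= e * `|h|) ->
  is_diff x f L.
Proof.
move=> cL fL.
have fE : f \o shift x = cst (f x) + L +o_ 0 id.
  apply/eqaddoP => e e0.
  by near=> h; rewrite /= opprD addrA; near: h; exact: fL.
have dE := diff_unique cL fE.
by apply: DiffDef => //; apply/diff_locallyP; rewrite dE.
Unshelve. all: by end_near. Qed.

Lemma near_eq_is_diff V W (f g : V -> W) (df : V -> W) x :
  (\forall y \near x, f y = g y) -> is_diff x f df -> is_diff x g df.
Proof.
move=> fg fx; have [dfx dfE] := fx; rewrite -dfE.
apply: is_diff_near; first exact: diff_continuous.
move=> e e0; have fgx := nbhs_singleton fg.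
have fg0 : \forall h \near (0 : V), f (h + x) = g (h + x).
  by move: fg; rewrite (near_shift 0); apply: filterS => y; rewrite /= subr0.
near=> h; rewrite -fgx -(near fg0 h)//.
by near: h; exact: differentiable_near.
Unshelve. all: by end_near. Qed.

Lemma near_eq_differentiable V W (f g : V -> W) x :
  (\forall y \near x, f y = g y) -> differentiable f x -> differentiable g x.
Proof.
by move=> fg fx; have [] := near_eq_is_diff fg (differentiableP fx).
Qed.

Lemma near_eq_diff V W (f g : V -> W) x : (\forall y \near x, f y = g y) ->
  differentiable f x -> 'd g x = 'd f x :> (V -> W).
Proof.
by move=> fg fx; have [] := near_eq_is_diff fg (differentiableP fx).
Qed.

Lemma open_near (T : topologicalType) (U : set T) (x : T) : open U -> U x ->
  \forall y \near x, U y.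
Proof. by move=> oU Ux; apply: open_nbhs_nbhs. Qed.

Lemma Ck_sub V W k (U U' : set V) (f : V -> W) :
  U `<=` U' -> Ck k U' f -> Ck k U f.
Proof.
move=> UU'; elim: k f => [|k IH] f /=; first by move=> cf x /UU'; apply: cf.
by case=> df Df; split=> [x /UU' /df|v] //; apply: IH.
Qed.

Lemma Ck_ext V W k (U : set V) (f g : V -> W) : open U ->
  (forall x, U x -> f x = g x) -> Ck k U f -> Ck k U g.
Proof.
move=> oU; elim: k f g => [|k IH] f g fg /= => [cf x Ux|[df Df]].
  have nfg : \forall y \near x, f y = g y.
    by near do apply: fg; exact: open_near.
  rewrite /prop_for /continuous_at -(fg _ Ux).
  by apply: cvg_trans (cf x Ux); apply: near_eq_cvg; apply: filterS nfg.
have nfg x : U x -> \forall y \near x, f y = g y.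
  by move=> Ux; near do apply: fg; exact: open_near.
split=> [x Ux|v]; first by apply: near_eq_differentiable (df _ Ux); exact: nfg.
apply: IH (Df v) => x Ux; have gx := near_eq_differentiable (nfg _ Ux) (df _ Ux).
rewrite (deriveE v gx) (deriveE v (df _ Ux)).
exact (congr1 (fun L : V -> W => L v) (esym (near_eq_diff (nfg _ Ux) (df _ Ux)))).
Unshelve. all: by end_near. Qed.

(** [U'] need not be open: every clause of [Ck] is a pointwise condition on a function defined on
    all of [V]. *)
Lemma Ck_local V W k (U : set V) (f : V -> W) :
  (forall x, U x -> exists2 U' : set V, U' x & Ck k U' f) -> Ck k U f.
Proof.
elim: k f => [|k IH] f /= Uf; first by move=> x /Uf[U' U'x]; apply.
split=> [x /Uf[U' U'x [df _]]|v]; first exact: df.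
by apply: IH => x /Uf[U' U'x [_ Df]]; exists U'.
Qed.

Lemma Ck_pred V W k (U : set V) (f : V -> W) : Ck k.+1 U f -> Ck k U f.
Proof.
elim: k f => [|k IH] f [df Df]; first by move=> x /df /differentiable_continuous.
by split=> // v; apply: IH.
Qed.

Lemma Ck_cst V W k (U : set V) (c : W) : Ck k U (fun=> c).
Proof.
elim: k c => [|k IH] c /=; first by move=> x _; exact: cst_continuous.
split=> [x _|v]; first exact: differentiable_cst.
by rewrite (_ : 'D_v _ = fun=> 0) // funeqE => x; rewrite derive_cst.
Qed.

Lemma Ck_linear V W k (U : set V) (L : {linear V -> W}) : continuous L ->
  Ck k U L.
Proof.
case: k => [|k] cL /=; first by move=> x _; exact: cL.
split=> [x _|v]; first exact: linear_differentiable.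
rewrite (_ : 'D_v _ = fun=> L v); first exact: Ck_cst.
by rewrite funeqE => x; rewrite deriveE ?diff_lin//; exact: linear_differentiable.
Qed.

Lemma CkD V W k (U : set V) (f g : V -> W) : open U ->
  Ck k U f -> Ck k U g -> Ck k U (fun x => f x + g x).
Proof.
move=> oU; elim: k f g => [|k IH] f g /=.
  by move=> cf cg x Ux; apply: continuousD; [exact: cf|exact: cg].
move=> [df Df] [dg Dg]; split=> [x Ux|v].
  by apply: differentiableD; [exact: df|exact: dg].
apply: (@Ck_ext _ _ _ _ (fun x => 'D_v f x + 'D_v g x)) => //.
  by move=> x Ux; rewrite deriveD//; apply: diff_derivable; [exact: df|exact: dg].
exact: IH.
Qed.

Lemma Ck_linear_comp V W W' k (U : set V) (L : {linear W -> W'}) (f : V -> W) :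
  open U -> continuous L -> Ck k U f -> Ck k U (fun x => L (f x)).
Proof.
move=> oU cL; elim: k f => [|k IH] f /=.
  by move=> cf x Ux; apply: continuous_comp; [exact: cf|exact: cL].
move=> [df Df]; have dLf x : U x -> differentiable (L \o f) x.
  move=> Ux; apply: differentiable_comp; first exact: df.
  exact: linear_differentiable.
split=> // v; apply: (@Ck_ext _ _ _ _ (fun x => L ('D_v f x))) => //.
  move=> x Ux; rewrite !deriveE//; [|exact: (dLf x Ux)|exact: df].
  rewrite (diff_comp (df _ Ux)) /=; last exact: linear_differentiable.
  by rewrite diff_lin.
exact: IH.
Qed.

Lemma Ck_pair V W W' k (U : set V) (f : V -> W) (g : V -> W') : open U ->
  Ck k U f -> Ck k U g -> Ck k U (fun x => (f x, g x)).
Proof.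
move=> oU; elim: k f g => [|k IH] f g /=.
  by move=> cf cg x Ux; apply: cvg_pair; [exact: cf|exact: cg].
move=> [df Df] [dg Dg]; split=> [x Ux|v].
  by apply: differentiable_pair; [exact: df|exact: dg].
apply: (@Ck_ext _ _ _ _ (fun x => ('D_v f x, 'D_v g x))) => //; last exact: IH.
move=> x Ux; rewrite !deriveE ?diff_pair//; try exact: df; try exact: dg.
by apply: differentiable_pair; [exact: df|exact: dg].
Qed.

Lemma scale_is_bilinear W :
  bilinear_for
    (GRing.Scale.Law.clone _ _ *:%R _) (GRing.Scale.Law.clone _ _ *:%R _)
    (@GRing.scale R W).
Proof.
split=> [u'|u] a x y /=.
- by rewrite scalerDl scalerA.
- by rewrite scalerDr !scalerA mulrC.
Qed.

HB.instance Definition _ W := bilinear_isBilinear.Build R R W W _ _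
  (@GRing.scale R W) (scale_is_bilinear W).

Lemma is_diff_scale V W (k : V -> R) (f : V -> W) x :
  differentiable k x -> differentiable f x ->
  is_diff x (fun y => k y *: f y) (fun v => k x *: 'd f x v + 'd k x v *: f x).
Proof.
move=> dk df.
have cs : continuous (fun p : R * W => p.1 *: p.2).
  by move=> p; apply: continuousZ; [exact: cvg_fst|exact: cvg_snd].
have dp := differentiable_pair dk df.
have db := @differentiable_bilin _ _ _ _ (@GRing.scale R W) (k x, f x) cs.
have -> : (fun y => k y *: f y) = (fun p : R * W => p.1 *: p.2) \o
  (fun y => (k y, f y)) by [].
apply: DiffDef; first exact: differentiable_comp.
by rewrite diff_comp // diff_bilin// diff_pair.
Qed.

Lemma Ck_scale V W k (U : set V) (c : V -> R) (f : V -> W) : open U ->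
  Ck k U c -> Ck k U f -> Ck k U (fun x => c x *: f x).
Proof.
move=> oU; elim: k c f => [|k IH] c f.
  by move=> cc cf x Ux; apply: continuousZ; [exact: cc|exact: cf].
move=> Cc Cf; have [[dc Dc] [df Df]] := (Cc, Cf).
have dcf x : U x -> is_diff x (fun y => c y *: f y) _ :=
  fun Ux => is_diff_scale (dc _ Ux) (df _ Ux).
split=> [x /dcf[]//|v].
apply: (@Ck_ext _ _ _ _ (fun x => c x *: 'D_v f x + 'D_v c x *: f x)) => //.
  move=> x Ux; have [d dE] := dcf _ Ux; rewrite [RHS]deriveE// dE.
  by rewrite (deriveE v (dc _ Ux)) (deriveE v (df _ Ux)).
by apply: CkD => //; [exact: IH (Ck_pred Cc) (Df v)|exact: IH (Dc v) (Ck_pred Cf)].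
Qed.

Lemma CkM V k (U : set V) (f g : V -> R) : open U ->
  Ck k U f -> Ck k U g -> Ck k U (fun x => f x * g x).
Proof. exact: Ck_scale. Qed.

Lemma CkZ V W k (U : set V) (c : R) (f : V -> W) : open U ->
  Ck k U f -> Ck k U (fun x => c *: f x).
Proof. by move=> oU; apply: Ck_scale => //; exact: Ck_cst. Qed.

Lemma CkN V W k (U : set V) (f : V -> W) : open U ->
  Ck k U f -> Ck k U (fun x => - f x).
Proof.
move=> oU /(CkZ (-1) oU); apply: Ck_ext => // x _; by rewrite scaleN1r.
Qed.

(** The derivative of 1/f is -f^-2 f', again built from 1/f but needed to one order less, so an
    induction on [k] closes. [Ck_sqrt] rests on the same remark. *)
Lemma CkV V k (U : set V) (f : V -> R) : open U -> (forall x, U x -> f x != 0) ->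
  Ck k U f -> Ck k U (fun x => (f x)^-1).
Proof.
move=> oU f0; elim: k => [|k IH].
  by move=> cf x Ux; apply: continuousV; [exact: f0|exact: cf].
move=> Cf; have [df Df] := Cf; split=> [x Ux|v].
  exact: differentiableV (df _ Ux) (f0 _ Ux).
have CV := IH (Ck_pred Cf).
apply: (@Ck_ext _ _ _ _ (fun x => - (((f x)^-1 * (f x)^-1) * 'D_v f x))) => //.
  move=> x Ux; rewrite deriveV ?f0//; last by apply: diff_derivable; exact: df.
  by rewrite expr2 invfM scaleNr.
exact: CkN oU (CkM oU (CkM oU CV CV) (Df v)).
Qed.

Lemma diff_compE V W W' (f : V -> W) (h : W -> W') x v :
  differentiable f x -> differentiable h (f x) ->
  'd (fun y => h (f y)) x v = 'd h (f x) ('d f x v).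
Proof.
move=> df dh; exact (congr1 (fun L : V -> W' => L v) (diff_comp df dh)).
Qed.

Lemma differentiable_real_comp V (f : V -> R) (h : R -> R) (x : V) (d : R) :
  differentiable f x -> is_derive (f x) 1 h d ->
  differentiable (fun y => h (f y)) x.
Proof.
move=> df [/derivable1_diffP dh _]; exact: differentiable_comp df dh.
Qed.

Lemma diff_real_comp V (f : V -> R) (h : R -> R) (x : V) (d : R) v :
  differentiable f x -> is_derive (f x) 1 h d ->
  'd (fun y => h (f y)) x v = d * 'd f x v.
Proof.
move=> df hd; have [/derivable1_diffP dh hE] := hd.
rewrite (diff_compE v df dh); set a := 'd f x v.
have -> : 'd h (f x) a = a *: 'd h (f x) 1 by rewrite -linearZ /GRing.scale/= mulr1.
by rewrite -(deriveE (1 : R) dh) hE mulrC.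
Qed.

Lemma Ck_sqrt V k (U : set V) (f : V -> R) : open U -> (forall x, U x -> 0 < f x) ->
  Ck k U f -> Ck k U (fun x => Num.sqrt (f x)).
Proof.
move=> oU f0; elim: k => [|k IH].
  by move=> cf x Ux; apply: continuous_comp; [exact: cf|exact: sqrt_continuous].
move=> Cf; have [df Df] := Cf.
have ds x : U x -> is_derive (f x) 1 Num.sqrt (2 * Num.sqrt (f x))^-1.
  by move=> Ux; apply: is_derive1_sqrt; exact: f0.
have dsf x : U x -> differentiable (fun y => Num.sqrt (f y)) x.
  by move=> Ux; apply: differentiable_real_comp (df _ Ux) (ds _ Ux).
split=> // v.
have Cs := IH (Ck_pred Cf).
apply: (@Ck_ext _ _ _ _ (fun x => (2 * Num.sqrt (f x))^-1 * 'D_v f x)) => //.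
  move=> x Ux; rewrite (deriveE v (dsf _ Ux)) (deriveE v (df _ Ux)).
  exact (esym (diff_real_comp v (df _ Ux) (ds _ Ux))).
apply: CkM oU (CkV oU _ (CkM oU (Ck_cst _ _ _) Cs)) (Df v) => x Ux.
by rewrite mulf_neq0 ?pnatr_eq0// gt_eqF// sqrtr_gt0 f0.
Qed.

Lemma linear_prodE W (L : {linear (R * R)%type -> W}) v :
  L v = v.1 *: L (1, 0) + v.2 *: L (0, 1).
Proof.
rewrite -!linearZ -linearD; congr (L _).
by case: v => a b; congr pair => /=;
  rewrite /GRing.scale/= ?mulr1 ?mulr0 ?addr0 ?add0r.
Qed.

Lemma diff_prodE W (f : R * R -> W) x v :
  'd f x v = v.1 *: 'd f x (1, 0) + v.2 *: 'd f x (0, 1).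
Proof. exact: linear_prodE. Qed.

Lemma fst_continuous (V W : normedModType R) : continuous (@fst V W).
Proof. by move=> x; exact: cvg_fst. Qed.
Lemma snd_continuous (V W : normedModType R) : continuous (@snd V W).
Proof. by move=> x; exact: cvg_snd. Qed.

Lemma Ck_fst V W W' k (U : set V) (f : V -> W * W') : open U ->
  Ck k U f -> Ck k U (fun x => (f x).1).
Proof. by move=> oU; apply: (Ck_linear_comp (L := fst)) => //; exact: fst_continuous. Qed.

Lemma Ck_snd V W W' k (U : set V) (f : V -> W * W') : open U ->
  Ck k U f -> Ck k U (fun x => (f x).2).
Proof. by move=> oU; apply: (Ck_linear_comp (L := snd)) => //; exact: snd_continuous. Qed.

(** With the plane as middle space, the derivative of the composite combines the two partial
    derivatives of [f] at [p x] with derivatives of [p] as coefficients; each factor is needed to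
    one order less. *)
Lemma Ck_comp V W k (U : set V) (U' : set (R * R)) (p : V -> R * R)
    (f : R * R -> W) : open U -> (forall x, U x -> U' (p x)) ->
  Ck k U p -> Ck k U' f -> Ck k U (f \o p).
Proof.
move=> oU UU'; elim: k f => [|k IH] f.
  move=> cp cf x Ux; apply: continuous_comp; first exact: cp.
  by apply: cf; exact: UU'.
move=> Cp [df Df]; have [dp Dp] := Cp.
have dfp x : U x -> differentiable (f \o p) x.
  by move=> Ux; apply: differentiable_comp; [exact: dp|apply: df; exact: UU'].
split=> // v; apply: (@Ck_ext _ _ _ _ (fun x => ('D_v p x).1 *: 'D_(1, 0) f (p x) +
   ('D_v p x).2 *: 'D_(0, 1) f (p x))) => //.
  move=> x Ux; have dfx := df _ (UU' _ Ux); have dpx := dp _ Ux.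
  rewrite (deriveE v (dfp _ Ux)) (deriveE v dpx) !(deriveE _ dfx) (diff_compE v dpx dfx).
  by rewrite [RHS]diff_prodE.
have Cp' := Ck_pred Cp; apply: CkD => //.
  exact: Ck_scale oU (Ck_fst oU (Dp v)) (IH _ Cp' (Df _)).
exact: Ck_scale oU (Ck_snd oU (Dp v)) (IH _ Cp' (Df _)).
Qed.

End Calculus.

(** * The inverse function theorem in the plane *)

Section LinesAndPlanes.
Variable R : realType.
Implicit Types V W : normedModType R.

Lemma near_normP V (x : V) (P : V -> Prop) : (\forall y \near x, P y) <->
  exists2 e : R, 0 < e & forall y, `|y - x| < e -> P y.
Proof.
split=> [/nbhs_ballP[e e0 eP]|[e e0 eP]].
  by exists e => // y yx; apply: eP; rewrite -ball_normE /= distrC.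
by apply/nbhs_ballP; exists e => // y; rewrite -ball_normE /= distrC; exact: eP.
Qed.

Lemma line_diff V (x v : V) (t : R) : is_diff t (fun s : R => x + s *: v) (fun s => s *: v).
Proof.
have [d dE] := is_diffD (is_diff_cst x t) (is_diff_scalel t v).
apply: DiffDef; first exact: d.
by apply: (etrans dE); rewrite funeqE => s; exact: add0r.
Qed.

Lemma is_derive_line V W (f : V -> W) (x v : V) (t : R) : differentiable f (x + t *: v) ->
  is_derive t 1 (fun s : R => f (x + s *: v)) ('d f (x + t *: v) v).
Proof.
move=> df; have [dl lE] := line_diff x v t.
have dc : differentiable (fun s : R => f (x + s *: v)) t by exact: differentiable_comp dl df.
apply: DeriveDef; first exact: diff_derivable.
rewrite (deriveE (1 : R) dc) (diff_compE (1 : R) dl df); congr ('d f _ _).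
by rewrite lE scale1r.
Qed.

Lemma mean_value_line V (f : V -> R) (x v : V) :
  (forall t, 0 <= t <= 1 -> differentiable f (x + t *: v)) ->
  exists2 t, 0 <= t <= 1 & f (x + v) - f x = 'd f (x + t *: v) v.
Proof.
move=> df.
have dl (t : R) : 0 <= t <= 1 -> is_derive t 1 (fun s : R => f (x + s *: v)) _ :=
  fun t01 => is_derive_line (df t t01).
have [||t t01 ft] := @MVT_segment R (fun s : R => f (x + s *: v))
    (fun t => 'd f (x + t *: v) v) 0 1 ler01.
- by move=> t; rewrite in_itv/= => /andP[t0 t1]; apply: dl; rewrite !ltW.
- apply: continuous_in_subspaceT => t; rewrite inE/= in_itv/= => t01.
  by apply/differentiable_continuous/derivable1_diffP; have [] := dl t t01.
exists t; first by move: t01; rewrite in_itv.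
by move: ft; rewrite scale1r scale0r addr0 subr0 mulr1.
Qed.

(** Convexity of the open ball: the point is a barycentre of [x] and [x + v]. The case t = 0 is
    apart because the strict inequality is carried by the factor t. *)
Lemma segment_dist V (p x v : V) (t r : R) : 0 <= t <= 1 ->
  `|x - p| < r -> `|x + v - p| < r -> `|x + t *: v - p| < r.
Proof.
move=> /andP[t0 t1] xr xvr.
have -> : x + t *: v - p = (1 - t) *: (x - p) + t *: (x + v - p).
  by rewrite [x + v - p]addrAC [t *: (_ + v)]scalerDr addrA -scalerDl subrK scale1r addrAC.
apply: le_lt_trans (ler_normD _ _) _; rewrite !normrZ ger0_norm ?subr_ge0//.
rewrite (ger0_norm t0).
have [->|tn0] := eqVneq t 0; first by rewrite subr0 mul1r mul0r addr0.
have -> : r = (1 - t) * r + t * r by rewrite -mulrDl subrK mul1r.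
apply: ler_ltD; first by rewrite ler_wpM2l ?subr_ge0// ltW.
by rewrite ltr_pM2l// lt_def tn0.
Qed.

(** Cramer's rule for the coordinates of [w] in the basis (a, b), hence the inverse of the linear
    map with columns [a] and [b]. Division by zero being zero, it is linear in [w] without any
    condition on the determinant. *)
Definition cramer (a b w : R * R) : R * R :=
  ((w.1 * b.2 - w.2 * b.1) / det2 a b, (a.1 * w.2 - a.2 * w.1) / det2 a b).

Lemma cramerK (a b w : R * R) : det2 a b != 0 ->
  (cramer a b w).1 *: a + (cramer a b w).2 *: b = w.
Proof.
case: a b w => [a1 a2] [b1 b2] [w1 w2]; rewrite /det2 /cramer /det2 /= => d0.
by congr pair; rewrite /= /GRing.scale/=; field.
Qed.

Lemma cramer_comb (a b h : R * R) : det2 a b != 0 ->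
  cramer a b (h.1 *: a + h.2 *: b) = h.
Proof.
case: a b h => [a1 a2] [b1 b2] [h1 h2]; rewrite /det2 /cramer /det2 /= => d0.
by congr pair; rewrite /= /GRing.scale/=; field.
Qed.

Lemma cramer_linear a b : linear (cramer a b).
Proof.
move=> k [u1 u2] [v1 v2]; rewrite /cramer.
by congr pair; rewrite /= /GRing.scale/=; ring.
Qed.

HB.instance Definition _ a b :=
  GRing.isLinear.Build R (R * R)%type (R * R)%type _ (cramer a b) (cramer_linear a b).

Lemma linear_prod_continuous W (L : {linear (R * R)%type -> W}) : continuous L.
Proof.
have -> : (L : R * R -> W) = fun v => v.1 *: L (1, 0) + v.2 *: L (0, 1).
  by rewrite funeqE => v; exact: linear_prodE.
by move=> v; apply: cvgD; apply: cvgZ; rewrite ?[_ @ _]/=;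
  (exact: cvg_cst || exact: fst_continuous || exact: snd_continuous).
Qed.

Lemma cramer_bound a b : exists2 k : R, 0 < k & forall w, `|cramer a b w| <= k * `|w|.
Proof. exact: linear_lipschitz (@linear_prod_continuous _ (cramer a b)). Qed.

Lemma diff_linear_comp (V W W' : normedModType R) (L : {linear W -> W'}) (f : V -> W) x :
  continuous L -> differentiable f x ->
  differentiable (fun y => L (f y)) x /\ forall v, 'd (fun y => L (f y)) x v = L ('d f x v).
Proof.
move=> cL df; have dL := linear_differentiable (f x) cL; split.
  exact: differentiable_comp df dL.
move=> v; apply: (etrans (diff_compE v df dL)).
exact (congr1 (fun l : W -> W' => l ('d f x v)) (diff_lin (f x) cL)).
Qed.

Lemma diff_fst W W' (f : R * R -> W * W') x v : differentiable f x ->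
  differentiable (fun y => (f y).1) x /\ 'd (fun y => (f y).1) x v = ('d f x v).1.
Proof. by move=> df; have [d E] := diff_linear_comp (@fst_continuous R W W') df; split. Qed.

Lemma diff_snd W W' (f : R * R -> W * W') x v : differentiable f x ->
  differentiable (fun y => (f y).2) x /\ 'd (fun y => (f y).2) x v = ('d f x v).2.
Proof. by move=> df; have [d E] := diff_linear_comp (@snd_continuous R W W') df; split. Qed.

End LinesAndPlanes.

(** * Injectivity near a point where the differential is invertible *)

Section LocalInjectivity.
Variable R : realType.
Implicit Types (f : R * R -> R * R) (U : set (R * R)).

Lemma norm_fst (V W : normedModType R) (x : V * W) : `|x.1| <= `|x|.
Proof. by rewrite prod_normE le_max lexx. Qed.
Lemma norm_snd (V W : normedModType R) (x : V * W) : `|x.2| <= `|x|.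
Proof. by rewrite prod_normE le_max lexx orbT. Qed.

Lemma derive_near (V W : normedModType R) (U : set V) (h : V -> W) p v (e : R) :
  open U -> U p -> Ck 1 U h -> 0 < e ->
  \forall x \near p, `|'d h x v - 'd h p v| <= e.
Proof.
move=> oU Up [dh Dh] e0; have /cvgrPdist_le/(_ _ e0) := Dh v _ Up.
move=> ch; near=> x; have Ux : U x by near: x; exact: open_near.
rewrite -(deriveE v (dh _ Ux)) -(deriveE v (dh _ Up)) distrC.
by near: x.
Unshelve. all: by end_near. Qed.

Lemma linear_prod_dist (W : normedModType R) (A B : {linear (R * R)%type -> W}) v (e : R) :
  `|A (1, 0) - B (1, 0)| <= e -> `|A (0, 1) - B (0, 1)| <= e ->
  `|A v - B v| <= 2 * e * `|v|.
Proof.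
move=> e1 e2; rewrite (linear_prodE A) (linear_prodE B) opprD addrACA -!scalerBr.
apply: le_trans (ler_normD _ _) _; rewrite !normrZ -mulrA mulr_natl mulr2n (mulrC e).
by apply: lerD; apply: ler_pM => //; [exact: norm_fst|exact: norm_snd].
Qed.

(** The mean value theorem is an equality for real functions only, so the two components of [f] are
    treated apart, with intermediate points that differ in general; [pair_dist] puts the two
    estimates together in the maximum norm. *)
Lemma mean_value_fst f (x v : R * R) :
  (forall t, 0 <= t <= 1 -> differentiable f (x + t *: v)) ->
  exists2 t, 0 <= t <= 1 & (f (x + v)).1 - (f x).1 = ('d f (x + t *: v) v).1.
Proof.
move=> df; have [|t t01 /= e] := @mean_value_line _ _ (fun y => (f y).1) x v.
  by move=> t /df/(diff_fst v)[].
by exists t => //; apply: (etrans e); have [_] := diff_fst v (df t t01).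
Qed.

Lemma mean_value_snd f (x v : R * R) :
  (forall t, 0 <= t <= 1 -> differentiable f (x + t *: v)) ->
  exists2 t, 0 <= t <= 1 & (f (x + v)).2 - (f x).2 = ('d f (x + t *: v) v).2.
Proof.
move=> df; have [|t t01 /= e] := @mean_value_line _ _ (fun y => (f y).2) x v.
  by move=> t /df/(diff_snd v)[].
by exists t => //; apply: (etrans e); have [_] := diff_snd v (df t t01).
Qed.

Lemma pair_dist (V W : normedModType R) (w B : V * W) (e : R) :
  (exists2 A : V * W, w.1 = A.1 & `|A - B| <= e) ->
  (exists2 A : V * W, w.2 = A.2 & `|A - B| <= e) -> `|w - B| <= e.
Proof.
move=> [A1 e1 A1B] [A2 e2 A2B]; rewrite prod_normE ge_max /= e1 e2; apply/andP.
split; [exact: le_trans (norm_fst (A1 - B)) A1B|exact: le_trans (norm_snd (A2 - B)) A2B].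
Qed.

(** If |v| <= k |df_p v|, it is enough to keep the differential within |v| / (2 k) of df_p v: then f
    (x + v) - f x differs from df_p v by at most half of its lower bound |v| / k. The tolerance 1 /
    (4 k) is set on the two basis vectors, and [linear_prod_dist] doubles it. *)
Lemma expansive_near U f p : open U -> U p -> Ck 1 U f ->
  det2 ('d f p (1, 0)) ('d f p (0, 1)) != 0 ->
  exists m r : R, [/\ 0 < m, 0 < r, forall x, `|x - p| < r -> U x &
    forall x v, `|x - p| < r -> `|x + v - p| < r ->
      m * `|v| <= `|f (x + v) - f x|].
Proof.
move=> oU Up Cf d0; have [df Df] := Cf.
have [k k0 kP] := cramer_bound ('d f p (1, 0)) ('d f p (0, 1)).
have k4 : 0 < (4 * k)^-1 by rewrite invr_gt0 mulr_gt0.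
have /near_normP[r r0 rP] : \forall x \near p, [/\ U x,
    `|'d f x (1, 0) - 'd f p (1, 0)| <= (4 * k)^-1 &
    `|'d f x (0, 1) - 'd f p (0, 1)| <= (4 * k)^-1].
  have n1 : \forall x \near p, U x by exact (open_near oU Up).
  have n2 v := derive_near v oU Up Cf k4.
  by apply: filterS3 n1 (n2 (1, 0)) (n2 (0, 1)).
exists (2 * k)^-1, r; split=> // [|x /rP[]//|x v xr xvr].
  by rewrite invr_gt0 mulr_gt0.
have Lv : `|v| <= k * `|'d f p v|.
  by rewrite -{1}(cramer_comb v d0) -(diff_prodE f p v); exact: kP.
have near_d t : 0 <= t <= 1 ->
    differentiable f (x + t *: v) /\
    `|'d f (x + t *: v) v - 'd f p v| <= (2 * k)^-1 * `|v|.
  move=> t01; have [Ux d1 d2] := rP _ (segment_dist t01 xr xvr).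
  split; first exact: df.
  apply: le_trans (linear_prod_dist v d1 d2) _.
  by rewrite le_eqVlt; apply/orP; left; apply/eqP; field; rewrite gt_eqF.
have dist : `|f (x + v) - f x - 'd f p v| <= (2 * k)^-1 * `|v|.
  apply: pair_dist.
    have [t t01 e] := mean_value_fst (fun t t01 => (near_d t t01).1).
    exists ('d f (x + t *: v) v); [exact e|exact (near_d _ t01).2].
  have [t t01 e] := mean_value_snd (fun t t01 => (near_d t t01).1).
  exists ('d f (x + t *: v) v); [exact e|exact (near_d _ t01).2].
have Lv' : k^-1 * `|v| <= `|'d f p v| by rewrite ler_pdivrMl.
have tri (w A : R * R) : `|A| <= `|w - A| + `|w|.
  by have := ler_normB w (w - A); rewrite subKr addrC.
have e2 : k^-1 * `|v| = (2 * k)^-1 * `|v| + (2 * k)^-1 * `|v|.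
  by field; rewrite gt_eqF.
have := tri (f (x + v) - f x) ('d f p v); move: dist Lv'.
move: (f (x + v) - f x) ('d f p v) => w A; clear -e2; lra.
Qed.

Lemma compact_cball (p : R * R) (r : R) : compact [set x | `|x - p| <= r].
Proof.
have -> : [set x | `|x - p| <= r] = `[p.1 - r, p.1 + r] `*` `[p.2 - r, p.2 + r].
  apply/seteqP; split=> x /=; rewrite prod_normE ge_max !ler_distl /= !in_itv/=.
    by move=> /andP[].
  by move=> [-> ->].
by apply: compact_setX; exact: segment_compact.
Qed.

End LocalInjectivity.

(** * Surjectivity onto a ball, by minimizing a distance *)

Section LocalSurjectivity.
Variable R : realType.
Implicit Types (f : R * R -> R * R) (U : set (R * R)).

Lemma diff_sq (V : normedModType R) (h : V -> R) x :
  differentiable h x ->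
  differentiable (fun y => h y * h y) x /\
  forall v, 'd (fun y => h y * h y) x v = 2 * (h x * 'd h x v).
Proof.
move=> dh; have [d dE] := is_diff_scale dh dh; split=> // v.
apply: (etrans (congr1 (fun L => L v) dE)).
by rewrite /GRing.scale/= mulrC -mulr2n mulr_natl mulrC.
Qed.

Lemma diff_subc (V : normedModType R) (h : V -> R) (c : R) x :
  differentiable h x ->
  differentiable (fun y => h y - c) x /\
  forall v, 'd (fun y => h y - c) x v = 'd h x v.
Proof.
move=> dh; have [d dE] := is_diffD (differentiableP dh) (is_diff_cst (- c) x).
split; first exact d.
move=> v; exact (etrans (congr1 (fun L => L v) dE) (addr0 _)).
Qed.

Definition sqdist f (y x : R * R) : R :=
  ((f x).1 - y.1) * ((f x).1 - y.1) + ((f x).2 - y.2) * ((f x).2 - y.2).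

Lemma diff_sqdist f y x : differentiable f x ->
  differentiable (sqdist f y) x /\ forall v, 'd (sqdist f y) x v =
    2 * (((f x).1 - y.1) * ('d f x v).1) + 2 * (((f x).2 - y.2) * ('d f x v).2).
Proof.
move=> df.
have [d1 D1] := diff_subc y.1 (diff_fst 0 df).1.
have [d2 D2] := diff_subc y.2 (diff_snd 0 df).1.
have [s1 S1] := diff_sq d1; have [s2 S2] := diff_sq d2.
have [d dE] := is_diffD (differentiableP s1) (differentiableP s2).
split; first exact d.
move=> v; apply: (etrans (congr1 (fun L => L v) dE)).
have e1 := etrans (D1 v) (diff_fst v df).2.
have e2 := etrans (D2 v) (diff_snd v df).2.
have S1v := etrans (S1 v) (congr1 (fun t => 2 * (((f x).1 - y.1) * t)) e1).
have S2v := etrans (S2 v) (congr1 (fun t => 2 * (((f x).2 - y.2) * t)) e2).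
exact (congr2 +%R S1v S2v).
Qed.

Lemma diff_local_min (V : normedModType R) (d : V -> R) (c : V) (r : R) v : 0 < r ->
  (forall x, `|x - c| < r -> differentiable d x /\ d c <= d x) -> 'd d c v = 0.
Proof.
move=> r0 dP; set e := r / (`|v| + 1).
have v1 : 0 < `|v| + 1 by rewrite ltr_wpDl.
have e0 : 0 < e by rewrite divr_gt0.
have inr t : t \in `](- e), e[ -> `|c + t *: v - c| < r.
  rewrite in_itv/= => te; rewrite addrC addKr normrZ.
  have te' : `|t| < e by rewrite ltr_norml.
  apply: le_lt_trans (_ : `|t| * (`|v| + 1) < r); first by rewrite ler_wpM2l// lerDl.
  by rewrite -ltr_pdivlMr.
have dl t : t \in `](- e), e[ -> is_derive t 1 (fun s : R => d (c + s *: v)) _ :=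
  fun te => is_derive_line (dP _ (inr t te)).1.
have z0 : 0 \in `](- e), e[ by rewrite in_itv/= oppr_lt0 e0.
have [||||_ D0] := @derive1_at_min _ (fun s : R => d (c + s *: v)) (- e) e 0.
- by rewrite lerNl; apply: le_trans (ltW e0); rewrite oppr_le0 ltW.
- by move=> t /dl[].
- exact: z0.
- by move=> t /inr/dP[_]; rewrite scale0r addr0.
have [_] := dl _ z0; rewrite D0 scale0r addr0 => ->//.
Qed.

(** Excludes a minimum of the squared distance on the boundary of the ball, with k = m r: there some
    component of f c is at least k / 2 from that of f p, hence 3 k / 8 from that of y, and (3/8)^2
    exceeds 2 (1/8)^2, the bound at f p. The factor 2 comes from passing from the maximum norm to
    the Euclidean distance. *)
Lemma sq_dist_contra (c1 c2 p1 p2 y1 y2 k : R) : 0 < k ->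
  `|p2 - y2| <= k / 8 -> `|p1 - y1| <= k / 8 ->
  (k / 2 <= `|c1 - p1|) || (k / 2 <= `|c2 - p2|) ->
  ~ (c1 - y1) * (c1 - y1) + (c2 - y2) * (c2 - y2) <=
    (p1 - y1) * (p1 - y1) + (p2 - y2) * (p2 - y2).
Proof.
have small (u : R) : `|u| <= k / 8 -> u * u <= k * k / 64.
  by rewrite ler_norml => /andP[u1 u2]; nra.
have big (a b : R) : 0 < k -> `|b| <= k / 8 -> k / 2 <= `|a| -> 9 * (k * k / 64) <= (a + b) * (a + b).
  move=> k0; rewrite ler_norml ler_normr => /andP[b1 b2] /orP[] a1; nra.
move=> k0 s2 s1 h le; have [/small t1 /small t2] := (s1, s2).
have kk : 0 < k * k by exact: mulr_gt0.
have q1 : 0 <= (c1 - y1) * (c1 - y1) by rewrite -expr2 sqr_ge0.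
have q2 : 0 <= (c2 - y2) * (c2 - y2) by rewrite -expr2 sqr_ge0.
case/orP: h => h; [have := big _ _ k0 s1 h|have := big _ _ k0 s2 h];
  rewrite addrA subrK => h'; lra.
Qed.

(* The preimage of y is a minimum point of |f x - y|^2 over a closed ball: at
   such a point the differential of the squared distance vanishes. *)
Lemma surjective_near U f p (m r : R) : open U -> Ck 1 U f -> 0 < m -> 0 < r ->
  (forall x, `|x - p| < r -> U x) ->
  (forall x v, `|x - p| < r -> `|x + v - p| < r -> m * `|v| <= `|f (x + v) - f x|) ->
  (forall x, U x -> det2 ('d f x (1, 0)) ('d f x (0, 1)) != 0) ->
  forall y, `|y - f p| < m * r / 8 -> exists2 x, `|x - p| < r / 2 & f x = y.
Proof.
move=> oU Cf m0 r0 rU exf df0 y yfp; have [df _] := Cf.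
have r20 : 0 < r / 2 by rewrite divr_gt0.
have rr : r / 2 < r by rewrite ltr_pdivrMr// ltr_pMr// ltr1n.
have [c] : exists2 c, c \in [set x | `|x - p| <= r / 2] &
    forall t, t \in [set x | `|x - p| <= r / 2] -> sqdist f y c <= sqdist f y t.
  apply: compact_EVT_min; first by exists p; rewrite /= subrr normr0 ltW.
    exact: compact_cball.
  apply: continuous_in_subspaceT => x; rewrite inE /= => xr.
  apply/differentiable_continuous/(diff_sqdist y (df _ _)).1/rU.
  exact: le_lt_trans xr rr.
rewrite inE /= => cr cmin.
have crr := le_lt_trans cr rr.
have cr' : `|c - p| < r / 2.
  (* On the boundary, expansiveness gives |f c - f p| >= m r / 2, so f p would be strictly closer to
     y than f c. *)
  rewrite lt_neqAle cr andbT; apply/eqP => cE.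
  have := cmin p; rewrite inE /= subrr normr0 ltW// => /(_ isT).
  have := exf p (c - p); rewrite subrr normr0 (addrC p) subrK cE => /(_ r0 rr).
  have fp : `|f p - y| < m * r / 8 by rewrite distrC.
  have := le_trans (norm_fst (f p - y)) (ltW fp).
  have := le_trans (norm_snd (f p - y)) (ltW fp).
  rewrite /sqdist [`|f c - f p|]prod_normE le_max /= mulrA.
  have k0 : 0 < m * r by exact: mulr_gt0.
  move: (f c).1 (f c).2 (f p).1 (f p).2 y.1 y.2 (m * r) k0.
  by move=> c1 c2 p1 p2 y1 y2 k k0; exact: sq_dist_contra.
exists c => //.
have near_c x : `|x - c| < r / 2 - `|c - p| -> `|x - p| < r / 2.
  move=> xc; have := ler_distD c x p; move: xc; lra.
have dc v : 'd (sqdist f y) c v = 0.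
  apply: (@diff_local_min _ _ _ (r / 2 - `|c - p|)); first by rewrite subr_gt0.
  move=> x /near_c xp; split; last by apply: cmin; rewrite inE /= ltW.
  by apply: (diff_sqdist y (df _ _)).1; apply: rU; exact: lt_trans xp rr.
have Uc := rU _ crr.
(* The test vector is the preimage of f c - y under the differential at c; along it the derivative
   of the squared distance is twice the squared distance itself. *)
have w0 := diff_prodE f c (cramer ('d f c (1, 0)) ('d f c (0, 1)) (f c - y)).
rewrite cramerK ?df0// in w0.
have := dc (cramer ('d f c (1, 0)) ('d f c (0, 1)) (f c - y)).
rewrite (diff_sqdist y (df _ Uc)).2 w0 /=.
move: (f c) => [c1 c2]; case: (y) => [y1 y2] /= sq0.
have /eqP : (c1 - y1) ^+ 2 + (c2 - y2) ^+ 2 = 0 by rewrite !expr2; lra.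
rewrite paddr_eq0 ?sqr_ge0// !sqrf_eq0 !subr_eq0 => /andP[/eqP -> /eqP ->].
by [].
Qed.

End LocalSurjectivity.

(** * Smooth local inverses *)

Section InverseFunction.
Variable R : realType.
Implicit Types (f : R * R -> R * R) (U : set (R * R)).

Lemma near_open (T : topologicalType) (A : set T) :
  (forall x, A x -> \forall y \near x, A y) -> open A.
Proof. by rewrite openE. Qed.

Lemma opprcramer (a b h k : R * R) :
  - cramer a b (h - k) = cramer a b k - cramer a b h.
Proof. by rewrite linearB opprB. Qed.

(** With u = i (h + y0) - i y0, the expansion of f at i y0 gives h = df u + o(u); the bound m |u| <=
    |h| turns o(u) into o(h), and [cramer] inverts df. *)
Lemma is_diff_inverse f (i : R * R -> R * R) (y0 : R * R) (m : R) :
  differentiable f (i y0) -> 0 < m ->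
  det2 ('d f (i y0) (1, 0)) ('d f (i y0) (0, 1)) != 0 ->
  (\forall y \near y0, f (i y) = y /\ m * `|i y - i y0| <= `|y - y0|) ->
  is_diff y0 i (cramer ('d f (i y0) (1, 0)) ('d f (i y0) (0, 1))).
Proof.
move=> df m0 det0 /near_normP[r r0 rP].
have [fiy _] : f (i y0) = y0 /\ m * `|i y0 - i y0| <= `|y0 - y0|.
  by apply: rP; rewrite subrr normr0.
set L := cramer _ _; apply: is_diff_near; first exact: linear_prod_continuous.
move=> e e0; have [k k0 kP] := cramer_bound ('d f (i y0) (1, 0)) ('d f (i y0) (0, 1)).
have e1 : 0 < e * m / k by rewrite divr_gt0 ?mulr_gt0.
have /near_normP[d d0 dP] := differentiable_near df e1.
apply/near_normP; exists (Num.min r (m * d)); first by rewrite lt_min r0 mulr_gt0.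
move=> h; rewrite subr0 lt_min => /andP[hr hd].
have [|fi mi] := rP (h + y0); first by rewrite addrK.
rewrite addrK in mi.
set u := i (h + y0) - i y0; rewrite -/u in mi.
have ud : `|u| < d by rewrite -(ltr_pM2l m0); exact: le_lt_trans mi hd.
have := dP u; rewrite subr0 /u subrK fi fiy addrK -/u => /(_ ud) rem.
have uE : cramer ('d f (i y0) (1, 0)) ('d f (i y0) (0, 1)) ('d f (i y0) u) = u.
  by rewrite (diff_prodE f (i y0) u) cramer_comb.
have -> : u - L h = - L (h - 'd f (i y0) u).
  exact (etrans (congr1 (fun t => t - L h) (esym uE)) (esym (opprcramer _ _ _ _))).
rewrite normrN; apply: le_trans (kP _) _.
apply: le_trans (_ : k * (e * m / k * `|u|) <= _); first by rewrite ler_pM2l.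
have -> : k * (e * m / k * `|u|) = e * (m * `|u|) by field; rewrite gt_eqF.
by rewrite ler_pM2l.
Qed.

(** The differential of [i] at y is a rational expression in the partial derivatives of [f] at
    [i y]; hence [i] of class C^k has a differential of class C^k and is itself of class C^(k+1). *)
Lemma smooth_inverse U (W : set (R * R)) f i : smooth_on U f -> open W ->
  (forall y, W y -> U (i y)) ->
  (forall x, U x -> det2 ('d f x (1, 0)) ('d f x (0, 1)) != 0) ->
  (forall y, W y -> is_diff y i (cramer ('d f (i y) (1, 0)) ('d f (i y) (0, 1)))) ->
  smooth_on W i.
Proof.
move=> Sf oW WU det0 di; elim=> [|k IH].
  by move=> y Wy; apply: differentiable_continuous; have [] := di _ Wy.
split=> [y Wy|v]; first by have [] := di _ Wy.
have [df Df] := Sf k.+1.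
have C w : Ck k W (fun y => 'D_w f (i y)) by apply: Ck_comp oW WU IH (Df w).
apply: (@Ck_ext _ _ _ _ _ (fun y => cramer ('D_(1, 0) f (i y)) ('D_(0, 1) f (i y)) v)) => //.
  move=> y Wy; have [dy dE] := di _ Wy; have dfi := df _ (WU _ Wy).
  rewrite (deriveE v dy) !(deriveE _ dfi).
  exact (esym (congr1 (fun L => L v) dE)).
have C11 := Ck_fst oW (C (1, 0)); have C12 := Ck_snd oW (C (1, 0)).
have C21 := Ck_fst oW (C (0, 1)); have C22 := Ck_snd oW (C (0, 1)).
have c a : Ck k W (fun=> a : R) by exact: Ck_cst.
have CB (a b : R * R -> R) : Ck k W a -> Ck k W b -> Ck k W (fun x => a x - b x).
  by move=> ca cb; exact: CkD oW ca (CkN oW cb).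
have Cdet : Ck k W (fun y => (det2 ('D_(1, 0) f (i y)) ('D_(0, 1) f (i y)))^-1).
  apply: CkV => //.
    move=> y Wy; have dfi := df _ (WU _ Wy).
    by rewrite !(deriveE _ dfi) det0//; exact: WU.
  exact: CB (CkM oW C11 C22) (CkM oW C12 C21).
apply: (Ck_pair oW); refine (CkM oW _ Cdet).
  exact: CB (CkM oW (c _) C22) (CkM oW (c _) C21).
exact: CB (CkM oW C11 (c _)) (CkM oW C12 (c _)).
Qed.

Lemma local_inverse U f p : open U -> U p -> smooth_on U f ->
  (forall x, U x -> det2 ('d f x (1, 0)) ('d f x (0, 1)) != 0) ->
  exists (V : set (R * R)) (i : R * R -> R * R),
    [/\ open V, V p, V `<=` U, open (f @` V) & forall x, V x -> i (f x) = x] /\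
    smooth_on (f @` V) i.
Proof.
move=> oU Up Sf det0; have [df _] := Sf 1%N.
have [m [r [m0 r0 rU exf]]] := expansive_near oU Up (Sf 1%N) (det0 _ Up).
have surj := surjective_near oU (Sf 1%N) m0 r0 rU exf det0.
have rr : r / 2 < r by rewrite ltr_pdivrMr// ltr_pMr// ltr1n.
have r20 : 0 < r / 2 by rewrite divr_gt0.
set d := m * r / 8; have d0 : 0 < d by rewrite divr_gt0 ?mulr_gt0.
(* The condition on f x makes the image of [V] a full ball, hence open: by [surj] every point of
   that ball has a preimage within r / 2 of p. *)
pose V := [set x | `|x - p| < r / 2 /\ `|f x - f p| < d].
have VU x : V x -> U x by move=> [xp _]; apply: rU; exact: lt_trans xp rr.
pose i y := get [set x | `|x - p| < r / 2 /\ f x = y].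
have iP y : `|y - f p| < d -> `|i y - p| < r / 2 /\ f (i y) = y.
  move=> yd; apply: (@getPex _ [set x | `|x - p| < r / 2 /\ f x = y]).
  by have [x xr fx] := surj y yd; exists x.
have exf' x x' : `|x - p| < r / 2 -> `|x' - p| < r / 2 ->
    m * `|x' - x| <= `|f x' - f x|.
  move=> xr x'r; have := exf x (x' - x) (lt_trans xr rr).
  by rewrite (addrC x) subrK; apply; exact: lt_trans x'r rr.
have fV : f @` V = [set y | `|y - f p| < d].
  apply/seteqP; split=> [_ [x [xp fxp] <-]//|y /= yd].
  by have [ip fi] := iP _ yd; exists (i y) => //; split; rewrite ?fi.
have ofV : open (f @` V).
  rewrite fV; apply: near_open => y /= yd.
  have : \forall z \near y, `|z - f p| < d.
    apply/near_normP; exists (d - `|y - f p|); first by rewrite subr_gt0.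
    move=> z zy; have := ler_distD y z (f p); move: zy; lra.
  exact.
have oV : open V.
  apply: near_open => x Vx; have [xp fxp] := Vx.
  have n1 : \forall z \near x, `|z - p| < r / 2.
    apply/near_normP; exists (r / 2 - `|x - p|); first by rewrite subr_gt0.
    move=> z zx; have := ler_distD x z p; move: zx; lra.
  have n2 : \forall z \near x, `|f z - f p| < d.
    have dx : 0 < d - `|f x - f p| by rewrite subr_gt0.
    have /cvgrPdist_lt/(_ _ dx) := differentiable_continuous (df _ (VU _ Vx)).
    apply: filterS => z zx; have := ler_distD (f x) (f z) (f p).
    move: zx; rewrite (distrC (f x) (f z)); lra.
  exact: filterI n1 n2.
have iK x : V x -> i (f x) = x.
  move=> [xp fxp]; have [ip fi] := iP _ fxp.
  have := exf' _ _ xp ip; rewrite fi subrr normr0 => h.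
  have : `|i (f x) - x| <= 0 by rewrite -(ler_pM2l m0) mulr0.
  by rewrite normr_le0 subr_eq0 => /eqP.
exists V, i; split; first by split=> //; split; rewrite subrr normr0.
apply: (smooth_inverse Sf ofV _ det0).
  by rewrite fV => y /iP[ip _]; apply: rU; exact: lt_trans ip rr.
move=> y fVy; have := fVy; rewrite fV => /= yd; have [ip fi] := iP _ yd.
have Ui : U (i y) by apply: rU; exact: lt_trans ip rr.
apply: (is_diff_inverse _ m0); [exact: df|exact: det0|].
have : \forall z \near y, (f @` V) z by exact (open_near ofV fVy).
apply: filterS => z; rewrite fV /= => zd; have [zp fz] := iP _ zd.
by split=> //; rewrite -{2}fz -{2}fi; exact: exf'.
Qed.

End InverseFunction.

(** * Null coordinates *)

Section ArcLength.
Variable R : realType.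

Lemma Ck_sum (V W : normedModType R) (I : Type) (s : seq I) k (U : set V) (f : I -> V -> W) :
  open U -> (forall i, Ck k U (f i)) -> Ck k U (fun x => \sum_(i <- s) f i x).
Proof.
move=> oU Cf; elim: s => [|a s IH].
  by apply: (Ck_ext oU _ (Ck_cst k U 0)) => x _; rewrite big_nil.
by apply: (Ck_ext oU _ (CkD oU (Cf a) IH)) => x _; rewrite big_cons.
Qed.

Lemma derive_translate (V W : normedModType R) (f : V -> W) (c x v : V) :
  'D_v (fun z => f (z + c)) x = 'D_v f (x + c).
Proof.
have fE : (fun z => f (z + c)) \o shift x = f \o shift (x + c).
  by rewrite funeqE => h /=; rewrite addrA.
by rewrite /derive fE.
Qed.

Lemma eq_translate (V : normedModType R) (k : V -> R) (p c : V) (r : R) :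
  (forall x, `|x - p| < r -> differentiable k x /\ 'd k x c = 0) ->
  forall x, `|x - p| < r -> `|x + c - p| < r -> k (x + c) = k x.
Proof.
move=> dk x xr xcr; have [|t t01 e] := @mean_value_line _ _ k x c.
  by move=> t t01; have [] := dk _ (segment_dist t01 xr xcr).
by apply/eqP; rewrite -subr_eq0 e (dk _ (segment_dist t01 xr xcr)).2.
Qed.

(* This replaces the symmetry of second derivatives in all that follows. *)
Lemma derive_eq_translate (V : normedModType R) (k : V -> R) (p c : V) (r : R) :
  (forall x, `|x - p| < r -> differentiable k x /\ 'd k x c = 0) ->
  forall x v, `|x - p| < r -> `|x + c - p| < r -> 'D_v k (x + c) = 'D_v k x.
Proof.
move=> dk x v xr xcr; rewrite -derive_translate; apply: esym.
have near_r (y : V) : `|y - p| < r -> \forall z \near (y : V), `|z - p| < r.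
  move=> yr; apply/near_normP; exists (r - `|y - p|); first by rewrite subr_gt0.
  move=> z zy; have := ler_distD y z p; move: zy; lra.
have kxc : \forall z \near x, k z = k (z + c).
  have n2 : \forall z \near x, `|z + c - p| < r.
    apply/near_normP; exists (r - `|x + c - p|); first by rewrite subr_gt0.
    move=> z; have := ler_distD (x + c) (z + c) p.
    have -> : z + c - (x + c) = z - x by rewrite opprD addrACA subrr addr0.
    lra.
  by apply: filterS2 (near_r _ xr) n2 => z zr zcr; rewrite (eq_translate dk zr zcr).
have dkx := (dk _ xr).1; have dkc := near_eq_differentiable kxc dkx.
rewrite (deriveE v dkx) (deriveE v dkc).
exact (congr1 (fun L : V -> R => L v) (esym (near_eq_diff kxc dkx))).
Qed.

(** The primitive is the integral from s0 - r / 2; halving r leaves a closed segment on which [w] is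
    continuous, hence integrable. *)
Lemma primitive_near (w : R -> R) (s0 r : R) : 0 < r ->
  (forall s, `|s - s0| < r -> {for s, continuous w}) ->
  exists T : R -> R, forall s, `|s - s0| < r / 2 -> is_derive s 1 T (w s).
Proof.
move=> r0 cw; pose a := s0 - r / 2; pose b := s0 + r / 2.
have ab x : a <= x <= b -> `|x - s0| < r.
  by rewrite /a /b ltr_norml => /andP[xa xb]; apply/andP; split; lra.
have iw : (@lebesgue_measure R).-integrable `[a, b] (EFin \o w).
  apply: continuous_compact_integrable; first exact: segment_compact.
  apply: continuous_in_subspaceT => x; rewrite inE /= in_itv/= => /ab; exact: cw.
exists (fun x => \int[lebesgue_measure]_(t in [set` `[a, x]]) w t)%R => s sr.
have [as_ sb] : a < s /\ s < b.
  by move: sr; rewrite /a /b ltr_norml => /andP[? ?]; split; lra.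
have [|dT TE] := continuous_FTC1_closed sb iw as_.
  by apply: cw; apply: ab; rewrite !ltW.
by apply: DeriveDef; [exact dT|rewrite -derive1E; exact TE].
Qed.

Definition speed n (k : 'I_n -> R * R -> R) (c y : R * R) : R :=
  Num.sqrt (\sum_i ('D_c (k i) y) ^+ 2).

Lemma smooth_speed n (k : 'I_n -> R * R -> R) (c : R * R) (W : set (R * R)) :
  open W -> (forall i, smooth_on W (k i)) ->
  (forall y, W y -> 0 < \sum_i ('D_c (k i) y) ^+ 2) -> smooth_on W (speed k c).
Proof.
move=> oW Sk k0 m; apply: Ck_sqrt => //; apply: (Ck_sum _ oW) => i.
have Ck1 : Ck m W (fun y => 'D_c (k i) y) by case: (Sk i m.+1) => _; apply.
by apply: (Ck_ext oW _ (CkM oW Ck1 Ck1)) => x _; rewrite expr2.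
Qed.

(* The functions k i depend on the coordinate q only, so the speed of the curve
   k in the direction c does too, and T is its arc length. *)
Lemma arc_length_coordinate n (k : 'I_n -> R * R -> R) (W : set (R * R))
    (y0 c c' : R * R) (q q' : {linear (R * R)%type -> R}) (r : R) :
  (forall v, v = q v *: c + q' v *: c') -> (forall v, `|q v| <= `|v|) ->
  `|c| <= 1 -> q c = 1 ->
  open W -> 0 < r -> (forall y, `|y - y0| < r -> W y) -> (forall i, smooth_on W (k i)) ->
  (forall y, W y -> 0 < \sum_i ('D_c (k i) y) ^+ 2) ->
  (forall i y, W y -> 'd (k i) y c' = 0) ->
  exists T : R -> R, forall y, `|y - y0| < r / 2 -> is_derive (q y) 1 T (speed k c y).
Proof.
move=> vE qle c1 qc oW r0 rW Sk k0 kc'.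
(* [l] is the line through [y0] in the direction [c], parametrized so that q (l s) = s; [T] is a
   primitive of the speed along it. *)
pose l s := y0 + (s - q y0) *: c.
have lr s : `|s - q y0| < r -> `|l s - y0| < r.
  move=> sr; rewrite /l addrC addKr normrZ; apply: le_lt_trans sr.
  by rewrite ler_piMr.
have [|T TP] := @primitive_near (fun s => speed k c (l s)) (q y0) r r0.
  move=> s sr; apply: continuous_comp.
    have [d _] := is_diffD (is_diff_cst y0 (s : R))
      (is_diff_comp (is_diffB (is_diff_id (s : R)) (is_diff_cst (q y0) (s : R)))
        (is_diff_scalel (s - q y0) c)).
    exact (differentiable_continuous d).
  exact: (smooth_speed oW Sk k0 0%N _ (rW _ (lr _ sr))).
exists T => y yr.
have qy : `|q y - q y0| < r / 2 by rewrite -linearB; apply: le_lt_trans (qle _) yr.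
have rr : r / 2 < r by rewrite ltr_pdivrMr// ltr_pMr// ltr1n.
suff -> : speed k c y = speed k c (l (q y)) by exact: TP.
(* y is reached from the point of the line with the same value of q by a multiple of c', and
   translations along c' do not change the derivatives of [k]. *)
have yE : y = l (q y) + (q' (y - y0)) *: c'.
  by rewrite /l -addrA -linearB -vE addrC subrK.
have lyr : `|l (q y) - y0| < r by apply: lr; exact: lt_trans qy rr.
have yrr := lt_trans yr rr.
rewrite /speed; congr Num.sqrt; apply: eq_bigr => i _; congr (_ ^+ 2).
have dk x : `|x - y0| < r -> differentiable (k i) x /\ 'd (k i) x (q' (y - y0) *: c') = 0.
  move=> xr; split; first by have [+ _] := Sk i 1%N; apply; exact: rW.
  by rewrite linearZ /= kc' ?scaler0//; exact: rW.
rewrite {1}yE; apply: (derive_eq_translate dk) => //; by rewrite -yE.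
Qed.

End ArcLength.

(** * Arc length of a null component as a function on the plane *)

Section NullCoordinate.
Variable R : realType.

Lemma diff_inverseE (V W : normedModType R) (F : V -> W) (i : W -> V) y v :
  (\forall z \near y, F (i z) = z) -> differentiable i y -> differentiable F (i y) ->
  'd F (i y) ('d i y v) = v.
Proof.
move=> Fi di dF; apply: (etrans (esym (diff_compE v di dF))).
have idE : \forall z \near y, z = F (i z) by apply: filterS Fi.
have [_ e] := near_eq_is_diff idE (is_diff_id y).
exact (congr1 (fun l : W -> W => l v) e).
Qed.

Lemma open_setI_preimage (S T : topologicalType) (U : set S) (B : set T) (F : S -> T) :
  open U -> open B -> (forall x, U x -> {for x, continuous F}) ->
  open (U `&` F @^-1` B).
Proof.
move=> oU oB cF; apply: near_open => x [Ux Bx].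
by apply: filterI; [exact: open_near|apply: (cF x Ux); exact: open_near].
Qed.

(** In the coordinates [F] the functions [P j] have no derivative along c', hence depend locally on
    q only, and [B] is the arc length of the resulting curve as a function of q (F x). The speed
    does not vanish because [P i0] is the coordinate q itself and has derivative 1 along c. The data
    q, q', c, c' let one proof serve both coordinates of [F]. *)
Lemma null_coordinate n (P : 'I_n -> R * R -> R) (i0 : 'I_n) (F i : R * R -> R * R)
    (V : set (R * R)) (p c c' : R * R) (q q' : {linear (R * R)%type -> R}) :
  (forall v, v = q v *: c + q' v *: c') -> (forall v, `|q v| <= `|v|) ->
  `|c| <= 1 -> q c = 1 -> q c' = 0 ->
  open V -> V p -> smooth_on V F -> open (F @` V) -> smooth_on (F @` V) i ->
  (forall x, V x -> i (F x) = x) -> (forall j, smooth_on V (P j)) ->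
  (forall x, P i0 x = q (F x)) ->
  (forall x, V x -> forall v, q ('d F x v) = 0 -> forall j, 'd (P j) x v = 0) ->
  exists (V' : set (R * R)) (B : R * R -> R),
    [/\ open V', V' p, V' `<=` V, smooth_on V' B &
      forall x, V' x -> forall v, ('d B x v) ^+ 2 = \sum_j ('d (P j) x v) ^+ 2].
Proof.
move=> vE qle c1 qc qc' oV Vp SF oW Si iK SP P0 ker.
have [dF _] := SF 1%N; have [di _] := Si 1%N.
have cq : continuous q by exact: linear_prod_continuous.
have iV y : (F @` V) y -> V (i y) by case=> x Vx <-; rewrite iK.
have Fi y : (F @` V) y -> F (i y) = y by case=> x Vx <-; rewrite iK.
have Fid y v : (F @` V) y -> 'd F (i y) ('d i y v) = v.
  move=> Wy; apply: diff_inverseE; [|exact: di|exact/dF/iV].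
  have : \forall z \near y, (F @` V) z by exact (open_near oW Wy).
  by apply: filterS => z; exact: Fi.
pose k j := P j \o i.
have Sk j : smooth_on (F @` V) (k j) by move=> m; exact: Ck_comp oW iV (Si m) (SP j m).
have dk j y v : (F @` V) y -> 'd (k j) y v = 'd (P j) (i y) ('d i y v).
  move=> Wy; have [dP _] := SP j 1%N.
  exact (diff_compE v (di _ Wy) (dP _ (iV _ Wy))).
have kc' j y : (F @` V) y -> 'd (k j) y c' = 0.
  by move=> Wy; apply: (etrans (dk j y c' Wy)); apply: (ker _ (iV _ Wy)); rewrite Fid.
have kc1 y : (F @` V) y -> 'd (k i0) y c = 1.
  move=> Wy; apply: (etrans (dk i0 y c Wy)).
  have P0' : P i0 = fun x => q (F x) by rewrite funeqE.
  have [_ e] := diff_linear_comp cq (dF _ (iV _ Wy)).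
  by rewrite P0'; apply: (etrans (e _)); rewrite Fid.
have Dk j y v : (F @` V) y -> 'D_v (k j) y = 'd (k j) y v.
  by move=> Wy; apply: deriveE; have [d _] := Sk j 1%N; exact: d.
have k0 y : (F @` V) y -> 0 < \sum_j ('D_c (k j) y) ^+ 2.
  move=> Wy; rewrite (bigD1 i0) //= Dk// kc1// expr1n.
  by apply: ltr_wpDr => //; apply: sumr_ge0 => j _; exact: sqr_ge0.
have Wp : (F @` V) (F p) by exists p.
have /near_normP[r r0 rW] : \forall y \near F p, (F @` V) y by exact (open_near oW Wp).
have [T TP] := arc_length_coordinate vE qle c1 qc oW r0 rW Sk k0 kc'.
have oB : open (ball (F p) (r / 2)).
  by apply: ball_open; rewrite divr_gt0.
have cF x : V x -> {for x, continuous F} by move=> /dF/differentiable_continuous.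
have oV' := open_setI_preimage oV oB cF.
pose B x := T (q (F x)).
have dqF x : V x -> differentiable (fun z => q (F z)) x /\
    forall v, 'd (fun z => q (F z)) x v = q ('d F x v).
  by move=> Vx; have := diff_linear_comp cq (dF _ Vx).
have TF x : (V `&` F @^-1` ball (F p) (r / 2)) x ->
    is_derive (q (F x)) 1 T (speed k c (F x)).
  by case=> Vx; rewrite /= -ball_normE /= distrC; exact: TP.
have dB x : (V `&` F @^-1` ball (F p) (r / 2)) x -> differentiable B x /\
    forall v, 'd B x v = speed k c (F x) * q ('d F x v).
  move=> Vx; have [d e] := dqF _ Vx.1; split.
    exact: differentiable_real_comp d (TF _ Vx).
  by move=> v; apply: (etrans (diff_real_comp v d (TF _ Vx))); rewrite e.
exists (V `&` F @^-1` ball (F p) (r / 2)), B; split=> //.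
- by split=> //=; rewrite -ball_normE /= subrr normr0 divr_gt0.
- move=> [|m]; first by move=> x /dB[/differentiable_continuous].
  split; first by move=> x /dB[].
  move=> v; have CF : Ck m.+1 (V `&` F @^-1` ball (F p) (r / 2)) F.
    by apply: Ck_sub (SF m.+1) => x [].
  have Cs : Ck m (V `&` F @^-1` ball (F p) (r / 2)) (fun x => speed k c (F x)).
    apply: Ck_comp (Ck_pred CF) (smooth_speed oW Sk k0 m) => //.
    by move=> x [Vx _]; exists x.
  have [dF' Cq] := CF.
  have := CkM oV' Cs (Ck_linear_comp (L := q) oV' cq (Cq v)).
  apply: Ck_ext => // x Vx; rewrite (deriveE v (dF' _ Vx)) (deriveE v (dB _ Vx).1).
  exact (esym ((dB _ Vx).2 v)).
move=> x Vx v; apply: (etrans (congr1 (fun t => t ^+ 2) ((dB _ Vx).2 v))).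
rewrite exprMn /speed sqr_sqrtr; last by apply: sumr_ge0 => j _; exact: sqr_ge0.
have Wx : (F @` V) (F x) by exists x => //; case: Vx.
rewrite mulr_suml; apply: eq_bigr => j _; rewrite -exprMn; congr (_ ^+ 2).
set a := q ('d F x v); pose b := 'd i (F x) c.
have e : 'D_c (k j) (F x) = 'd (P j) x b.
  apply: (etrans (Dk j _ c Wx)); apply: (etrans (dk j _ c Wx)).
  exact (congr1 (fun z => 'd (P j) z b) (iK x Vx.1)).
rewrite e.
(* b is the preimage of c under dF, so q (dF (v - a b)) = 0 and all the d(P j) vanish on v - a b:
   their values on v are a times those on b. *)
have : 'd (P j) x (v - a *: b) = 0.
  apply: ker; first by case: Vx.
  have -> : 'd F x (v - a *: b) = 'd F x v - a *: 'd F x b by rewrite linearB linearZ.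
  have Fb : 'd F x b = c.
    apply: (etrans _ (Fid _ c Wx)).
    exact (congr1 (fun z => 'd F z b) (esym (iK x Vx.1))).
  by rewrite Fb linearB linearZ /= qc /GRing.scale/= mulr1 subrr.
by rewrite linearB linearZ /= => /eqP; rewrite subr_eq0 => /eqP ->; rewrite mulrC.
Qed.

(** For a matrix of determinant 0 with columns a and b, the vectors (b2, -a2) and (-b1, a1) are in
    the kernel; if both vanish, the matrix is 0 and (1, 0) is in the kernel. *)
Lemma det2_neq0 (L : {linear (R * R)%type -> (R * R)%type}) :
  (forall v, L v = 0 -> v = 0) -> det2 (L (1, 0)) (L (0, 1)) != 0.
Proof.
move=> Linj; apply/eqP => d0.
have LE := linear_prodE L.
move: d0 LE; move: (L (1, 0)) (L (0, 1)) => [a1 a2] [b1 b2]; rewrite /det2 /= => d0 LE.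
have := Linj (b2, - a2); rewrite LE.
have -> : (b2, - a2).1 *: (a1, a2) + (b2, - a2).2 *: (b1, b2) = 0.
  by congr pair; rewrite /= /GRing.scale/=; [rewrite -d0; ring|ring].
move=> /(_ erefl)[b20 /eqP]; rewrite oppr_eq0 => /eqP a20.
have := Linj (- b1, a1); rewrite LE.
have -> : (- b1, a1).1 *: (a1, a2) + (- b1, a1).2 *: (b1, b2) = 0.
  by congr pair; rewrite /= /GRing.scale/=; [ring|rewrite -d0; ring].
move=> /(_ erefl)[/eqP]; rewrite oppr_eq0 => /eqP b10 a10.
have := Linj (1, 0); rewrite LE /= a10 a20 b10 b20 => h.
have : ((1, 0) : R * R) = 0.
  by apply: h; congr pair; rewrite /= /GRing.scale/=; ring.
by case=> /eqP; rewrite oner_eq0.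
Qed.

Lemma det2_inj (L : {linear (R * R)%type -> (R * R)%type}) v :
  det2 (L (1, 0)) (L (0, 1)) != 0 -> L v = 0 -> v = 0.
Proof.
by move=> d0 Lv; rewrite -(cramer_comb v d0) -linear_prodE Lv linear0.
Qed.

Lemma dual_basis (A B : {linear (R * R)%type -> R}) u w : A u != 0 -> A w = 0 ->
  B u = 0 -> B w != 0 -> forall v, v = (A v / A u) *: u + (B v / B w) *: w.
Proof.
move=> Au Aw Bu Bw v.
have d0 : det2 u w != 0.
  apply/eqP => d0.
  have e1 : w.2 *: u - u.2 *: w = 0.
    by case: u w d0 {Au Aw Bu Bw} => [u1 u2] [w1 w2]; rewrite /det2 /= => d0;
      congr pair; rewrite /= /GRing.scale/=; [rewrite -d0; ring|ring].
  have e2 : w.1 *: u - u.1 *: w = 0.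
    by case: u w d0 {Au Aw Bu Bw e1} => [u1 u2] [w1 w2]; rewrite /det2 /= => d0;
      congr pair; rewrite /= /GRing.scale/=; [ring|rewrite -[RHS]oppr0 -d0; ring].
  have lA a b : A (a *: u - b *: w) = a * A u - b * A w.
    by rewrite linearB linearZ [A (b *: w)]linearZ.
  have := congr1 A e1; have := congr1 A e2.
  rewrite !lA Aw !mulr0 !subr0 linear0 => /eqP.
  rewrite mulf_eq0 (negbTE Au) orbF => /eqP w1 /eqP.
  rewrite mulf_eq0 (negbTE Au) orbF => /eqP w2.
  have w0 : w = 0 by rewrite (surjective_pairing w) w1 w2.
  by move: Bw; rewrite w0 linear0 eqxx.
have vE := esym (cramerK v d0).
set a := (cramer u w v).1 in vE; set b := (cramer u w v).2 in vE.
have Av : A v = a * A u.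
  by rewrite vE linearD linearZ [A (b *: w)]linearZ /= Aw /GRing.scale/= mulr0 addr0.
have Bv : B v = b * B w.
  by rewrite vE linearD linearZ [B (b *: w)]linearZ /= Bu /GRing.scale/= mulr0 add0r.
by rewrite Av Bv !mulfK.
Qed.

End NullCoordinate.

(** * Positive charts formed by two null coordinates *)

Section NullChart.
Variable R : realType.

Lemma sum_sqr_eq0 n (a : 'I_n -> R) : \sum_i (a i) ^+ 2 = 0 -> forall i, a i = 0.
Proof.
move=> /eqP; rewrite psumr_eq0; last by move=> i _; exact: sqr_ge0.
by move=> /allP a0 i; apply/eqP; rewrite -sqrf_eq0; apply: a0; rewrite mem_index_enum.
Qed.

(** [w] spans the kernel of [A] and [u] that of [B]. *)
Lemma dual_basis_ker (A B : {linear (R * R)%type -> R}) u w : A u != 0 -> A w = 0 ->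
  B u = 0 -> B w != 0 -> forall v (C : {linear (R * R)%type -> R}),
  (A v = 0 -> C w = 0 -> C v = 0) /\ (B v = 0 -> C u = 0 -> C v = 0).
Proof.
move=> Au Aw Bu Bw v C.
have -> : C v = (A v / A u) * C u + (B v / B w) * C w.
  by rewrite {1}(dual_basis Au Aw Bu Bw v) linearD linearZ [C ((B v / B w) *: w)]linearZ.
by split=> -> ->; rewrite !mul0r ?mulr0 addr0.
Qed.

Lemma dual_basis_eq0 (A B : {linear (R * R)%type -> R}) u w v : A u != 0 -> A w = 0 ->
  B u = 0 -> B w != 0 -> A v = 0 -> B v = 0 -> v = 0.
Proof.
move=> Au Aw Bu Bw Av Bv; rewrite (dual_basis Au Aw Bu Bw v) Av Bv.
by rewrite !mul0r !scale0r addr0.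
Qed.

(* With P and N the two families of null components of a conformal immersion,
   u and w are the null directions. *)
Definition null_split n (P N : 'I_n -> R * R -> R) (x : R * R) : Prop :=
  exists u w : R * R, [/\ forall i, 'd (N i) x u = 0, forall i, 'd (P i) x w = 0,
    exists i, 'd (P i) x u != 0 & exists i, 'd (N i) x w != 0].

Lemma null_split_inj n (P N : 'I_n -> R * R -> R) (x v : R * R) : null_split P N x ->
  (forall i, 'd (P i) x v = 0) -> (forall i, 'd (N i) x v = 0) -> v = 0.
Proof.
move=> [u [w [Nu Pw [i Pu] [j Nw]]]] Pv Nv.
exact: (dual_basis_eq0 Pu (Pw i) (Nu j) Nw (Pv i) (Nv j)).
Qed.

Lemma open_neq0 (V : normedModType R) (U : set V) (h : V -> R) : open U ->
  Ck 0 U h -> open (U `&` [set x | h x != 0]).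
Proof.
move=> oU ch; have -> : [set x | h x != 0] = h @^-1` (~` [set 0]).
  by apply/seteqP; split=> x /= /eqP.
by apply: open_setI_preimage => //; apply: closed_openC; exact: closed_eq.
Qed.

Lemma open_gt0 (V : normedModType R) (U : set V) (h : V -> R) : open U ->
  Ck 0 U h -> open (U `&` [set x | 0 < h x]).
Proof.
move=> oU ch; have -> : [set x | 0 < h x] = h @^-1` [set r | 0 < r] by [].
by apply: open_setI_preimage => //; exact: open_gt.
Qed.

Lemma Ck_det (U : set (R * R)) k (f : R * R -> R * R) : open U -> Ck k.+1 U f ->
  Ck k U (fun x => det2 ('d f x (1, 0)) ('d f x (0, 1))).
Proof.
move=> oU [df Df].
have C := Df; apply: (@Ck_ext _ _ _ _ _
  (fun x => det2 ('D_(1, 0) f x) ('D_(0, 1) f x))) => //.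
  by move=> x Ux; rewrite !(deriveE _ (df _ Ux)).
apply: CkD oU (CkM oU (Ck_fst oU (C _)) (Ck_snd oU (C _)))
  (CkN oU (CkM oU (Ck_snd oU (C _)) (Ck_fst oU (C _)))).
Qed.

(** At p the differential of some [P i0] is nonzero on u and that of some [N j0] on w, while each
    kills the other direction. So F = (P i0, N j0) is a local diffeomorphism, and it straightens
    both null directions at once. *)
Lemma null_coordinates n (P N : 'I_n -> R * R -> R) (Om : set (R * R)) (p : R * R) :
  open Om -> Om p -> (forall i, smooth_on Om (P i)) -> (forall i, smooth_on Om (N i)) ->
  (forall x, Om x -> null_split P N x) ->
  exists (V : set (R * R)) (B1 B2 : R * R -> R),
    [/\ open V, V p, V `<=` Om & smooth_on V B1 /\ smooth_on V B2] /\
    forall x, V x -> forall v, ('d B1 x v) ^+ 2 = \sum_i ('d (P i) x v) ^+ 2 /\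
      ('d B2 x v) ^+ 2 = \sum_i ('d (N i) x v) ^+ 2.
Proof.
move=> oOm Omp SP SN sp; have [u0 [w0 [Nu0 Pw0 [i0 Pu0] [j0 Nw0]]]] := sp p Omp.
pose F x := (P i0 x, N j0 x).
have SF : smooth_on Om F by move=> k; exact: Ck_pair oOm (SP i0 k) (SN j0 k).
have [dF _] := SF 1%N.
have dP i x : Om x -> differentiable (P i) x by move=> Ox; have [d _] := SP i 1%N; exact: d.
have dN i x : Om x -> differentiable (N i) x by move=> Ox; have [d _] := SN i 1%N; exact: d.
have dFE x v : Om x -> 'd F x v = ('d (P i0) x v, 'd (N j0) x v).
  move=> Ox.
  exact (congr1 (fun l : R * R -> R * R => l v) (diff_pair (dP i0 x Ox) (dN j0 x Ox))).
pose Om' := Om `&` [set x | det2 ('d F x (1, 0)) ('d F x (0, 1)) != 0].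
have oOm' : open Om' by apply: open_neq0 => //; apply: Ck_det => //; exact: (SF 1%N).
have Om'p : Om' p.
  split=> //=; apply: det2_neq0 => v; rewrite dFE// => -[Pv Nv].
  exact: (dual_basis_eq0 Pu0 (Pw0 i0) (Nu0 j0) Nw0 Pv Nv).
have SF' : smooth_on Om' F by move=> k; apply: Ck_sub (SF k) => x [].
have [V [i [[oV Vp VOm' oW iK] Si]]] := local_inverse oOm' Om'p SF' (fun x Ox => Ox.2).
have VOm x : V x -> Om x by move=> /VOm'[].
have SV (k : 'I_n -> R * R -> R) : (forall j, smooth_on Om (k j)) ->
  forall j, smooth_on V (k j) by move=> Sk j m; apply: Ck_sub (Sk j m).
have SFV : smooth_on V F by move=> k; apply: Ck_sub (SF k).
(* The indices i0 and j0 are chosen at p, and the splitting at x may come with other ones;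
   invertibility of dF at x shows that i0 and j0 serve there too. *)
have split_x x v : V x -> ('d (P i0) x v = 0 -> forall j, 'd (P j) x v = 0) /\
    ('d (N j0) x v = 0 -> forall j, 'd (N j) x v = 0).
  move=> Vx; have [u [w [Nu Pw [j Pu] [j' Nw]]]] := sp x (VOm _ Vx).
  have inj y : 'd (P i0) x y = 0 -> 'd (N j0) x y = 0 -> y = 0.
    move=> Py Ny; apply: (det2_inj (VOm' _ Vx).2).
    exact (etrans (dFE x y (VOm _ Vx)) (congr2 pair Py Ny)).
  have Pu0' : 'd (P i0) x u != 0.
    by apply/eqP => Pu'; move: Pu; rewrite (inj _ Pu' (Nu j0)) linear0 eqxx.
  have Nw0' : 'd (N j0) x w != 0.
    by apply/eqP => Nw'; move: Nw; rewrite (inj _ (Pw i0) Nw') linear0 eqxx.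
  have K := @dual_basis_ker _ _ u w Pu0' (Pw i0) (Nu j0) Nw0' v.
  by split=> [Pv l|Nv l]; [exact: (K ('d (P l) x)).1 Pv (Pw l)|
    exact: (K ('d (N l) x)).2 Nv (Nu l)].
have kerP x : V x -> forall v, ('d F x v).1 = 0 -> forall j, 'd (P j) x v = 0.
  move=> Vx v Fv; apply: (split_x x v Vx).1.
  exact (etrans (esym (congr1 fst (dFE x v (VOm _ Vx)))) Fv).
have kerN x : V x -> forall v, ('d F x v).2 = 0 -> forall j, 'd (N j) x v = 0.
  move=> Vx v Fv; apply: (split_x x v Vx).2.
  exact (etrans (esym (congr1 snd (dFE x v (VOm _ Vx)))) Fv).
have fE (v : R * R) : v = v.1 *: (1, 0) + v.2 *: (0, 1).
  by case: v => a b; congr pair; rewrite /= /GRing.scale/=; ring.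
have sE (v : R * R) : v = v.2 *: (0, 1) + v.1 *: (1, 0) by rewrite addrC -fE.
have n1 : `|((1, 0) : R * R)| <= 1 by rewrite prod_normE /= normr1 normr0 ge_max lexx ler01.
have n2 : `|((0, 1) : R * R)| <= 1 by rewrite prod_normE /= normr1 normr0 ge_max lexx ler01.
have [V1 [B1 [oV1 V1p V1V SB1 B1P]]] := @null_coordinate R n P i0 F i V p (1, 0) (0, 1)
  fst snd fE (@norm_fst R R R) n1 erefl erefl oV Vp SFV oW Si iK (SV _ SP)
  (fun=> erefl) kerP.
have [V2 [B2 [oV2 V2p V2V SB2 B2P]]] := @null_coordinate R n N j0 F i V p (0, 1) (1, 0)
  snd fst sE (@norm_snd R R R) n2 erefl erefl oV Vp SFV oW Si iK (SV _ SN)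
  (fun=> erefl) kerN.
exists (V1 `&` V2), B1, B2; split.
  split; [exact: openI|by []|by move=> x [/V1V/VOm]|].
  by split=> k; [apply: Ck_sub (SB1 k) => x []|apply: Ck_sub (SB2 k) => x []].
by move=> x [V1x V2x] v; split; [exact: B1P|exact: B2P].
Qed.

(* The signs of B1 and B2 are free: one of the two choices makes the chart
   ((B1 + B2) / 2, (B1 - B2) / 2) positive. *)
Lemma null_chart n (P N : 'I_n -> R * R -> R) (Om : set (R * R)) (p : R * R) :
  open Om -> Om p -> (forall i, smooth_on Om (P i)) -> (forall i, smooth_on Om (N i)) ->
  (forall x, Om x -> null_split P N x) ->
  exists (V : set (R * R)) (b i : R * R -> R * R),
    [/\ open V, V p, V `<=` Om, open (b @` V) & forall x, V x -> i (b x) = x] /\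
    [/\ smooth_on V b, smooth_on (b @` V) i,
      forall x, V x -> 0 < det2 ('d b x (1, 0)) ('d b x (0, 1)) &
      forall x, V x -> forall v,
        (('d b x v).1 + ('d b x v).2) ^+ 2 = \sum_i ('d (P i) x v) ^+ 2 /\
        (('d b x v).1 - ('d b x v).2) ^+ 2 = \sum_i ('d (N i) x v) ^+ 2].
Proof.
(* The solution (x, y) of x + y = a.1 and x - y = s a.2, where a will be the pair (B1, B2) of null
   coordinates. *)
pose c s : R * R -> R * R := fun a => ((a.1 + s * a.2) / 2, (a.1 - s * a.2) / 2).
have c0 a : c 1 a = 0 -> a.1 = 0 /\ a.2 = 0 by case=> e1 e2; split; lra.
have cP s a : (c s a).1 + (c s a).2 = a.1 by rewrite /c /=; field.
have cM s a : (c s a).1 - (c s a).2 = s * a.2 by rewrite /c /=; field.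
have exsign (d : R) : d != 0 -> exists2 s : R, s ^+ 2 = 1 & 0 < s * d.
  by have [d0|d0|] := ltgtP 0 d => // _; [exists 1; rewrite ?expr1n ?mul1r|
    exists (-1); rewrite ?sqrrN ?expr1n ?mulN1r ?oppr_gt0].
have lc s : linear (c s).
  by move=> k u v; congr pair; rewrite /= /GRing.scale/=; ring.
move=> oOm Omp SP SN sp.
have [V [B1 [B2 [[oV Vp VOm [SB1 SB2]] BP]]]] := null_coordinates oOm Omp SP SN sp.
have [dB1 _] := SB1 1%N; have [dB2 _] := SB2 1%N.
pose C s : {linear (R * R)%type -> (R * R)%type} :=
  HB.pack (c s) (GRing.isLinear.Build _ _ _ _ _ (lc s)).
pose BB x := (B1 x, B2 x).
have SBB : smooth_on V BB by move=> k; exact: Ck_pair oV (SB1 k) (SB2 k).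
pose b s x := C s (BB x).
have Sb s : smooth_on V (b s).
  by move=> k; apply: Ck_linear_comp oV _ (SBB k); exact: linear_prod_continuous.
have dbE s x v : V x -> 'd (b s) x v = c s ('d B1 x v, 'd B2 x v).
  move=> Vx; have dBB := differentiable_pair (dB1 _ Vx) (dB2 _ Vx).
  have [_ e] := diff_linear_comp (@linear_prod_continuous _ _ (C s)) dBB.
  apply: (etrans (e v)); congr (c s _).
  exact (congr1 (fun l : R * R -> R * R => l v) (diff_pair (dB1 x Vx) (dB2 x Vx))).
have det_s s x : V x -> det2 ('d (b s) x (1, 0)) ('d (b s) x (0, 1)) =
    s * det2 ('d (b 1) x (1, 0)) ('d (b 1) x (0, 1)).
  move=> Vx; have cE u v : det2 (c s u) (c s v) = s * det2 (c 1 u) (c 1 v).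
    by rewrite /c /det2 /=; field.
  apply: (etrans (congr2 (@det2 R) (dbE s x _ Vx) (dbE s x _ Vx))).
  apply: (etrans (cE _ _)); apply: esym.
  exact (congr1 ( *%R s) (congr2 (@det2 R) (dbE 1 x _ Vx) (dbE 1 x _ Vx))).
have det1 : det2 ('d (b 1) p (1, 0)) ('d (b 1) p (0, 1)) != 0.
  apply: det2_neq0 => v bv; have [BP1 BP2] := BP p Vp v.
  have [B1v B2v] := c0 _ (etrans (esym (dbE 1 p v Vp)) bv).
  apply: (null_split_inj (sp p Omp)); apply: sum_sqr_eq0.
    by apply: (etrans (esym BP1)); move: B1v => /= ->; rewrite expr0n.
  by apply: (etrans (esym BP2)); move: B2v => /= ->; rewrite expr0n.
have [s ss sd] := exsign _ det1.
have sdet : 0 < det2 ('d (b s) p (1, 0)) ('d (b s) p (0, 1)).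
  exact (eq_ind_r (fun t => 0 < t) sd (det_s s p Vp)).
pose V' := V `&` [set x | 0 < det2 ('d (b s) x (1, 0)) ('d (b s) x (0, 1))].
have oV' : open V' by apply: open_gt0 => //; apply: Ck_det => //; exact: (Sb s 1%N).
have Sb' : smooth_on V' (b s) by move=> k; apply: Ck_sub (Sb s k) => x [].
have [|V0 [i [[oV0 V0p V0V oW iK] Si]]] := @local_inverse R V' (b s) p oV' (conj Vp sdet) Sb'.
  by move=> x [_ /= d0]; rewrite gt_eqF.
exists V0, (b s), i; split; first by split=> // x /V0V[/VOm].
split; [by move=> k; apply: Ck_sub (Sb' k)|exact: Si|by move=> x /V0V[]|].
move=> x /V0V[Vx _] v; have [BP1 BP2] := BP x Vx v.
have e := dbE s x v Vx; split.
  apply: (etrans (congr1 (fun a => (a.1 + a.2) ^+ 2) e)).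
  by apply: (etrans (congr1 (fun t => t ^+ 2) (cP s _))); exact BP1.
apply: (etrans (congr1 (fun a => (a.1 - a.2) ^+ 2) e)).
apply: (etrans (congr1 (fun t => t ^+ 2) (cM s _))).
by rewrite exprMn ss mul1r; exact BP2.
Qed.

End NullChart.

(** * Lorentz numbers and conformal charts *)

Section LorentzAlgebra.
Variable R : realType.
Implicit Types (a b : lorentz R) (p q : lquat R) (e : R).

(* For e = 1 and e = -1 the two ring homomorphisms from the Lorentz numbers to
   R, whose kernels are the two null lines. *)
Definition pe e a : R := a.1 + e * a.2.

Lemma pe_ext a b : pe 1 a = pe 1 b -> pe (-1) a = pe (-1) b -> a = b.
Proof.
by case: a b => [a1 a2] [b1 b2]; rewrite /pe /= => h1 h2; apply: lorentz_ext => /=; lra.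
Qed.

Lemma peM e a b : e * e = 1 -> pe e (a * b) = pe e a * pe e b.
Proof.
move=> ee; rewrite /pe /= mulrDl !mulrDr.
have -> : e * a.2 * (e * b.2) = e * e * (a.2 * b.2) by ring.
by rewrite ee; ring.
Qed.

Lemma pe_linear e : linear (pe e).
Proof. by move=> k a b; rewrite /pe /= /GRing.scale/=; ring. Qed.
HB.instance Definition _ e := GRing.isLinear.Build R (lorentz R) R _ (pe e) (pe_linear e).

Lemma pe_continuous e : continuous (pe e).
Proof. exact: (@linear_prod_continuous R R (pe e)). Qed.

Lemma pe1 e : pe e 1 = 1. Proof. by rewrite /pe /= mulr0 addr0. Qed.
Lemma pe_sigma e : pe e lsigma = e. Proof. by rewrite /pe /= mulr1 add0r. Qed.

Definition qcomp (i : 'I_4) q : lorentz R :=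
  match val i with 0 => qc0 q | 1 => qc1 q | 2 => qc2 q | _ => qc3 q end%N.

(** For fixed e the four functions [pq e i] are the Euclidean coordinates of a quaternion in one of
    the two factors of the splitting of H^A into two copies of the real quaternions. *)
Definition pq e (i : 'I_4) q : R := pe e (qcomp i q).

Lemma pq_linear e i : linear (pq e i).
Proof.
by move=> k p q; rewrite /pq -pe_linear; case: i => [[|[|[|[|]]]]].
Qed.
HB.instance Definition _ e i :=
  GRing.isLinear.Build R (lquat R) R _ (pq e i) (pq_linear e i).

Lemma pq_continuous e i : continuous (pq e i).
Proof.
pose A := lorentz R.
have c1 : continuous (fun q : lquat R => q.1) := @fst_continuous R (A * A * A)%type A.
have c2 : continuous (fun q : lquat R => q.2) := @snd_continuous R (A * A * A)%type A.
have c11 q : {for q, continuous (fun q : lquat R => q.1.1)}.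
  exact (continuous_comp (c1 q) (@fst_continuous R (A * A)%type A _)).
have c12 q : {for q, continuous (fun q : lquat R => q.1.2)}.
  exact (continuous_comp (c1 q) (@snd_continuous R (A * A)%type A _)).
have c111 q : {for q, continuous (fun q : lquat R => q.1.1.1)}.
  exact (continuous_comp (c11 q) (@fst_continuous R A A _)).
have c112 q : {for q, continuous (fun q : lquat R => q.1.1.2)}.
  exact (continuous_comp (c11 q) (@snd_continuous R A A _)).
move=> q; rewrite /pq; have pec := @pe_continuous e.
case: i => [[|[|[|k]]] Hi].
- exact (continuous_comp (c111 q) (pec _)).
- exact (continuous_comp (c112 q) (pec _)).
- exact (continuous_comp (c12 q) (pec _)).
- exact (continuous_comp (c2 q) (pec _)).
Qed.

Lemma pq_ext p q : (forall i, pq 1 i p = pq 1 i q) ->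
  (forall i, pq (-1) i p = pq (-1) i q) -> p = q.
Proof.
move=> h1 h2; have h i : qcomp i p = qcomp i q by apply: pe_ext; [exact: h1|exact: h2].
by apply: lquat_ext; [have := h (inord 0)|have := h (inord 1)|have := h (inord 2)|
  have := h (inord 3)]; rewrite /qcomp /= inordK.
Qed.

Lemma pq_qscale e i a q : e * e = 1 -> pq e i (qscale a q) = pe e a * pq e i q.
Proof.
move=> ee; have qE : qcomp i (qscale a q) = a * qcomp i q by case: i => [[|[|[|[|]]]]].
by rewrite /pq qE peM.
Qed.

Lemma pq_sigma e i q : e * e = 1 -> pq e i (qscale lsigma q) = e * pq e i q.
Proof. by move=> ee; rewrite pq_qscale// pe_sigma. Qed.

(** In each factor H becomes a Euclidean square norm; this turns H(g', g') = 1 into the unit speed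
    of two curves. *)
Lemma pe_qform e q : e * e = 1 -> pe e (qform q q) = \sum_i (pq e i q) ^+ 2.
Proof.
move=> ee; rewrite /qform !linearD /= !peM//.
by rewrite !big_ord_recr big_ord0 /= add0r !expr2.
Qed.

Lemma lorentz_dec (w : lorentz R) : w = w.1 *: (1 : lorentz R) + w.2 *: lsigma.
Proof.
case: w => a b; apply: lorentz_ext.
  by change (a = a * 1 + b * 0); ring.
by change (b = a * 0 + b * 1); ring.
Qed.

Lemma qscaleD (a b : lorentz R) q : qscale (a + b) q = qscale a q + qscale b q.
Proof. by rewrite qD; apply: lquat_ext; rewrite /qscale /mkQ /qc0 /qc1 /qc2 /qc3 /= mulrDl. Qed.

Lemma scale_lmul (r : R) (a b : lorentz R) : (r *: a : lorentz R) * b = r *: (a * b).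
Proof.
apply: lorentz_ext.
  by change (r * a.1 * b.1 + r * a.2 * b.2 = r * (a.1 * b.1 + a.2 * b.2)); ring.
by change (r * a.1 * b.2 + r * a.2 * b.1 = r * (a.1 * b.2 + a.2 * b.1)); ring.
Qed.

Lemma qscaleZ (r : R) (a : lorentz R) q : qscale (r *: a) q = r *: qscale a q.
Proof.
by apply: lquat_ext; rewrite /qscale /mkQ /qc0 /qc1 /qc2 /qc3 /=; exact: scale_lmul.
Qed.

Lemma qscale1 q : qscale 1 q = q.
Proof. by apply: lquat_ext; rewrite /qscale /mkQ /qc0 /qc1 /qc2 /qc3 /= mul1r. Qed.

Lemma qform_qscale (a : lorentz R) q : qform (qscale a q) (qscale a q) = a * a * qform q q.
Proof. by rewrite /qform /qscale /mkQ /qc0 /qc1 /qc2 /qc3 /=; ring. Qed.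

End LorentzAlgebra.

(** * Differentials on the surface and along charts *)

Section SurfaceCharts.
Variables (R : realType) (M : surface R).
Implicit Types (c : chart R M) (x : M).

Lemma cinv_dom c z : (cmap c @` cdom c) z -> cdom c (cinv c z) /\ cmap c (cinv c z) = z.
Proof. by case=> x cx <-; rewrite cmapK. Qed.

Lemma cimg_setI c (A : set M) :
  cmap c @` (cdom c `&` A) = (cmap c @` cdom c) `&` (cinv c @^-1` A).
Proof.
apply/seteqP; split=> [_ [x [cx Ax] <-]|z [cz Az]].
  by split; [exists x|rewrite /= cmapK].
by have [cz' zE] := cinv_dom cz; exists (cinv c z).
Qed.

Lemma open_cimg c (A : set M) : open A -> open (cmap c @` (cdom c `&` A)).
Proof.
move=> oA; rewrite cimg_setI.
have := open_setI_preimage (@cimg_open R M c) oA (fun z => @cinv_cont R M c z).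
exact.
Qed.

Lemma open_cpre c (A : set (R * R)) : open A -> open (cdom c `&` cmap c @^-1` A).
Proof. by move=> oA; exact: open_setI_preimage (@cdom_open R M c) oA (fun z => @cmap_cont R M c z). Qed.

Lemma schart_img x : (cmap (schart x) @` cdom (schart x)) (cmap (schart x) x).
Proof. by exists x => //; exact: schart_dom. Qed.

Lemma schart_cinv x : cinv (schart x) (cmap (schart x) x) = x.
Proof. by apply: cmapK; exact: schart_dom. Qed.

Lemma near_schart_dom c x : cdom c x ->
  \forall z \near cmap (schart x) x, cdom c (cinv (schart x) z).
Proof.
move=> cx; apply: (cinv_cont (schart_img x)).
by rewrite schart_cinv; exact: open_near (@cdom_open R M c) cx.
Qed.

Lemma differentiable_trans c c' x : satlas c -> satlas c' -> cdom c x -> cdom c' x ->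
  differentiable (cmap c' \o cinv c) (cmap c x).
Proof.
move=> Ac Ac' cx c'x; have [d _] := strans_smooth Ac Ac' 1%N.
by apply: d; exists x.
Qed.

(** [mdiff] is computed in the chart [schart x]; the chain rule through the transition map, defined
    near x, allows any other chart [c]. *)
Lemma mdiff_chart (W : normedModType R) (f : M -> W) c x u : satlas c -> cdom c x ->
  differentiable (f \o cinv c) (cmap c x) ->
  mdiff f x u = 'd (f \o cinv c) (cmap c x) (mdiff (cmap c) x u).
Proof.
move=> Ac cx df; have dt := differentiable_trans (schart_atlas x) Ac (schart_dom x) cx.
set t := cmap c \o cinv (schart x) in dt.
have tx : t (cmap (schart x) x) = cmap c x by rewrite /t /= schart_cinv.
have df' : differentiable (f \o cinv c) (t (cmap (schart x) x)) by rewrite tx.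
have nf : \forall z \near cmap (schart x) x, (f \o cinv c) (t z) = (f \o cinv (schart x)) z.
  by apply: filterS (near_schart_dom cx) => z cz; rewrite /t /= cmapK.
have dft := differentiable_comp dt df'.
apply: (etrans (congr1 (fun L : R * R -> W => L u) (near_eq_diff nf dft))).
apply: (etrans (diff_compE u dt df')).
exact (congr1 (fun z => 'd (f \o cinv c) z ('d t (cmap (schart x) x) u)) tx).
Qed.

Lemma mdiff_cmap_det c x : satlas c -> cdom c x ->
  0 < det2 (mdiff (cmap c) x (1, 0)) (mdiff (cmap c) x (0, 1)).
Proof. by move=> Ac cx; exact: (strans_pos (schart_atlas x) Ac (schart_dom x) cx). Qed.

Lemma smooth_differentiable (V W : normedModType R) (U : set V) (f : V -> W) z :
  smooth_on U f -> U z -> differentiable f z.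
Proof. by move=> Sf Uz; have [d _] := Sf 1%N; exact: d. Qed.

Lemma msmooth_differentiable (W : normedModType R) (U : set M) (f : M -> W) c x :
  msmooth U f -> satlas c -> cdom c x -> U x -> differentiable (f \o cinv c) (cmap c x).
Proof. by move=> Sf Ac cx Ux; apply: smooth_differentiable (Sf c Ac) _; exists x. Qed.

Lemma mulr1_neq0r (s t : R) : s * t = 1 -> t != 0.
Proof. by move=> st; apply/eqP => t0; move/eqP: st; rewrite t0 mulr0 eq_sym oner_eq0. Qed.

Lemma det2_inj2 (L : {linear (R * R)%type -> (R * R)%type}) u v :
  det2 (L (1, 0)) (L (0, 1)) != 0 -> L u = L v -> u = v.
Proof.
move=> d0 uv; apply/eqP; rewrite -subr_eq0; apply/eqP; apply: (det2_inj d0).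
by rewrite linearB uv subrr.
Qed.

(** [lorentz_chart] without conformality and with the inverse [b] named, so that differentials can
    be inverted before anything is known about [sig]. *)
Definition smooth_chart (U : set (lorentz R)) (a : lorentz R -> M) (b : M -> lorentz R) : Prop :=
  [/\ open U, open (a @` U) & forall z, U z -> {for z, continuous a}] /\
  [/\ forall c : chart R M, satlas c -> smooth_on (U `&` (a @^-1` cdom c)) (cmap c \o a),
      forall z, U z -> b (a z) = z & msmooth (a @` U) b].

Lemma lorentz_chart_smooth sig U a : lorentz_chart sig U a -> exists b, smooth_chart U a b.
Proof. by case=> oU [oaU [ca [Sa [[b [ab Sb]] _]]]]; exists b. Qed.

Section SmoothChart.
Variables (U : set (lorentz R)) (a : lorentz R -> M) (b : M -> lorentz R).
Hypothesis ch : smooth_chart U a b.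

Lemma differentiable_chart c z : satlas c -> U z -> cdom c (a z) ->
  differentiable (cmap c \o a) z.
Proof.
move=> Ac Uz cz; have [_ [Sa _ _]] := ch.
by apply: smooth_differentiable (Sa c Ac) _.
Qed.

Lemma near_chart_dom (A : set M) z : U z -> open A -> A (a z) ->
  \forall w \near z, U w /\ A (a w).
Proof.
move=> Uz oA Az; have [[oU _ ca] _] := ch.
have n1 : \forall w \near z, U w by exact: open_near oU Uz.
have n2 : \forall w \near z, A (a w) by apply: (ca z Uz); exact: open_near.
exact: filterI n1 n2.
Qed.

Lemma diff_along_chart (W : normedModType R) (A : set M) (f : M -> W) z : open A -> msmooth A f ->
  U z -> A (a z) -> differentiable (f \o a) z /\
  forall w, 'd (f \o a) z w = mdiff f (a z) (chart_diff a z w).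
Proof.
move=> oA Sf Uz Az; set x := a z; set c := schart x.
have da : differentiable (cmap c \o a) z.
  exact: differentiable_chart (schart_atlas x) Uz (schart_dom x).
have df : differentiable (f \o cinv c) ((cmap c \o a) z).
  exact: msmooth_differentiable Sf (schart_atlas x) (schart_dom x) Az.
have nf : \forall w \near z, (f \o cinv c) ((cmap c \o a) w) = (f \o a) w.
  by apply: filterS (near_chart_dom Uz (@cdom_open R M c) (schart_dom x)) => w [_ cw];
    rewrite /= cmapK.
have dfa := differentiable_comp da df; split.
  exact: near_eq_differentiable nf dfa.
move=> w; apply: (etrans (congr1 (fun L : lorentz R -> W => L w) (near_eq_diff nf dfa))).
exact: (diff_compE w da df).
Qed.

Lemma mdiff_chartK z w : U z -> mdiff b (a z) (chart_diff a z w) = w.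
Proof.
move=> Uz; have [[oU oaU ca] [_ ab Sb]] := ch.
have Az : (a @` U) (a z) by exists z.
have [_ <-] := diff_along_chart oaU Sb Uz Az.
have nid : \forall w \near z, w = (b \o a) w.
  by apply: filterS (open_near oU Uz) => t Ut; rewrite /= ab.
have [_ e] := near_eq_is_diff nid (is_diff_id z).
exact (congr1 (fun l : lorentz R -> lorentz R => l w) e).
Qed.

Lemma chart_diff_det z : U z -> det2 (chart_diff a z 1) (chart_diff a z lsigma) *
  det2 (mdiff b (a z) (1, 0)) (mdiff b (a z) (0, 1)) = 1.
Proof.
move=> Uz; have h := mdiff_chartK 1 Uz; have h' := mdiff_chartK lsigma Uz.
have detM (L : {linear (R * R)%type -> (R * R)%type}) (u v : R * R) :
    det2 u v * det2 (L (1, 0)) (L (0, 1)) = det2 (L u) (L v).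
  by rewrite (linear_prodE L u) (linear_prodE L v) /det2 /= /GRing.scale/=; ring.
apply: (etrans (detM ('d (b \o cinv (schart (a z))) (cmap (schart (a z)) (a z))) _ _)).
apply: (etrans (congr2 (@det2 R) h h')).
by rewrite /det2 /=; ring.
Qed.

(** In the plane the left inverse of [mdiff_chartK] is also a right inverse, because its determinant
    is nonzero. *)
Lemma chart_diffK z u : U z -> chart_diff a z (mdiff b (a z) u) = u.
Proof.
move=> Uz; have d0 := mulr1_neq0r (chart_diff_det Uz).
apply: (@det2_inj2 ('d (b \o cinv (schart (a z))) (cmap (schart (a z)) (a z))) _ _ d0).
exact (mdiff_chartK (mdiff b (a z) u) Uz).
Qed.

End SmoothChart.

End SurfaceCharts.

(** * Null directions of the Lorentz structure *)

Section NullDirections.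
Variables (R : realType) (M : surface R) (g : M -> lquat R).
Variable sig : M -> R * R -> (R * R)%type.
Hypothesis Sg : msmooth setT g.
Hypothesis g_conf : forall x u, mdiff g x (sig x u) = qscale lsigma (mdiff g x u).
Hypothesis g_inj : forall x u, mdiff g x u = 0 -> u = 0.
Hypothesis sig_lin : forall x (a : R) u v, sig x (a *: u + v) = a *: sig x u + sig x v.
Hypothesis sigK : forall x u, sig x (sig x u) = u.
Hypothesis sig_neq : forall x, sig x <> id /\ sig x <> -%R.

Lemma sigD x u v : sig x (u + v) = sig x u + sig x v.
Proof. by have := sig_lin x 1 u v; rewrite !scale1r. Qed.

Lemma sigN x u : sig x (- u) = - sig x u.
Proof.
have s0 : sig x 0 = 0 by apply/(addrI (sig x 0)); rewrite -sigD !addr0.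
by have := sig_lin x (-1) u 0; rewrite !scaleN1r s0 !addr0.
Qed.

(** The vectors sig u + e u are eigenvectors for e because sig is an involution, and they are not
    all zero because sig differs from -e id. *)
Lemma eigenvector (e : R) x : e = 1 \/ e = -1 -> exists2 u, u != 0 & sig x u = e *: u.
Proof.
have [s1 s2] := sig_neq x; case=> ->.
  apply: contrapT => h; apply: s2; rewrite funeqE => u.
  apply/eqP; rewrite -subr_eq0 opprK; apply/negP => su0; apply: h.
  exists (sig x u + u); first exact/negP.
  by rewrite scale1r sigD sigK addrC.
apply: contrapT => h; apply: s1; rewrite funeqE => u.
apply/eqP; rewrite -subr_eq0; apply/negP => su0; apply: h.
exists (sig x u - u); first exact/negP.
by rewrite scaleN1r sigD sigN sigK opprB.
Qed.

Lemma mdiff_pq (e : R) x u i : e * e = 1 ->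
  pq e i (mdiff g x (sig x u)) = e * pq e i (mdiff g x u).
Proof. by move=> ee; rewrite g_conf pq_sigma. Qed.

Lemma pq_eigen (e : R) x u i : e * e = 1 -> sig x u = (- e) *: u -> pq e i (mdiff g x u) = 0.
Proof.
move=> ee su; have := mdiff_pq x u i ee; rewrite su.
have -> : mdiff g x ((- e) *: u) = (- e) *: mdiff g x u by exact: linearZ.
rewrite linearZ /= /GRing.scale/= => h.
have e0 : e != 0 by apply/eqP => e0; move/eqP: ee; rewrite e0 mulr0 eq_sym oner_eq0.
have /eqP : e * pq e i (mdiff g x u) = 0 by move: h; lra.
by rewrite mulf_eq0 (negbTE e0) => /eqP.
Qed.

Lemma mdiff_neq0 x u : u != 0 -> mdiff g x u <> 0.
Proof. by move=> /eqP u0 /g_inj. Qed.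

(** By [mdiff_pq] the part of dg in the factor e is multiplied by e under sig, so it vanishes on the
    eigenvectors of sig for -e. On a nonzero eigenvector one part of dg thus vanishes, and the other
    cannot since dg is injective. *)
Lemma null_split_g c x : satlas c -> cdom c x ->
  null_split (fun i z => pq 1 i (g (cinv c z))) (fun i z => pq (-1) i (g (cinv c z))) (cmap c x).
Proof.
move=> Ac cx.
have dg : differentiable (g \o cinv c) (cmap c x) by exact: msmooth_differentiable Sg Ac cx _.
have dpq e i u : 'd (fun z => pq e i (g (cinv c z))) (cmap c x) (mdiff (cmap c) x u) =
    pq e i (mdiff g x u).
  have [_ E] := diff_linear_comp (@pq_continuous R e i) dg.
  by apply: (etrans (E _)); congr (pq e i _); exact (esym (mdiff_chart u Ac cx dg)).
have ee1 : (1 : R) * 1 = 1 by rewrite mulr1.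
have eeN : (-1 : R) * -1 = 1 by rewrite mulrNN mulr1.
have [u u0 su] := eigenvector x (or_introl erefl).
have [w w0 sw] := eigenvector x (or_intror erefl).
have Nu i : pq (-1) i (mdiff g x u) = 0 by apply: pq_eigen => //; rewrite opprK.
have Pw i : pq 1 i (mdiff g x w) = 0 by apply: pq_eigen.
exists (mdiff (cmap c) x u), (mdiff (cmap c) x w); split.
- by move=> i; exact: (etrans (dpq _ _ _) (Nu i)).
- by move=> i; exact: (etrans (dpq _ _ _) (Pw i)).
- apply: contrapT => /forallNP h; apply: (mdiff_neq0 u0); apply: pq_ext => i; rewrite linear0 ?Nu//.
  by have /negP := h i; rewrite negbK => /eqP; apply: etrans; exact: esym (dpq _ _ _).
- apply: contrapT => /forallNP h; apply: (mdiff_neq0 w0); apply: pq_ext => i; rewrite linear0 ?Pw//.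
  by have /negP := h i; rewrite negbK => /eqP; apply: etrans; exact: esym (dpq _ _ _).
Qed.

Lemma sq_conformal (u v : lorentz R) : pe 1 (u - v) ^+ 2 = 0 -> pe (-1) (u + v) ^+ 2 = 0 ->
  u = lsigma * v.
Proof.
move=> /eqP; rewrite sqrf_eq0 linearB subr_eq0 => /eqP h1 /eqP.
rewrite sqrf_eq0 linearD addr_eq0 => /eqP h2; apply: pe_ext.
  by rewrite peM ?mulr1// pe_sigma mul1r.
by rewrite peM ?mulrNN ?mulr1// pe_sigma mulN1r.
Qed.

(** In the factor e the hypothesis says that the square of the linear form pe e (db) is the square
    norm of the corresponding part of dg, so the form vanishes where that part does. This is the
    case on sig u - e u, whence pe e (db (sig u)) = e pe e (db u) for both e. *)
Lemma conformal_of_square (b : M -> lorentz R) x :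
  (forall u, mdiff b x u * mdiff b x u = qform (mdiff g x u) (mdiff g x u)) ->
  forall u, mdiff b x (sig x u) = lsigma * mdiff b x u.
Proof.
move=> bsq u.
have sq e v : e * e = 1 -> (forall i, pq e i (mdiff g x v) = 0) -> pe e (mdiff b x v) ^+ 2 = 0.
  by move=> ee h; rewrite expr2 -peM// bsq pe_qform// big1// => i _; rewrite h expr0n.
have ee1 : (1 : R) * 1 = 1 by rewrite mulr1.
have eeN : (-1 : R) * -1 = 1 by rewrite mulrNN mulr1.
have bB : mdiff b x (sig x u - u) = mdiff b x (sig x u) - mdiff b x u by exact: linearB.
have bD : mdiff b x (sig x u + u) = mdiff b x (sig x u) + mdiff b x u by exact: linearD.
have gB : mdiff g x (sig x u - u) = mdiff g x (sig x u) - mdiff g x u by exact: linearB.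
have gD : mdiff g x (sig x u + u) = mdiff g x (sig x u) + mdiff g x u by exact: linearD.
apply: sq_conformal.
  rewrite -bB; apply: sq => // i; rewrite gB linearB /=.
  by rewrite (mdiff_pq x u i ee1) mul1r subrr.
rewrite -bD; apply: sq => // i; rewrite gD linearD /=.
by rewrite (mdiff_pq x u i eeN) mulN1r addNr.
Qed.

Lemma chart_conformal U a b : smooth_chart U a b ->
  (forall z, U z -> forall u, mdiff b (a z) (sig (a z) u) = lsigma * mdiff b (a z) u) ->
  forall z, U z -> forall w, chart_diff a z (lsigma * w) = sig (a z) (chart_diff a z w).
Proof.
move=> ch bs z Uz w.
rewrite -[RHS](chart_diffK ch _ Uz); congr (chart_diff a z _).
by rewrite bs// (mdiff_chartK ch).
Qed.

Definition gderiv (a : lorentz R -> M) (z : lorentz R) : lquat R :=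
  mdiff g (a z) (chart_diff a z 1).

Lemma lorentz_deriv_g U a b : smooth_chart U a b ->
  (forall z, U z -> forall w, chart_diff a z (lsigma * w) = sig (a z) (chart_diff a z w)) ->
  lorentz_deriv U (g \o a) (gderiv a).
Proof.
move=> ch conf z Uz; have [d dE] := diff_along_chart ch openT Sg Uz I; split=> // w.
apply: (etrans (dE w)).
have -> : chart_diff a z w = w.1 *: chart_diff a z 1 + w.2 *: sig (a z) (chart_diff a z 1).
  rewrite -conf// mulr1 -!linearZ -linearD; congr ('d _ z _); exact: lorentz_dec.
have -> : mdiff g (a z) (w.1 *: chart_diff a z 1 + w.2 *: sig (a z) (chart_diff a z 1)) =
    w.1 *: mdiff g (a z) (chart_diff a z 1) + w.2 *: mdiff g (a z) (sig (a z) (chart_diff a z 1)).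
  by rewrite /mdiff linearD linearZ [X in _ + X]linearZ.
by rewrite g_conf -qscaleZ -{1}[mdiff g _ _]qscale1 -qscaleZ -qscaleD -lorentz_dec.
Qed.

End NullDirections.

(** * Existence of adapted charts *)

Section ExistenceOfCharts.
Variables (R : realType) (M : surface R) (g : M -> lquat R).
Variable sig : M -> R * R -> (R * R)%type.
Hypothesis Sg : msmooth setT g.
Hypothesis g_conf : forall x u, mdiff g x (sig x u) = qscale lsigma (mdiff g x u).
Hypothesis g_inj : forall x u, mdiff g x u = 0 -> u = 0.
Hypothesis sig_lin : forall x (a : R) u v, sig x (a *: u + v) = a *: sig x u + sig x v.
Hypothesis sigK : forall x u, sig x (sig x u) = u.
Hypothesis sig_neq : forall x, sig x <> id /\ sig x <> -%R.

Lemma cmap_smooth_chart (c : chart R M) (V : set (R * R)) (b i : R * R -> R * R) :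
  satlas c -> open V -> V `<=` cmap c @` cdom c -> open (b @` V) ->
  (forall z, V z -> i (b z) = z) -> smooth_on V b -> smooth_on (b @` V) i ->
  @smooth_chart R M (b @` V) (cinv c \o i) (b \o cmap c).
Proof.
move=> Ac oV VO oW iK Sb Si.
have iV w : (b @` V) w -> V (i w) by case=> z Vz <-; rewrite iK.
have imE : (cinv c \o i) @` (b @` V) = cdom c `&` cmap c @^-1` V.
  apply/seteqP; split=> [_ [_ [z Vz <-] <-]|x [cx Vx]].
    by rewrite /= iK//; have [h1 h2] := cinv_dom (VO _ Vz); rewrite /= h2.
  by exists (b (cmap c x)); [exists (cmap c x)|rewrite /= iK// cmapK].
have oim : open ((cinv c \o i) @` (b @` V)) by rewrite imE; exact: open_cpre.
have ci w : (b @` V) w -> {for w, continuous i}.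
  by move=> Ww; exact: (Si 0%N w Ww).
have ca w : (b @` V) w -> {for w, continuous (cinv c \o i)}.
  by move=> Ww; exact: (continuous_comp (ci w Ww) (@cinv_cont R M c (i w) (VO _ (iV _ Ww)))).
have bK w : (b @` V) w -> b (i w) = w by case=> z Vz <-; rewrite iK.
split; [split; [exact oW|exact oim|exact ca]|split].
- move=> c' Ac' k.
  have oD : open ((b @` V) `&` (cinv c \o i) @^-1` cdom c').
    exact (open_setI_preimage oW (@cdom_open R M c') ca).
  have Ci : Ck k ((b @` V) `&` (cinv c \o i) @^-1` cdom c') i by apply: Ck_sub (Si k) => w [].
  apply: (Ck_comp oD _ Ci (strans_smooth Ac Ac' k)).
  move=> w [Ww c'w]; have [h1 h2] := cinv_dom (VO _ (iV _ Ww)).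
  by exists (cinv c (i w)).
- by move=> w Ww /=; have [h1 h2] := cinv_dom (VO _ (iV _ Ww)); rewrite h2 bK.
- move=> c' Ac' k; have oD := @open_cimg R M c' _ oim.
  have St : Ck k (cmap c' @` (cdom c' `&` (cinv c \o i) @` (b @` V))) (cmap c \o cinv c').
    apply: Ck_sub (strans_smooth Ac' Ac k) => _ [x [c'x imx] <-]; exists x => //.
    by split=> //; move: imx; rewrite imE => -[].
  apply: (Ck_comp oD _ St (Sb k)) => _ [x [c'x imx] <-] /=.
  by rewrite cmapK//; move: imx; rewrite imE => -[].
Qed.

Lemma diff_pq c x e i u : satlas c -> cdom c x ->
  'd (fun z => pq e i (g (cinv c z))) (cmap c x) (mdiff (cmap c) x u) = pq e i (mdiff g x u).
Proof.
move=> Ac cx.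
have dg : differentiable (g \o cinv c) (cmap c x) by exact: msmooth_differentiable Sg Ac cx _.
have [_ E] := diff_linear_comp (@pq_continuous R e i) dg.
by apply: (etrans (E _)); congr (pq e i _); exact (esym (mdiff_chart u Ac cx dg)).
Qed.

Lemma det2_comp (L L' : {linear (R * R)%type -> (R * R)%type}) :
  det2 (L (L' (1, 0))) (L (L' (0, 1))) =
  det2 (L (1, 0)) (L (0, 1)) * det2 (L' (1, 0)) (L' (0, 1)).
Proof.
by rewrite (linear_prodE L (L' (1, 0))) (linear_prodE L (L' (0, 1))) /det2 /=
  /GRing.scale/=; ring.
Qed.

(** The two equations of [null_chart] are the null projections of the single identity db * db =
    H(dg, dg) in A. From it come both the conformality of the chart, through [conformal_of_square],
    and the normalization of g', by evaluation at the vector on which db is 1. *)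
Lemma exists_adapted_chart (p : M) : exists U a g',
  adapted_chart sig g U a g' /\ (a @` U) p.
Proof.
set c := schart p; have Ac : satlas c := schart_atlas p.
have gT : (fun _ : M => True) = setT by [].
have Sgc : smooth_on (cmap c @` cdom c) (g \o cinv c).
  by have := Sg Ac; rewrite setIT.
have oO : open (cmap c @` cdom c) := @cimg_open R M c.
have Spq e i : smooth_on (cmap c @` cdom c) (fun z => pq e i (g (cinv c z))).
  move=> k; exact: (Ck_linear_comp (L := pq e i) oO (@pq_continuous R e i) (Sgc k)).
have sp z : (cmap c @` cdom c) z ->
    null_split (fun i z => pq 1 i (g (cinv c z))) (fun i z => pq (-1) i (g (cinv c z))) z.
  by case=> x cx <-; exact: null_split_g.
have [V [b [i [[oV Vp VO oW iK] [Sb Si det0 sq]]]]] :=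
  null_chart oO (schart_img p) (Spq 1) (Spq (-1)) sp.
pose a : lorentz R -> M := cinv c \o i; pose U : set (lorentz R) := b @` V.
pose B : M -> lorentz R := b \o cmap c.
have ch : smooth_chart U a B := cmap_smooth_chart Ac oV VO oW iK Sb Si.
have aU z : U z -> cdom c (a z) /\ V (cmap c (a z)).
  case=> y Vy <-; rewrite /a /= iK//; have [h1 h2] := cinv_dom (VO _ Vy).
  by rewrite h2.
have dbc z : U z -> differentiable (B \o cinv c) (cmap c (a z)).
  move=> Uz; have [_ [_ _ SB]] := ch; have [ca _] := aU _ Uz.
  by apply: msmooth_differentiable SB Ac ca _; exists z.
have dB z u : U z -> mdiff B (a z) u = 'd b (cmap c (a z)) (mdiff (cmap c) (a z) u).
  move=> Uz; have [ca Va] := aU _ Uz.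
  apply: (etrans (mdiff_chart u Ac ca (dbc _ Uz))).
  have nb : \forall y \near cmap c (a z), (B \o cinv c) y = b y.
    have := open_near oV Va; apply: filterS => y Vy.
    by rewrite /B /=; have [_ ->] := cinv_dom (VO _ Vy).
  exact (esym (congr1 (fun L : R * R -> R * R => L (mdiff (cmap c) (a z) u))
    (near_eq_diff nb (dbc _ Uz)))).
have ee1 : (1 : R) * 1 = 1 by rewrite mulr1.
have eeN : (-1 : R) * -1 = 1 by rewrite mulrNN mulr1.
have Bsq z : U z -> forall u,
    mdiff B (a z) u * mdiff B (a z) u = qform (mdiff g (a z) u) (mdiff g (a z) u).
  move=> Uz u; have [ca Va] := aU _ Uz.
  have [s1 s2] := sq _ Va (mdiff (cmap c) (a z) u).
  apply: pe_ext; rewrite peM// pe_qform// -expr2.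
    rewrite /pe mul1r; apply: (etrans (congr1 (fun w => (w.1 + w.2) ^+ 2) (dB z u Uz))).
    apply: (etrans s1); apply: eq_bigr => j _; congr (_ ^+ 2); exact (diff_pq 1 j u Ac ca).
  rewrite /pe mulN1r; apply: (etrans (congr1 (fun w => (w.1 - w.2) ^+ 2) (dB z u Uz))).
  apply: (etrans s2); apply: eq_bigr => j _; congr (_ ^+ 2); exact (diff_pq (-1) j u Ac ca).
have conf := chart_conformal ch (fun z Uz => conformal_of_square g_conf (Bsq z Uz)).
exists U, a, (gderiv g a); split; last first.
  exists (b (cmap c p)); first by exists (cmap c p).
  by rewrite /a /= iK//; exact: schart_cinv.
have [[oU oaU ca] [Sa BK SB]] := ch.
split; [split; [exact oU|]|split; [|split]].
- split; [exact oaU|split; [exact ca|split; [exact Sa|split; [|exact conf]]]].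
  by exists B; split; [exact BK|exact SB].
(* The inverse of the new chart is a positive transition map followed by the positive map [b], so
   the new chart is positive. *)
- move=> z Uz; have := chart_diff_det ch Uz; have [caz Va] := aU _ Uz.
  have e1 := congr2 (@det2 R) (dB z (1, 0) Uz) (dB z (0, 1) Uz).
  have e2 := det2_comp ('d b (cmap c (a z)))
    ('d (cmap c \o cinv (schart (a z))) (cmap (schart (a z)) (a z))).
  have pos := mulr_gt0 (det0 _ Va) (mdiff_cmap_det Ac caz).
  have pos' := eq_ind_r (fun t => 0 < t) pos (etrans e1 e2).
  move=> d1; rewrite -(pmulr_lgt0 _ pos').
  exact (eq_ind_r (fun t => 0 < t) ltr01 d1).
- exact (lorentz_deriv_g Sg g_conf ch conf).
- by move=> z Uz; rewrite /gderiv -(Bsq z Uz) (mdiff_chartK ch) ?mulr1.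
Qed.

End ExistenceOfCharts.

(** * Uniqueness of adapted charts *)

Section Transition.
Variables (R : realType) (M : surface R) (g : M -> lquat R).
Variable sig : M -> R * R -> (R * R)%type.
Hypothesis Sg : msmooth setT g.
Local Notation A := (lorentz R).

Lemma chart_conf_inv U a b z u : smooth_chart U a b -> lorentz_chart sig U a -> U z ->
  mdiff b (a z) (sig (a z) u) = lsigma * mdiff b (a z) u.
Proof.
move=> ch [_ [_ [_ [_ [_ conf]]]]] Uz.
rewrite -{1}(chart_diffK ch u Uz) -(conf _ Uz); exact: (mdiff_chartK ch _ Uz).
Qed.

Lemma adapted_deriv U a g' z : adapted_chart sig g U a g' -> U z ->
  g' z = mdiff g (a z) (chart_diff a z 1).
Proof.
move=> [la [_ [dg _]]] Uz; have [b ch] := lorentz_chart_smooth la.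
have [_ E] := diff_along_chart ch openT Sg Uz I; have [_ E'] := dg z Uz.
by rewrite -E E' qscale1.
Qed.

(** The square roots of 1 in A are 1, -1, sigma and -sigma; the determinant of the multiplication by
    a + sigma b is a^2 - b^2, which is -1 for the last two. *)
Lemma unit_pos_lorentz (t : A) : t * t = 1 -> 0 < det2 t (lsigma * t) ->
  (t = 1 \/ t = - 1).
Proof.
case: t => a b /[dup] /(congr1 fst) /= h1 /(congr1 snd) /= h2.
rewrite /det2 /= !mul0r !mul1r !add0r => h3.
have ab : a * b = 0 by lra.
have b0 : b = 0.
  move/eqP: ab; rewrite mulf_eq0 => /orP[/eqP a0|/eqP//].
  by move: h3; rewrite a0 mul0r sub0r oppr_gt0 ltNge -expr2 sqr_ge0.
have /eqP : (a - 1) * (a + 1) = 0 by rewrite b0 in h1; lra.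
rewrite mulf_eq0 => /orP[/eqP ha|/eqP ha]; [left|right]; apply: lorentz_ext => /=;
  rewrite ?b0 ?oppr0//; lra.
Qed.

(** Distinct signs are at distance 2, so a variation of at most 1 of the differential of a
    transition map freezes its sign. *)
Lemma sign_close (s t : R) : s * s = 1 -> t * t = 1 -> -1 <= s - t <= 1 -> t = s.
Proof.
move=> ss tt /andP[h1 h2].
have /eqP : (s - t) * (s + t) = 0 by rewrite mulrBl !mulrDr ss tt; ring.
rewrite mulf_eq0 subr_eq0 addr_eq0 => /orP[/eqP ->//|/eqP sE].
rewrite sE in h1 h2; nra.
Qed.

Lemma scale1_inj (s t : R) : s *: (1 : A) = t *: (1 : A) -> s = t.
Proof. by move=> /(congr1 (fun w : A => w.1)); rewrite /= /GRing.scale/= !mulr1. Qed.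

Lemma scale1_close (s t : R) (p q : A) : p = s *: (1 : A) -> q = t *: (1 : A) ->
  `|p - q| <= 1 -> -1 <= s - t <= 1.
Proof.
move=> -> ->; rewrite -scalerBl => h.
by have := le_trans (norm_fst ((s - t) *: (1 : A))) h; rewrite /= /GRing.scale/= mulr1 ler_norml.
Qed.

(** Stated after projection by [pe k] because the mean value theorem behind [eq_translate] concerns
    real functions. *)
Lemma pe_sub_const (k e r : R) (T : A -> A) (z : A) :
  (forall v, `|v - z| < r -> differentiable T v /\ forall u, 'd T v u = e *: u) ->
  forall w, `|w - z| < r -> pe k (T w - e *: w) = pe k (T z - e *: z).
Proof.
move=> dT w wr; pose h v : R := pe k (T v - e *: v).
have zr : `|z - z| < r by rewrite subrr normr0 (le_lt_trans (normr_ge0 _) wr).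
have dh v : `|v - z| < r -> differentiable h v /\ 'd h v (w - z) = 0.
  move=> /dT[d dE]; have [d1 E1] := is_diffB (differentiableP d) (is_diff_scaler e v).
  have [d2 E2] := diff_linear_comp (@pe_continuous R k) d1.
  split; first exact d2.
  apply: (etrans (E2 _)); apply: (etrans (congr1 (fun L : A -> A => pe k (L (w - z))) E1)).
  by rewrite -[X in pe k X]/('d T v (w - z) - e *: (w - z)) dE subrr linear0.
have := eq_translate dh zr; rewrite (addrC z) subrK; exact.
Qed.

(* The transition map has an A-linear differential t, and t^2 = 1 because both
   derivatives of g have norm 1; positivity excludes t = sigma and t = -sigma. *)
Lemma adapted_transition U1 a1 g1' U2 a2 g2' b2 z1 z2 :
  adapted_chart sig g U1 a1 g1' -> adapted_chart sig g U2 a2 g2' ->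
  smooth_chart U2 a2 b2 -> U1 z1 -> U2 z2 -> a1 z1 = a2 z2 ->
  exists2 e : R, e * e = 1 & g1' z1 = e *: g2' z2 /\
    forall w, mdiff b2 (a1 z1) (chart_diff a1 z1 w) = e *: w.
Proof.
move=> ad1 ad2 ch2 U1z U2z a12.
have [la1 [pos1 [dg1 n1]]] := ad1; have [la2 [pos2 [dg2 n2]]] := ad2.
have [b1 ch1] := lorentz_chart_smooth la1.
pose t := mdiff b2 (a1 z1) (chart_diff a1 z1 1).
have conf1 : forall w, chart_diff a1 z1 (lsigma * w) = sig (a1 z1) (chart_diff a1 z1 w).
  by have [_ [_ [_ [_ [_ c1]]]]] := la1; exact: c1.
have tD : chart_diff a2 z2 t = chart_diff a1 z1 1.
  by rewrite /t; move: (chart_diff a1 z1 1); rewrite a12 => u; exact (chart_diffK ch2 u U2z).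
have ts : mdiff b2 (a1 z1) (chart_diff a1 z1 lsigma) = lsigma * t.
  by rewrite -[X in chart_diff a1 z1 X]mulr1 conf1 /t a12; exact (chart_conf_inv _ ch2 la2 U2z).
have sD : chart_diff a2 z2 (lsigma * t) = chart_diff a1 z1 lsigma.
  by rewrite -ts; move: (chart_diff a1 z1 lsigma); rewrite a12 => u; exact (chart_diffK ch2 u U2z).
have g12 : g1' z1 = qscale t (g2' z2).
  rewrite (adapted_deriv ad1 U1z) -tD a12.
  have [_ E] := diff_along_chart ch2 openT Sg U2z I; have [_ E'] := dg2 z2 U2z.
  by rewrite -E E'.
have tt : t * t = 1.
  by have := n1 _ U1z; rewrite g12 qform_qscale (n2 _ U2z) mulr1.
have dpos : 0 < det2 t (lsigma * t).
  have detM (L : {linear (R * R)%type -> (R * R)%type}) (u v : R * R) :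
      det2 u v * det2 (L (1, 0)) (L (0, 1)) = det2 (L u) (L v).
    by rewrite (linear_prodE L u) (linear_prodE L v) /det2 /= /GRing.scale/=; ring.
  have p2 := pos2 _ U2z.
  rewrite -(pmulr_lgt0 _ p2).
  have := detM ('d (cmap (schart (a2 z2)) \o a2) z2) t (lsigma * t).
  rewrite -[X in _ = X]/(det2 (chart_diff a2 z2 t) (chart_diff a2 z2 (lsigma * t))).
  rewrite tD sD => E; exact (eq_ind_r (fun t => 0 < t) (pos1 _ U1z) E).
have [e ee te] : exists2 e : R, e * e = 1 & t = e *: (1 : A).
  have [->|->] := unit_pos_lorentz tt dpos.
    by exists 1; [rewrite mulr1|rewrite scale1r].
  by exists (-1); [rewrite mulrNN mulr1|rewrite scaleN1r].
exists e => //; split; first by rewrite g12 te qscaleZ qscale1.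
move=> w; rewrite {1}(lorentz_dec w).
have -> : chart_diff a1 z1 (w.1 *: (1 : A) + w.2 *: lsigma) =
    w.1 *: chart_diff a1 z1 1 + w.2 *: chart_diff a1 z1 lsigma.
  by rewrite /chart_diff linearD linearZ [X in _ + X]linearZ.
have -> : mdiff b2 (a1 z1) (w.1 *: chart_diff a1 z1 1 + w.2 *: chart_diff a1 z1 lsigma) =
    w.1 *: t + w.2 *: (lsigma * t).
  by rewrite -ts /t /mdiff linearD linearZ [X in _ + X]linearZ.
have -> : lsigma * t = e *: (lsigma : A).
  by rewrite te mulrC; have := scale_lmul e (1 : A) lsigma; rewrite mul1r.
by rewrite te [in RHS](lorentz_dec w) scalerDr !scalerA !(mulrC e).
Qed.

Lemma connected_locally_constant (T : topologicalType) (S : Type) (W : set T) (f : T -> S) :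
  open W -> connected W -> (forall x, W x -> \forall y \near x, f y = f x) ->
  forall x y, W x -> W y -> f x = f y.
Proof.
move=> oW cW lf x y Wx Wy.
suff BW : W `&` [set z | f z = f x] = W.
  have : (W `&` [set z | f z = f x]) y by rewrite BW.
  by case=> _ /= ->.
have opn (P : S -> Prop) : open (W `&` [set z | P (f z)]).
  apply: near_open => z [Wz Pz]; apply: filterI; first exact: open_near.
  by apply: filterS (lf z Wz) => u fu /=; rewrite fu.
apply: cW; first by exists x.
  by exists (W `&` [set z | f z = f x]); [exact: (opn (fun s => s = f x))|
    rewrite setIA setIid].
exists (~` (W `&` [set z | f z <> f x])).
  by apply: open_closedC; exact: (opn (fun s => s <> f x)).
apply/seteqP; split=> z [Wz fz]; split=> //=; first by case.
by apply: contrapT => nf; apply: fz.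
Qed.

Lemma msmooth_continuous (W : normedModType R) (B : set M) (f : M -> W) x :
  msmooth B f -> B x -> {for x, continuous f}.
Proof.
move=> Sf Bx; set c := schart x; have cx : cdom c x := schart_dom x.
have cf : {for cmap c x, continuous (f \o cinv c)}.
  by apply: (Sf c (schart_atlas x) 0%N); exists x.
have cfc := continuous_comp (@cmap_cont R M c x cx) cf.
have nf : \forall y \near x, ((f \o cinv c) \o cmap c) y = f y.
  by apply: filterS (open_near (@cdom_open R M c) cx) => y cy; rewrite /= cmapK.
rewrite /prop_for /continuous_at -(nbhs_singleton nf).
by apply: cvg_trans cfc; apply: near_eq_cvg; apply: filterS nf.
Qed.

Lemma smooth_along_chart (W : normedModType R) (B : set M) (f : M -> W) U a b :
  smooth_chart U a b -> open B -> msmooth B f -> smooth_on (U `&` a @^-1` B) (f \o a).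
Proof.
move=> ch oB Sf k; have [[oU oaU ca] [Sa bK Sb]] := ch.
apply: Ck_local => z [Uz Bz]; set c := schart (a z).
have cz : cdom c (a z) := schart_dom (a z).
have oBc : open (B `&` cdom c) := openI oB (@cdom_open R M c).
exists (U `&` a @^-1` (B `&` cdom c)); first by [].
have oD : open (U `&` a @^-1` (B `&` cdom c)) := open_setI_preimage oU oBc ca.
have Ca : Ck k (U `&` a @^-1` (B `&` cdom c)) (cmap c \o a).
  by apply: Ck_sub (Sa c (schart_atlas _) k) => w [Uw [_ cw]].
have Im w : (U `&` a @^-1` (B `&` cdom c)) w -> (cmap c @` (cdom c `&` B)) ((cmap c \o a) w).
  by move=> [_ [Bw cw]]; exists (a w).
apply: (Ck_ext oD _ (Ck_comp oD Im Ca (Sf c (schart_atlas _) k))).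
by move=> w [_ [_ cw]]; rewrite /= cmapK.
Qed.

(** The transition map is locally w |-> e w + b with e = 1 or e = -1. The pair (e, b) is read as a
    locally constant function of the point of [W], so connectedness makes it constant. *)
Lemma adapted_unique U1 a1 g1' U2 a2 g2' :
  adapted_chart sig g U1 a1 g1' -> adapted_chart sig g U2 a2 g2' ->
  forall W : set M, open W -> connected W -> W `<=` (a1 @` U1) `&` (a2 @` U2) ->
  exists2 t, @group_G R t & forall z, U1 z -> W (a1 z) -> U2 (t z) /\ a2 (t z) = a1 z.
Proof.
move=> ad1 ad2 W oW cW WU.
have [b1 ch1] := lorentz_chart_smooth ad1.1; have [b2 ch2] := lorentz_chart_smooth ad2.1.
have [[oU1 oaU1 ca1] [Sa1 bK1 Sb1]] := ch1; have [[oU2 oaU2 ca2] [Sa2 bK2 Sb2]] := ch2.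
pose T : A -> A := b2 \o a1.
have Wb1 x : W x -> U1 (b1 x) /\ a1 (b1 x) = x.
  by move=> /WU[[z Uz <-] _]; rewrite bK1.
have Wb2 x : W x -> U2 (b2 x) /\ a2 (b2 x) = x.
  by move=> /WU[_ [z Uz <-]]; rewrite bK2.
have dT z : U1 z -> W (a1 z) -> differentiable T z /\
    exists2 e : R, e * e = 1 & forall w, 'd T z w = e *: w.
  move=> Uz Wz; have [_ W2] := WU _ Wz; have [d E] := diff_along_chart ch1 oaU2 Sb2 Uz W2.
  split=> //; have [Uz2 az2] := Wb2 _ Wz.
  have [e ee [_ He]] := adapted_transition ad1 ad2 ch2 Uz Uz2 (esym az2).
  by exists e => // w; apply: (etrans (E w)).
pose e x : R := ('D_(1 : A) T (b1 x)).1.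
have eP z : U1 z -> W (a1 z) -> e (a1 z) * e (a1 z) = 1 /\ forall w, 'd T z w = e (a1 z) *: w.
  move=> Uz Wz; have [d [k kk dk]] := dT z Uz Wz.
  suff -> : e (a1 z) = k by [].
  rewrite /e bK1// (deriveE (1 : A) d).
  have := congr1 (fun w : A => w.1) (dk (1 : A)); rewrite /= /GRing.scale/= mulr1.
  exact.
pose kap x : R * A := (e x, b2 x - e x *: b1 x).
have lk x : W x -> \forall y \near x, kap y = kap x.
  move=> Wx; have [Uz az] := Wb1 _ Wx; set z := b1 x in Uz az.
  have Wz : W (a1 z) by rewrite az.
  have oO : open (U1 `&` a1 @^-1` W) := open_setI_preimage oU1 oW ca1.
  have CT : Ck 1 (U1 `&` a1 @^-1` W) T.
    apply: Ck_sub (smooth_along_chart ch1 oaU2 Sb2 1%N) => w [Uw Ww]; split=> //.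
    by have [_] := WU _ Ww.
  have Oz : (U1 `&` a1 @^-1` W) z by split.
  have ne : \forall w \near z, (U1 `&` a1 @^-1` W) w /\ `|'d T w (1 : A) - 'd T z (1 : A)| <= 1.
    exact: filterI (open_near oO Oz) (derive_near (1 : A) oO Oz CT ltr01).
  have /near_normP[r r0 rP] := ne.
  have ez w : `|w - z| < r -> (U1 `&` a1 @^-1` W) w /\ forall v, 'd T w v = e x *: v.
    move=> /rP[[Uw Ww] d1]; split; first by split.
    have [ee1 E1] := eP _ Uw Ww; have [ee2 E2] := eP _ Uz Wz.
    rewrite az in ee2 E2; suff -> : e x = e (a1 w) by exact: E1.
    apply: sign_close ee1 ee2 _; exact: scale1_close (E1 (1 : A)) (E2 (1 : A)) d1.
  have zr : `|z - z| < r by rewrite subrr normr0.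
  have Tc w : `|w - z| < r -> T w - e x *: w = T z - e x *: z.
    move=> wr; apply: pe_ext; apply: pe_sub_const wr => v vr; have [Ov Ev] := ez v vr;
    split=> //; by have [d _] := dT v Ov.1 Ov.2.
  have kw w : `|w - z| < r -> kap (a1 w) = kap x.
    move=> wr; have [[Uw Ww] Ew] := ez w wr.
    have ew : e (a1 w) = e x.
      have [_ E1] := eP _ Uw Ww; have := etrans (esym (E1 (1 : A))) (Ew (1 : A)).
      exact: scale1_inj.
    rewrite /kap ew bK1//; congr pair; apply: (etrans (Tc w wr)).
    by rewrite /T /= az.
  have nz : \forall w \near z, kap (a1 w) = kap x by apply/near_normP; exists r.
  have aUx : (a1 @` U1) x by exists z.
  have cb : {for x, continuous b1} := msmooth_continuous Sb1 aUx.
  have nW : \forall y \near x, W y by exact: open_near.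
  have nk : \forall y \near x, kap (a1 (b1 y)) = kap x by exact: cb nz.
  by apply: filterS2 nk nW => y ky Wy; have [_ ay] := Wb1 _ Wy; rewrite -{1}ay.
have kc := connected_locally_constant oW cW lk.
have [[x0 Wx0]|W0] := pselect (W !=set0); last first.
  exists (fun a => a + 0); first by exists 0; left.
  by move=> z _ Wz; case: W0; exists (a1 z).
have [Uz0 az0] := Wb1 _ Wx0; have Waz0 : W (a1 (b1 x0)) by rewrite az0.
have [ee _] := eP _ Uz0 Waz0; rewrite az0 in ee.
have tP (t : A -> A) : (forall z, t z = e x0 *: z + (b2 x0 - e x0 *: b1 x0)) ->
    forall z, U1 z -> W (a1 z) -> U2 (t z) /\ a2 (t z) = a1 z.
  move=> tE z Uz Wz; suff -> : t z = b2 (a1 z) by exact: Wb2.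
  have kE := kc _ _ Wx0 Wz; have e1 : e x0 = e (a1 z) := congr1 fst kE.
  have e2 : b2 x0 - e x0 *: b1 x0 = b2 (a1 z) - e (a1 z) *: b1 (a1 z) := congr1 snd kE.
  by rewrite tE e2 -e1 bK1// addrC subrK.
have : (e x0 - 1) * (e x0 + 1) = 0 by rewrite mulrBl mulrDr ee mul1r mulr1; ring.
move=> /eqP; rewrite mulf_eq0 subr_eq0 addr_eq0 => /orP[/eqP e1|/eqP e1].
  exists (fun a => a + (b2 x0 - e x0 *: b1 x0)).
    by exists (b2 x0 - e x0 *: b1 x0); left.
  by apply: tP => z; rewrite {2}e1 scale1r.
exists (fun a => - a + (b2 x0 - e x0 *: b1 x0)).
  by exists (b2 x0 - e x0 *: b1 x0); right.
by apply: tP => z; rewrite {2}e1 scaleN1r.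
Qed.

End Transition.

(** * Action of the group on adapted charts *)

Section GroupAction.
Variables (R : realType) (M : surface R) (g : M -> lquat R).
Variable sig : M -> R * R -> (R * R)%type.
Hypothesis sig_lin : forall x (a : R) u v, sig x (a *: u + v) = a *: sig x u + sig x v.
Local Notation A := (lorentz R).

Lemma is_diff_affine (e : R) (b z : A) :
  is_diff z (fun w : A => e *: w + b) (fun w : A => e *: w).
Proof.
have [d E] := is_diffD (is_diff_scaler e z) (is_diff_cst b z).
by apply: DiffDef; [exact d|apply: (etrans E); rewrite funeqE => w; exact: addr0].
Qed.

(** Writing the elements of the group as z |-> e z + b with e^2 = 1 treats both kinds together: the
    orientation determinant and H(g', g') are each multiplied by e^2. *)
Lemma adapted_affine U a g' (e : R) (b : A) : e * e = 1 -> adapted_chart sig g U a g' ->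
  adapted_chart sig g ((fun z : A => e *: z + b) @^-1` U) (a \o (fun z : A => e *: z + b))
    (fun z => e *: g' (e *: z + b)).
Proof.
move=> ee [[oU [oaU [ca [Sa [[b1 [bK Sb]] conf]]]]] [pos [dg nrm]]].
pose t (z : A) : A := e *: z + b; rewrite -/t.
pose t' (z : A) : A := e *: z + - (e *: b).
have tK z : t' (t z) = z.
  by rewrite /t /t' scalerDr scalerA ee scale1r addrK.
have t'K z : t (t' z) = z.
  by rewrite /t /t' scalerDr scalerN !scalerA ee !scale1r subrK.
have dt z : is_diff z t (fun w : A => e *: w) := is_diff_affine e b z.
have ct z : {for z, continuous t} by have [d _] := dt z; exact: differentiable_continuous.
have oU' : open (t @^-1` U).
  have -> : t @^-1` U = setT `&` t @^-1` U by rewrite setTI.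
  exact (open_setI_preimage openT oU (fun z _ => ct z)).
have Ck_t k (O : set A) (c : A) : open O -> Ck k O (fun z : A => e *: z + c).
  move=> oO; have Cid : Ck k O (id : A -> A).
    exact: (@Ck_linear R A A k O idfun (fun z => cvg_id)).
  exact: CkD oO (CkZ e oO Cid) (Ck_cst _ _ _).
have im : (a \o t) @` (t @^-1` U) = a @` U.
  apply/seteqP; split=> [_ [z Uz <-]|_ [z Uz <-]]; first by exists (t z).
  by exists (t' z); rewrite /= ?t'K.
have cat z : U (t z) -> {for z, continuous (a \o t)}.
  by move=> Uz; exact: (continuous_comp (ct z) (ca _ Uz)).
have dat z : U (t z) -> differentiable (cmap (schart (a (t z))) \o a) (t z).
  move=> Uz; apply: smooth_differentiable (Sa _ (schart_atlas (a (t z)))) _.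
  by split=> //; exact: schart_dom.
have cdE z w : U (t z) -> chart_diff (a \o t) z w = e *: chart_diff a (t z) w.
  move=> Uz; have [d E] := dt z; apply: (etrans (diff_compE w d (dat z Uz))).
  apply: (etrans (congr1 (fun L : A -> A => 'd (cmap (schart (a (t z))) \o a) (t z) (L w)) E)).
  by rewrite linearZ.
have sigZ x (k : R) u : sig x (k *: u) = k *: sig x u.
  have s0 : sig x 0 = 0.
    by apply/(addrI (sig x 0)); have := sig_lin x 1 0 0; rewrite !scale1r !addr0.
  by have := sig_lin x k u 0; rewrite s0 !addr0.
split; [split; [exact oU'|split; [by rewrite im|split; [exact cat|split]]]|].
- move=> c Ac k; have Sc := Sa c Ac k.
  have oD : open (t @^-1` U `&` (a \o t) @^-1` cdom c).
    exact (open_setI_preimage oU' (@cdom_open R M c) cat).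
  exact: (@Ck_comp R A _ k _ (U `&` a @^-1` cdom c) t (cmap c \o a) oD (fun z h => h)
    (Ck_t k _ b oD) Sc).
- split.
    exists (t' \o b1); split=> [z Uz|]; first by rewrite /= bK// tK.
    rewrite im => c Ac k; have oD := @open_cimg R M c _ oaU.
    exact: CkD oD (CkZ e oD (Sb c Ac k)) (Ck_cst _ _ _).
  move=> z Uz w; rewrite (cdE _ _ Uz) (cdE _ _ Uz) sigZ; congr (_ *: _); exact: conf.
split; [|split].
- move=> z Uz; rewrite (cdE _ _ Uz) (cdE _ _ Uz).
  have -> : det2 (e *: chart_diff a (t z) 1) (e *: chart_diff a (t z) lsigma) =
      e * e * det2 (chart_diff a (t z) 1) (chart_diff a (t z) lsigma).
    by rewrite /det2 /= /GRing.scale/=; ring.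
  by rewrite ee mul1r; exact: pos.
- move=> z Uz; have [d E] := dt z; have [dga Ega] := dg _ Uz; split.
    exact: differentiable_comp d dga.
  move=> w; apply: (etrans (diff_compE w d dga)).
  apply: (etrans (congr1 (fun L : A -> A => 'd (g \o a) (t z) (L w)) E)).
  rewrite Ega qscaleZ /qscale.
  by apply: lquat_ext; apply: lorentz_ext; rewrite /= /GRing.scale/=; ring.
- move=> z Uz; have -> : e *: g' (t z) = qscale (e *: (1 : A)) (g' (t z)).
    by rewrite qscaleZ qscale1.
  rewrite qform_qscale nrm// mulr1; have := scale_lmul e (1 : A) (e *: (1 : A)).
  by rewrite mul1r scalerA ee scale1r.
Qed.

Lemma adapted_group U a g' t : adapted_chart sig g U a g' -> @group_G R t ->
  exists g'', adapted_chart sig g (t @^-1` U) (a \o t) g''.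
Proof.
move=> ad [b [->|->]].
  have -> : (fun a : A => a + b) = fun a => 1 *: a + b by rewrite funeqE => z; rewrite scale1r.
  by eexists; apply: adapted_affine ad; rewrite mulr1.
have -> : (fun a : A => - a + b) = fun a => (-1) *: a + b.
  by rewrite funeqE => z; rewrite scaleN1r.
by eexists; apply: adapted_affine ad; rewrite mulrNN mulr1.
Qed.

End GroupAction.

(** * Lifting circle-valued functions *)

Section Angles.
Variable R : realType.

Lemma uniformly_continuous_compact (V : normedModType R) (K : set V) (f : V -> R) (e : R) :
  compact K -> continuous f -> 0 < e ->
  exists2 d : R, 0 < d & forall x y, K x -> `|y - x| < d -> `|f y - f x| < e.
Proof.
move=> cK cf e0; have e20 : 0 < e / 2 by rewrite divr_gt0.
have /compact_near_coveringP cov := cK.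
have /near_normP[d d0 dP] : \forall d \near (0 : R), K `<=`
    [set x | forall y, `|y - x| < d -> `|f y - f x| < e].
  apply: (cov R (nbhs (0 : R)) (fun d x => forall y, `|y - x| < d -> `|f y - f x| < e)).
  move=> x Kx.
  have /cvgrPdist_lt/(_ _ e20)/near_normP[r r0 rP] := cf x.
  have r20 : 0 < r / 2 by rewrite divr_gt0.
  have n1 : \forall x' \near x, `|x' - x| < r / 2 by apply/near_normP; exists (r / 2).
  have n2 : \forall d \near (0 : R), `|d| < r / 2.
    by apply/near_normP; exists (r / 2) => // y; rewrite subr0.
  exists ([set x' | `|x' - x| < r / 2], [set d | `|d| < r / 2]); first by split.
  move=> [x' d] /= [x'x dr] y yx'.
  have yx : `|y - x| < r.
    apply: le_lt_trans (ler_distD x' y x) _; rewrite [r]splitr.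
    by apply: ltrD => //; apply: lt_trans yx' _; apply: le_lt_trans (ler_norm d) dr.
  have x'r : `|x' - x| < r by apply: lt_trans x'x _; rewrite ltr_pdivrMr// ltr_pMr// ltr1n.
  apply: le_lt_trans (ler_distD (f x) (f y) (f x')) _; rewrite [e]splitr.
  by apply: ltrD; [rewrite distrC; exact: rP|exact: rP].
exists (d / 2); first by rewrite divr_gt0.
move=> x y Kx yx; apply: (dP (d / 2) _ x Kx) => //.
by rewrite subr0 ger0_norm ?ltW ?divr_gt0// ltr_pdivrMr// ltr_pMr// ltr1n.
Qed.

Lemma exists_angle (c s : R) : c * c + s * s = 1 -> exists t : R, cos t = c /\ sin t = s.
Proof.
move=> cs; have c1 : -1 <= c <= 1.
  by rewrite -ler_norml -(@expr_le1 _ 2)// ?real_normK ?num_real// expr2; nra.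
have sE : Num.sqrt (1 - c ^+ 2) = `|s|.
  by rewrite -sqrtr_sqr; congr Num.sqrt; rewrite !expr2; lra.
have cE : cos (acos c) = c by apply: acosK; rewrite in_itv.
have [s0|s0] := leP 0 s.
  by exists (acos c); rewrite cE sin_acos// sE ger0_norm.
by exists (- acos c); rewrite cosN sinN cE sin_acos// sE ltr0_norm// opprK.
Qed.

Lemma cos_sin_atan (x y : R) : 0 < x -> x * x + y * y = 1 ->
  cos (atan (y / x)) = x /\ sin (atan (y / x)) = y.
Proof.
move=> x0 xy; have xn0 : x != 0 by rewrite gt_eqF.
have cE : cos (atan (y / x)) = x.
  rewrite cos_atan; have -> : 1 + (y / x) ^+ 2 = x^-1 ^+ 2.
    have -> : x^-1 ^+ 2 = (x * x + y * y) * x^-1 ^+ 2 by rewrite xy mul1r.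
    by field.
  by rewrite sqrtr_sqr ger0_norm ?invr_ge0 1?ltW// invrK.
split=> //; have [_] := atan_def (y / x); rewrite /tan cE => /(congr1 (fun t => t * x)).
by rewrite !divfK.
Qed.

(** The difference [d] of the two variations starts at 0 and has cosine 1. If d 1 were not 0, d
    would take the value m or -m with m = min(|d 1|, 1), which lies in (0, pi], where the cosine is
    not 1. *)
Lemma lift_variation_unique (w w' : R -> R) :
  (forall t, 0 <= t <= 1 -> {for t, continuous w}) ->
  (forall t, 0 <= t <= 1 -> {for t, continuous w'}) ->
  (forall t, 0 <= t <= 1 -> cos (w t) = cos (w' t)) ->
  (forall t, 0 <= t <= 1 -> sin (w t) = sin (w' t)) ->
  w 1 - w 0 = w' 1 - w' 0.
Proof.
move=> cw cw' cE sE; pose d t := (w t - w' t) - (w 0 - w' 0).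
have i0 : 0 <= (0 : R) <= 1 by rewrite lexx ler01.
have i1 : 0 <= (1 : R) <= 1 by rewrite lexx ler01.
have cosd t : 0 <= t <= 1 -> cos (d t) = 1.
  move=> ti; rewrite /d !cosB !sinB cE// sE// (cE 0)// (sE 0)//.
  have := cos2Dsin2 (w' t); have := cos2Dsin2 (w' 0); rewrite !expr2 => h1 h2.
  by rewrite h1 h2 ; ring.
suff d1 : d 1 = 0.
  by move/eqP: d1; rewrite /d subr_eq0 => /eqP; lra.
have cd : {within `[0, 1], continuous d}.
  apply: continuous_in_subspaceT => t; rewrite inE /= in_itv /= => ti.
  apply: cvgB; last exact: cvg_cst.
  by apply: cvgB; [exact: cw|exact: cw'].
have d0 : d 0 = 0 by rewrite /d subrr.
apply: contrapT => /eqP dn.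
pose m : R := Num.min `|d 1| 1.
have m0 : 0 < m by rewrite lt_min normr_gt0 dn ltr01.
have mpi : m <= pi.
  by apply: le_trans (pi_ge2 R); rewrite ge_min; apply/orP; right; rewrite ler1n.
have key v : `|v| = m -> (exists2 t, 0 <= t <= 1 & d t = v) -> False.
  move=> vm [t ti dt]; have mi : m \in `[0, pi] by rewrite in_itv/= (ltW m0) mpi.
  have zi : 0 \in `[0, pi : R] by rewrite in_itv/= lexx pi_ge0.
  have m00 : m = 0.
    by apply: (cos_inj mi zi); rewrite cos0 -vm cos_norm -dt; exact: cosd.
  by move: m0; rewrite m00 ltxx.
have [d1p|d1n] := leP 0 (d 1).
  apply: (key m); first by rewrite ger0_norm// ltW.
  have [|t] := @IVT _ d 0 1 m ler01 cd; last by rewrite in_itv /=; exists t.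
  rewrite d0 ge_min le_max; apply/andP; split; apply/orP; first by left; exact: ltW.
  by right; rewrite /m ge_min ger0_norm// lexx.
apply: (key (- m)); first by rewrite normrN ger0_norm// ltW.
have [|t] := @IVT _ d 0 1 (- m) ler01 cd; last by rewrite in_itv /=; exists t.
rewrite d0 ge_min le_max; apply/andP; split; apply/orP.
  by right; rewrite lerNr /m ge_min ltr0_norm// lexx.
by left; rewrite oppr_le0 ltW.
Qed.

End Angles.

(** * Lifting over segments and squares *)

Section LiftingHomotopies.
Variable R : realType.

(** The scalar product of unit vectors is 1 minus half the square of their distance, and here that
    square is less than 2. *)
Lemma unit_close (c s c' s' : R) : c * c + s * s = 1 -> c' * c' + s' * s' = 1 ->
  `|c' - c| < 1 -> `|s' - s| < 1 -> 0 < c * c' + s * s'.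
Proof.
move=> h h'; rewrite !ltr_norml => /andP[a1 a2] /andP[b1 b2].
have e1 : (c' - c) * (c' - c) < 1 by nra.
have e2 : (s' - s) * (s' - s) < 1 by nra.
nra.
Qed.

(** The increment is the angle of the rotation that carries (c, s) to (c', s'); its cosine is
    positive, so an arc tangent gives it. *)
Lemma angle_step (c s c' s' t : R) : c * c + s * s = 1 -> c' * c' + s' * s' = 1 ->
  0 < c * c' + s * s' -> cos t = c -> sin t = s ->
  cos (t + atan ((c * s' - s * c') / (c * c' + s * s'))) = c' /\
  sin (t + atan ((c * s' - s * c') / (c * c' + s * s'))) = s'.
Proof.
move=> h h' pos ct st.
have u : (c * c' + s * s') * (c * c' + s * s') + (c * s' - s * c') * (c * s' - s * c') = 1.
  have -> : (c * c' + s * s') * (c * c' + s * s') + (c * s' - s * c') * (c * s' - s * c') =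
    (c * c + s * s) * (c' * c' + s' * s') by ring.
  by rewrite h h' mulr1.
have [ca sa] := cos_sin_atan pos u; rewrite cosD sinD ca sa ct st; split.
  have -> : c * (c * c' + s * s') - s * (c * s' - s * c') = (c * c + s * s) * c' by ring.
  by rewrite h mul1r.
have -> : s * (c * c' + s * s') + c * (c * s' - s * c') = (c * c + s * s) * s' by ring.
by rewrite h mul1r.
Qed.

(* The angle at z is the sum of the increments of the angle along N equal steps
   of the segment from 0 to z, with N independent of z. *)
Lemma lift_star (V : normedModType R) (K : set V) (C S : V -> R) (t0 : R) :
  compact K -> (forall z, K z -> `|z| <= 1) ->
  (forall z t, K z -> 0 <= t <= 1 -> K (t *: z)) ->
  continuous C -> continuous S -> (forall z, C z * C z + S z * S z = 1) ->
  cos t0 = C 0 -> sin t0 = S 0 ->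
  exists L : V -> R, L 0 = t0 /\
    forall z, K z -> [/\ {for z, continuous L}, cos (L z) = C z & sin (L z) = S z].
Proof.
move=> cK K1 star cC cS CS c0 s0.
have [d1 d10 d1P] := uniformly_continuous_compact cK cC ltr01.
have [d2 d20 d2P] := uniformly_continuous_compact cK cS ltr01.
have d0 : 0 < Num.min d1 d2 by rewrite lt_min d10.
(* There are N + 1 steps, of length at most 1 / (N + 1), which is below the moduli of uniform
   continuity of [C] and [S] for the tolerance 1 that [unit_close] asks for. *)
have [N _ NP] := near_infty_natSinv_lt (PosNum d0).
have {NP} := NP N (leqnn N); rewrite /= lt_min => /andP[Nd1 Nd2].
have N0 : 0 < N.+1%:R :> R by rewrite ltr0n.
pose pt k (z : V) := (k%:R / N.+1%:R) *: z.
pose cc k z := C (pt k z) * C (pt k.+1 z) + S (pt k z) * S (pt k.+1 z).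
pose ss k z := C (pt k z) * S (pt k.+1 z) - S (pt k z) * C (pt k.+1 z).
pose L n z := t0 + \sum_(k < n) atan (ss k z / cc k z).
have Kpt k z : (k <= N.+1)%N -> K z -> K (pt k z).
  move=> kN Kz; apply: star => //; rewrite divr_ge0 ?ler0n//=.
  by rewrite ler_pdivrMr// mul1r ler_nat.
have ptS k z : K z -> `|pt k.+1 z - pt k z| <= N.+1%:R^-1.
  move=> Kz; rewrite /pt -scalerBl -mulrBl -natrB// subSnn mul1r normrZ.
  by rewrite ger0_norm ?invr_ge0 ?ler0n// ler_piMr ?invr_ge0 ?ler0n// K1.
have ccp k z : (k < N.+1)%N -> K z -> 0 < cc k z.
  move=> kN Kz; have Kk := Kpt k z (ltnW kN) Kz; have dk := ptS k z Kz.
  apply: unit_close => //; [apply: d1P Kk _|apply: d2P Kk _].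
    exact: le_lt_trans dk Nd1.
  exact: le_lt_trans dk Nd2.
have cpt k : continuous (pt k) by exact: scaler_continuous.
have cont n z : (n <= N.+1)%N -> K z -> {for z, continuous (L n)}.
  move=> nN Kz; suff h : {for z, continuous (fun z => \sum_(k < n) atan (ss k z / cc k z))}.
    by apply: cvgD; [exact: cvg_cst|exact: h].
  elim: n nN => [|n IH] nN.
    have -> : (fun z => \sum_(k < 0) atan (ss k z / cc k z)) = fun=> 0.
      by rewrite funeqE => y; rewrite big_ord0.
    exact: cst_continuous.
  have -> : (fun z => \sum_(k < n.+1) atan (ss k z / cc k z)) =
      fun z => (\sum_(k < n) atan (ss k z / cc k z)) + atan (ss n z / cc n z).
    by rewrite funeqE => y; rewrite big_ord_recr.
  have IHn := IH (ltnW nN); have cCk k : {for z, continuous (fun z => C (pt k z))}.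
    by apply: continuous_comp; [exact: cpt|exact: cC].
  have cSk k : {for z, continuous (fun z => S (pt k z))}.
    by apply: continuous_comp; [exact: cpt|exact: cS].
  have css : {for z, continuous (ss n)}.
    by apply: cvgB; apply: cvgM; [exact: cCk|exact: cSk|exact: cSk|exact: cCk].
  have ccc : {for z, continuous (cc n)}.
    by apply: cvgD; apply: cvgM; [exact: cCk|exact: cCk|exact: cSk|exact: cSk].
  have cq : {for z, continuous (fun z => ss n z / cc n z)}.
    by apply: continuousM css (continuousV _ ccc); rewrite gt_eqF// ccp.
  exact: continuousD IHn (continuous_comp cq (@continuous_atan _ _)).
have val n z : (n <= N.+1)%N -> K z -> cos (L n z) = C (pt n z) /\ sin (L n z) = S (pt n z).
  move=> nN Kz; elim: n nN => [|n IH] nN.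
    by rewrite /L big_ord0 addr0 /pt mul0r scale0r.
  have [cn sn] := IH (ltnW nN); rewrite /L big_ord_recr /= addrA.
  exact: (angle_step (CS _) (CS _) (ccp _ _ nN Kz) cn sn).
exists (L N.+1); split.
  rewrite /L big1 ?addr0// => k _; rewrite /ss /pt !scaler0 (mulrC (C 0)) subrr mul0r.
  exact: atan0.
move=> z Kz; have [cz sz] := val N.+1 z (leqnn _) Kz.
have ptz : pt N.+1 z = z by rewrite /pt divff ?gt_eqF// scale1r.
by split; [exact: cont|rewrite cz ptz|rewrite sz ptz].
Qed.

(** The retraction of the line onto [0, 1], in a form whose continuity is immediate. Composing with
    it replaces a path or homotopy continuous within [0, 1] by one continuous everywhere. *)
Definition clamp (t : R) : R := (`|t| - `|t - 1| + 1) / 2.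

Lemma clamp_id t : 0 <= t <= 1 -> clamp t = t.
Proof.
move=> /andP[t0 t1]; rewrite /clamp ger0_norm// ler0_norm ?subr_le0//; lra.
Qed.

Lemma clamp_in t : 0 <= clamp t <= 1.
Proof.
have [t0|t0] := leP 0 t; have [t1|t1] := leP t 1.
- by rewrite clamp_id// t0.
- by rewrite /clamp ger0_norm// gtr0_norm ?subr_gt0//; apply/andP; split; lra.
- by rewrite /clamp ltr0_norm// ler0_norm ?subr_le0//; apply/andP; split; lra.
- lra.
Qed.

Lemma clamp_continuous : continuous clamp.
Proof.
move=> t; apply: cvgM; last exact: cvg_cst.
apply: cvgD; last exact: cvg_cst.
apply: cvgB; apply: cvg_norm; first exact: cvg_id.
by apply: cvgB; [exact: cvg_id|exact: cvg_cst].
Qed.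

Lemma within_comp (X Y T : topologicalType) (K : set Y) (h : Y -> T) (q : X -> Y) :
  {within K, continuous h} -> continuous q -> (forall x, K (q x)) -> continuous (h \o q).
Proof.
move=> /subspace_continuousP ch cq qK x A hA.
have := ch (q x) (qK x) A hA; rewrite /within /= => near_q.
have nx : \forall y \near x, K (q y) -> A (h (q y)) by exact: cq near_q.
have : \forall y \near x, A (h (q y)) by apply: filterS nx => y; apply; exact: qK.
exact.
Qed.

Lemma continuous_paste (T : topologicalType) (f h : R -> T) (a : R) :
  continuous f -> continuous h -> f a = h a ->
  continuous (fun t => if t <= a then f t else h t).
Proof.
move=> cf ch fha t A; rewrite /=.
case: (ltgtP t a) => [ta|ta|->].
- move=> fA; have n1 : \forall s \near t, s < a.
    apply/near_normP; exists (a - t); first by rewrite subr_gt0.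
    by move=> s; rewrite ltr_norml; lra.
  by apply: filterS2 n1 (cf t A fA) => s sa fs; rewrite /= ltW.
- move=> hA; have n1 : \forall s \near t, a < s.
    apply/near_normP; exists (t - a); first by rewrite subr_gt0.
    by move=> s; rewrite ltr_norml; lra.
  by apply: filterS2 n1 (ch t A hA) => s sa hs; rewrite /= leNgt sa.
- move=> fA; have hA : nbhs (h a) A by rewrite -fha.
  have nf : \forall s \near a, A (f s) by exact: cf fA.
  have nh : \forall s \near a, A (h s) by exact: ch hA.
  have : \forall s \near a, A (if s <= a then f s else h s).
    by apply: filterS2 nf nh => s fs hs; case: ifP.
  exact.
Qed.

Lemma pair_continuous (X Y Z : topologicalType) (f : X -> Y) (h : X -> Z) :
  continuous f -> continuous h -> continuous (fun x => (f x, h x)).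
Proof. by move=> cf ch x; exact: cvg_pair (cf x) (ch x). Qed.

Lemma I01_compact : compact [set t : R | 0 <= t <= 1].
Proof.
have -> : [set t : R | 0 <= t <= 1] = `[0, 1]%classic; last exact: segment_compact.
by apply/seteqP; split=> t /=; rewrite in_itv.
Qed.

(** The homotopy is lifted over the whole square. Three of its sides go to the base point, so by
    [lift_variation_unique] the lift takes equal values at the ends of each of them; hence also at
    the ends of the fourth side, which carries the loop. *)
Lemma loop_lift (M : topologicalType) (C S : M -> R) (l : R -> M) (h : R * R -> M) :
  let I01 : set R := [set t | 0 <= t <= 1] in
  continuous C -> continuous S -> (forall x, C x * C x + S x * S x = 1) ->
  {within I01 `*` I01, continuous h} ->
  (forall t, I01 t -> h (0, t) = l t /\ h (1, t) = l 0) ->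
  (forall r, I01 r -> h (r, 0) = l 0 /\ h (r, 1) = l 0) ->
  exists w : R -> R, w 1 = w 0 /\ forall t, I01 t ->
    [/\ {for t, continuous w}, cos (w t) = C (l t) & sin (w t) = S (l t)].
Proof.
move=> I01 cC cS CS ch hl hr.
pose H (z : R * R) := h (clamp z.1, clamp z.2).
have cH : continuous H.
  apply: (within_comp (q := fun z : R * R => (clamp z.1, clamp z.2)) ch).
    apply: pair_continuous => z.
      exact: (continuous_comp (@fst_continuous R R R z) (@clamp_continuous _)).
    exact: (continuous_comp (@snd_continuous R R R z) (@clamp_continuous _)).
  by move=> z; split; exact: clamp_in.
have HE r t : I01 r -> I01 t -> H (r, t) = h (r, t).
  by move=> ri ti; rewrite /H /= !clamp_id.
have z0 : I01 0 by rewrite /I01 /= lexx ler01.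
have z1 : I01 1 by rewrite /I01 /= lexx ler01.
have [t0 [ct0 st0]] := exists_angle (CS (H 0)).
have cCH : continuous (C \o H) by move=> z; exact: (continuous_comp (cH z) (cC _)).
have cSH : continuous (S \o H) by move=> z; exact: (continuous_comp (cH z) (cS _)).
have Kc : compact (I01 `*` I01) by apply: compact_setX; exact: I01_compact.
have K1 (z : R * R) : (I01 `*` I01) z -> `|z| <= 1.
  move=> [/= /andP[a0 a1] /andP[b0 b1]]; rewrite prod_normE ge_max.
  by rewrite !ger0_norm// a1 b1.
have Ks (z : R * R) t : (I01 `*` I01) z -> 0 <= t <= 1 -> (I01 `*` I01) (t *: z).
  move=> [/= /andP[a0 a1] /andP[b0 b1]] /andP[t0' t1]; rewrite /I01 /GRing.scale/=.
  by split; apply/andP; split; rewrite ?mulr_ge0 ?mulr_ile1.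
have [L [_ LP]] := lift_star Kc K1 Ks cCH cSH (fun z => CS (H z)) ct0 st0.
have curve (c : R -> R * R) (k : R * R) : continuous c -> (forall t, I01 t -> (I01 `*` I01) (c t)) ->
    (forall t, I01 t -> h (c t) = l 0) -> L (c 1) = L (c 0).
  move=> cc cK hc.
  have E t : I01 t -> H (c t) = l 0.
    by move=> ti; have [a b] := cK t ti; rewrite -(hc t ti) (surjective_pairing (c t)) HE.
  have := @lift_variation_unique _ (fun t => L (c t)) (fun=> L (c 0)) _ _ _ _.
  rewrite subrr => U; apply/eqP; rewrite -subr_eq0; apply/eqP; apply: U.
  - by move=> t ti; have [cL _ _] := LP _ (cK t ti); exact: continuous_comp (cc t) cL.
  - by move=> t _; exact: cst_continuous.
  - move=> t ti; have [_ -> _] := LP _ (cK t ti); have [_ -> _] := LP _ (cK 0 z0).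
    by rewrite /= !E.
  - move=> t ti; have [_ _ ->] := LP _ (cK t ti); have [_ _ ->] := LP _ (cK 0 z0).
    by rewrite /= !E.
have pc1 (a : R) : continuous (fun t : R => (a, t)).
  by apply: pair_continuous => t; [exact: cvg_cst|exact: cvg_id].
have pc2 (a : R) : continuous (fun t : R => (t, a)).
  by apply: pair_continuous => t; [exact: cvg_id|exact: cvg_cst].
have e1 : L (1, 1) = L (1, 0).
  by apply: (curve (fun t => (1, t)) 0 (pc1 1)) => t ti; [split|have [] := hl t ti].
have e2 : L (1, 0) = L (0, 0).
  by apply: (curve (fun t => (t, 0)) 0 (pc2 0)) => t ti; [split|have [] := hr t ti].
have e3 : L (1, 1) = L (0, 1).
  by apply: (curve (fun t => (t, 1)) 0 (pc2 1)) => t ti; [split|have [] := hr t ti].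
exists (fun t => L (0, t)); split; first by rewrite -e3 e1 e2.
move=> t ti; have [cL cosL sinL] := LP (0, t) (conj z0 ti); split.
- exact: (continuous_comp (pc1 0 t) cL).
- by rewrite cosL /= HE//; have [-> _] := hl t ti.
- by rewrite sinL /= HE//; have [-> _] := hl t ti.
Qed.

End LiftingHomotopies.

(** * Lifting on a simply connected surface *)

Section GlobalLift.
Variables (R : realType) (M : surface R).

Lemma affine_continuous (a b : R) : continuous (fun t : R => a * t + b).
Proof.
by move=> t; apply: cvgD; [apply: cvgM; [exact: cvg_cst|exact: cvg_id]|exact: cvg_cst].
Qed.

(** The loop that runs through [f1], [f2] and then [f3] backwards has a lift of total variation 0 by
    [loop_lift]. Over each third its variation is that of the given lift, up to the sense of
    travel. *)
Lemma loop3_lift (C S : M -> R) (f1 f2 f3 : R -> M) (u1 u2 u3 : R -> R) :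
  simply_connected R M -> continuous C -> continuous S ->
  (forall x, C x * C x + S x * S x = 1) ->
  continuous f1 -> continuous f2 -> continuous f3 ->
  f1 1 = f2 0 -> f2 1 = f3 1 -> f1 0 = f3 0 ->
  (forall t, 0 <= t <= 1 -> [/\ {for t, continuous u1}, cos (u1 t) = C (f1 t) & sin (u1 t) = S (f1 t)]) ->
  (forall t, 0 <= t <= 1 -> [/\ {for t, continuous u2}, cos (u2 t) = C (f2 t) & sin (u2 t) = S (f2 t)]) ->
  (forall t, 0 <= t <= 1 -> [/\ {for t, continuous u3}, cos (u3 t) = C (f3 t) & sin (u3 t) = S (f3 t)]) ->
  (u1 1 - u1 0) + (u2 1 - u2 0) = u3 1 - u3 0.
Proof.
move=> [_ sc] cC cS CS c1 c2 c3 f12 f23 f13 u1P u2P u3P.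
pose l t := if t <= 3^-1 then f1 (3 * t + 0) else
  if t <= 2 / 3 then f2 (3 * t + -1) else f3 (- 3 * t + 3).
have three : 3 * 3^-1 = 1 :> R by rewrite mulfV.
have cl : continuous l.
  apply: continuous_paste.
  - by move=> t; exact: (continuous_comp (@affine_continuous 3 0 t) (c1 _)).
  - apply: continuous_paste.
    + by move=> t; exact: (continuous_comp (@affine_continuous 3 (-1) t) (c2 _)).
    + by move=> t; exact: (continuous_comp (@affine_continuous (-3) 3 t) (c3 _)).
    have -> : 3 * (2 / 3) + -1 = 1 :> R by lra.
    have -> : -3 * (2 / 3) + 3 = 1 :> R by lra.
    exact: f23.
  have -> : (3^-1 <= 2 / 3 :> R) by lra.
  have -> : 3 * 3^-1 + 0 = 1 :> R by lra.
  have -> : 3 * 3^-1 + -1 = 0 :> R by lra.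
  exact: f12.
have l1 t : 0 <= t <= 1 -> l (t / 3) = f1 t.
  move=> /andP[t0 t1]; rewrite /l ifT; last by lra.
  by congr f1; lra.
have l2 t : 0 <= t <= 1 -> l ((t + 1) / 3) = f2 t.
  move=> /andP[t0 t1]; rewrite /l; case: ifPn => [h|h].
    have t00 : t = 0 by lra.
    by rewrite t00 -f12; congr f1; lra.
  by rewrite ifT; [congr f2; lra|lra].
have l3 t : 0 <= t <= 1 -> l (1 - t / 3) = f3 t.
  move=> /andP[t0 t1]; rewrite /l ifF; last by apply/negbTE; rewrite -ltNge; lra.
  case: ifPn => [h|h]; last by congr f3; lra.
  have t11 : t = 1 by lra.
  by rewrite t11 -f23; congr f2; lra.
have z0 : 0 <= (0 : R) <= 1 by rewrite lexx ler01.
have z1 : 0 <= (1 : R) <= 1 by rewrite lexx ler01.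
have l0 : l 0 = f1 0 by rewrite -(l1 0 z0) mul0r.
have l11 : l 1 = f1 0 by rewrite f13 -(l3 0 z0) mul0r subr0.
have cl' : {within [set t | 0 <= t <= 1], continuous l} by exact: continuous_subspaceT.
have [|h [ch [hl hr]]] := sc l cl'; first by rewrite l0 l11.
have [w [w10 wP]] := loop_lift cC cS CS ch hl hr.
have aff (a b : R) t : 0 <= a * t + b <= 1 -> {for t, continuous (fun t => w (a * t + b))}.
  by move=> ti; have [cw _ _] := wP _ ti; exact: (continuous_comp (@affine_continuous a b t) cw).
have seg (a b : R) (f : R -> M) (u : R -> R) :
    (forall t, 0 <= t <= 1 -> 0 <= a * t + b <= 1) ->
    (forall t, 0 <= t <= 1 -> l (a * t + b) = f t) ->
    (forall t, 0 <= t <= 1 -> [/\ {for t, continuous u}, cos (u t) = C (f t) & sin (u t) = S (f t)]) ->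
    w (a + b) - w b = u 1 - u 0.
  move=> ab lf uP.
  have := @lift_variation_unique _ (fun t => w (a * t + b)) u _ _ _ _.
  rewrite mulr1 mulr0 add0r; apply => t ti; have [cu cosu sinu] := uP t ti.
  - exact: aff (ab t ti).
  - exact: cu.
  - by have [_ -> _] := wP _ (ab t ti); rewrite lf// cosu.
  - by have [_ _ ->] := wP _ (ab t ti); rewrite lf// sinu.
have s1 : w (3^-1 + 0) - w 0 = u1 1 - u1 0.
  apply: seg u1P => t ti; first by case/andP: ti => *; apply/andP; split; lra.
  by rewrite -(l1 t ti); congr l; lra.
have s2 : w (3^-1 + 3^-1) - w 3^-1 = u2 1 - u2 0.
  apply: seg u2P => t ti; first by case/andP: ti => *; apply/andP; split; lra.
  by rewrite -(l2 t ti); congr l; lra.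
have s3 : w (- 3^-1 + 1) - w 1 = u3 1 - u3 0.
  apply: seg u3P => t ti; first by case/andP: ti => *; apply/andP; split; lra.
  by rewrite -(l3 t ti); congr l; lra.
have e : - 3^-1 + 1 = 3^-1 + 3^-1 :> R by lra.
move: s1 s2 s3; rewrite e addr0 w10.
move: (w _) (w _) (w 0) (u1 1) (u1 0) (u2 1) (u2 0) (u3 1) (u3 0) => a b c d1 d2 d3 d4 d5 d6.
lra.
Qed.

(** The value at x is the end value of a lift along a path from a base point to x, and the paths are
    chosen without any continuity in x. Continuity at x0 comes from [loop3_lift], applied to the
    paths to x0 and to x and to the segment between them in a chart. *)
Lemma global_lift (C S : M -> R) : simply_connected R M -> continuous C -> continuous S ->
  (forall x, C x * C x + S x * S x = 1) ->
  exists chi : M -> R, continuous chi /\ forall x, cos (chi x) = C x /\ sin (chi x) = S x.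
Proof.
move=> sc cC cS CS.
have [[p0 _]|M0] := pselect (exists p : M, True); last first.
  by exists (fun=> 0); split=> x; case: M0; exists x.
have [t0 [ct0 st0]] := exists_angle (CS p0).
have z0 : 0 <= (0 : R) <= 1 by rewrite lexx ler01.
have z1 : 0 <= (1 : R) <= 1 by rewrite lexx ler01.
have path_lift x : exists fu : (R -> M) * (R -> R),
    [/\ continuous fu.1, fu.1 0 = p0, fu.1 1 = x, fu.2 0 = t0 &
      forall t, 0 <= t <= 1 ->
        [/\ {for t, continuous fu.2}, cos (fu.2 t) = C (fu.1 t) & sin (fu.2 t) = S (fu.1 t)]].
  have [f [cf [f0 f1]]] := sc.1 p0 x.
  have cfc : continuous (f \o @clamp R).
    exact: within_comp cf (@clamp_continuous R) (@clamp_in R).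
  have [|||||||L [L0 LP]] := @lift_star R R [set t | 0 <= t <= 1] (C \o (f \o @clamp R))
      (S \o (f \o @clamp R)) t0 (@I01_compact R).
  - by move=> z /andP[a b]; rewrite ger0_norm.
  - move=> z t /andP[a b] /andP[a' b']; rewrite /GRing.scale/=; apply/andP.
    by split; [exact: mulr_ge0|exact: mulr_ile1].
  - by move=> z; exact: (continuous_comp (cfc z) (cC _)).
  - by move=> z; exact: (continuous_comp (cfc z) (cS _)).
  - by move=> z; exact: CS.
  - by rewrite /= clamp_id// f0.
  - by rewrite /= clamp_id// f0.
  exists (f \o @clamp R, L); split=> //=; by rewrite clamp_id.
have [F FP] := choice path_lift.
pose chi x := (F x).2 1.
have chiP x : cos (chi x) = C x /\ sin (chi x) = S x.
  by have [_ _ f1 _ h] := FP x; have [_ cE sE] := h 1 z1; rewrite /chi cE sE f1.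
exists chi; split=> // x0; set c := schart x0.
pose cc x := C x0 * C x + S x0 * S x; pose ss x := C x0 * S x - S x0 * C x.
have ccc : continuous cc.
  by move=> x; apply: cvgD; apply: cvgM; [exact: cvg_cst|exact: cC|exact: cvg_cst|exact: cS].
have css : continuous ss.
  by move=> x; apply: cvgB; apply: cvgM; [exact: cvg_cst|exact: cS|exact: cvg_cst|exact: cC].
have cca x : 0 < cc x -> {for x, continuous (fun x => chi x0 + atan (ss x / cc x))}.
  move=> cx; apply: cvgD; first exact: cvg_cst.
  have cq : {for x, continuous (fun x => ss x / cc x)}.
    by apply: continuousM (css x) (continuousV _ (ccc x)); rewrite gt_eqF.
  exact: (continuous_comp cq (@continuous_atan _ _)).
have cc0 : 0 < cc x0 by rewrite /cc CS.
(* Points of the chart where (C, S) makes an acute angle with its value at x0; along segments in a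
   ball inside [E] the arc tangent provides the lift. *)
pose E : set (R * R) := (cmap c @` cdom c) `&` [set z | 0 < cc (cinv c z)].
have oE : open E.
  rewrite /E; have -> : [set z | 0 < cc (cinv c z)] = (cc \o cinv c) @^-1` [set r | 0 < r] by [].
  have oc : open (cmap c @` cdom c) := @cimg_open R M c.
  have op : open [set r : R | 0 < r] by exact: open_gt.
  apply: (open_setI_preimage oc op) => z cz.
  exact: (continuous_comp (@cinv_cont R M c z cz) (ccc _)).
have Ez : E (cmap c x0) by split; [exact: schart_img|rewrite /= schart_cinv].
have /near_normP[r r0 rP] : \forall z \near cmap c x0, E z by exact: (open_near oE Ez).
have nx : \forall x \near x0, cdom c x /\ `|cmap c x - cmap c x0| < r.
  have n1 : \forall x \near x0, cdom c x.
    exact: (open_near (@cdom_open R M c) (schart_dom x0)).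
  have n2 : \forall z \near cmap c x0, `|z - cmap c x0| < r by apply/near_normP; exists r.
  have n3 : \forall x \near x0, `|cmap c x - cmap c x0| < r.
    exact: (@cmap_cont R M c x0 (schart_dom x0) _ n2).
  exact: filterI n1 n3.
have chiE x : cdom c x -> `|cmap c x - cmap c x0| < r -> chi x0 + atan (ss x / cc x) = chi x.
  move=> cx xr; pose g t := cmap c x0 + clamp t *: (cmap c x - cmap c x0).
  have gE t : E (g t).
    apply: rP; rewrite /g addrC addKr normrZ; apply: le_lt_trans xr.
    have /andP[a b] := clamp_in t; rewrite ger0_norm//.
    by rewrite -[leRHS]mul1r ler_wpM2r.
  have cg : continuous g.
    move=> t; apply: cvgD; first exact: cvg_cst.
    by apply: cvgZ; [exact: clamp_continuous|exact: cvg_cst].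
  have cs : continuous (cinv c \o g).
    by move=> t; exact: (continuous_comp (cg t) (@cinv_cont R M c _ (gE t).1)).
  have g0 : cinv c (g 0) = x0 by rewrite /g clamp_id// scale0r addr0 schart_cinv.
  have g1 : cinv c (g 1) = x by rewrite /g clamp_id// scale1r addrC subrK cmapK.
  have [cf1 f10 f11 u10 u1P] := FP x0; have [cf3 f30 f31 u30 u3P] := FP x.
  have [cchi schi] := chiP x0.
  have u2P t : 0 <= t <= 1 ->
      [/\ {for t, continuous (fun t => chi x0 + atan (ss (cinv c (g t)) / cc (cinv c (g t))))},
        cos (chi x0 + atan (ss (cinv c (g t)) / cc (cinv c (g t)))) = C ((cinv c \o g) t) &
        sin (chi x0 + atan (ss (cinv c (g t)) / cc (cinv c (g t)))) = S ((cinv c \o g) t)].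
    move=> _; have pos : 0 < cc (cinv c (g t)) by have [] := gE t.
    have [a b] := angle_step (CS x0) (CS _) pos cchi schi; split=> //.
    exact: (continuous_comp (cs t) (cca _ pos)).
  have := loop3_lift sc cC cS CS cf1 cs cf3 _ _ _ u1P u2P u3P.
  rewrite /= g0 g1 f11 f31 f10 f30 u10 u30 => /(_ erefl erefl erefl).
  have -> : ss x0 = 0 by rewrite /ss mulrC subrr.
  rewrite mul0r atan0 addr0 -/(chi x0) -/(chi x).
  move: (atan _) (chi x0) (chi x) => a1 a2 a3; lra.
have nchi : \forall x \near x0, chi x0 + atan (ss x / cc x) = chi x.
  by apply: filterS nx => x [cx xr]; exact: chiE.
have c0 := cca x0 cc0.
rewrite /prop_for /continuous_at -(nbhs_singleton nchi).
by apply: cvg_trans c0; apply: near_eq_cvg; apply: filterS nchi.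
Qed.

End GlobalLift.

(** * The angle function psi *)

Section LorentzTrigonometry.
Variable R : realType.
Local Notation A := (lorentz R).
Implicit Types (z : A) (e : R).

(** The inverse of the isomorphism from A to R x R with components [pe 1] and [pe (-1)]. *)
Definition of_pe (c d : R) : A := mkL ((c + d) / 2) ((c - d) / 2).

Lemma pe_of_pe1 c d : pe 1 (of_pe c d) = c.
Proof. by rewrite /pe /=; lra. Qed.
Lemma pe_of_peN1 c d : pe (-1) (of_pe c d) = d.
Proof. by rewrite /pe /=; lra. Qed.
Lemma of_peK z : of_pe (pe 1 z) (pe (-1) z) = z.
Proof. by apply: pe_ext; rewrite ?pe_of_pe1 ?pe_of_peN1. Qed.

Lemma lorentz_lim (u : nat -> A) (c d : R) :
  (fun n => pe 1 (u n)) @ \oo --> c -> (fun n => pe (-1) (u n)) @ \oo --> d ->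
  limn u = of_pe c d.
Proof.
move=> uc ud; apply: (@cvg_lim _ (@norm_hausdorff _ A)).
have -> : u = (fun n => of_pe (pe 1 (u n)) (pe (-1) (u n))).
  by apply/funext => n; rewrite of_peK.
apply: (@cvg_pair _ _ _ _ (nbhs ((c + d) / 2)) (nbhs ((c - d) / 2))).
  by apply: cvgM; [exact: cvgD|exact: cvg_cst].
by apply: cvgM; [exact: cvgB|exact: cvg_cst].
Qed.

Lemma pe_expr e z n : e * e = 1 -> pe e (z ^+ n) = pe e z ^+ n.
Proof. by move=> ee; elim: n => [|n IH]; rewrite ?pe1// !exprS peM// IH. Qed.

Lemma pe_partial_cos e z n : e * e = 1 ->
  pe e (\sum_(0 <= k < n) ((-1) ^+ k / ((2 * k)`!)%:R : R) *: z ^+ (2 * k)) =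
  series (cos_coeff' (pe e z)) n.
Proof.
move=> ee; rewrite linear_sum /series /=; apply: eq_bigr => k _.
rewrite linearZ /= pe_expr// /cos_coeff' -mul2n.
by rewrite mulrAC.
Qed.

Lemma pe_partial_sin e z n : e * e = 1 ->
  pe e (\sum_(0 <= k < n) ((-1) ^+ k / ((2 * k).+1`!)%:R : R) *: z ^+ (2 * k).+1) =
  series (sin_coeff' (pe e z)) n.
Proof.
move=> ee; rewrite linear_sum /series /=; apply: eq_bigr => k _.
rewrite linearZ /= pe_expr// /sin_coeff' -mul2n.
by rewrite mulrAC.
Qed.

(** The power series has real coefficients and [pe e] is a ring homomorphism, so it sends the
    partial sums to those of the real cosine. *)
Lemma lcosE z : lcos z = of_pe (cos (pe 1 z)) (cos (pe (-1) z)).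
Proof.
apply: lorentz_lim.
  rewrite (_ : (fun n => _) = series (cos_coeff' (pe 1 z))); first exact: cvg_cos_coeff'.
  by apply/funext => n; exact: pe_partial_cos (mulr1 _).
rewrite (_ : (fun n => _) = series (cos_coeff' (pe (-1) z))); first exact: cvg_cos_coeff'.
by apply/funext => n; apply: pe_partial_cos; rewrite mulrNN mulr1.
Qed.

Lemma lsinE z : lsin z = of_pe (sin (pe 1 z)) (sin (pe (-1) z)).
Proof.
apply: lorentz_lim.
  rewrite (_ : (fun n => _) = series (sin_coeff' (pe 1 z))); first exact: cvg_sin_coeff'.
  by apply/funext => n; exact: pe_partial_sin (mulr1 _).
rewrite (_ : (fun n => _) = series (sin_coeff' (pe (-1) z))); first exact: cvg_sin_coeff'.
by apply/funext => n; apply: pe_partial_sin; rewrite mulrNN mulr1.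
Qed.

End LorentzTrigonometry.

(** * Smoothness of continuous angles, and the halving of an angle *)

Section AngleFunction.
Variable R : realType.
Implicit Types V : normedModType R.

Lemma sin_sub_atan (t t0 : R) : -(pi / 2) < t - t0 < pi / 2 ->
  t = t0 + atan ((sin t * cos t0 - cos t * sin t0) / (cos t * cos t0 + sin t * sin t0)).
Proof.
move=> b; rewrite -cosB -sinB -/(tan (t - t0)) tanK ?in_itv//.
by rewrite addrCA subrr addr0.
Qed.

(** Near z0, psi is psi z0 plus the arc tangent of s / c, where s and c are the sine and cosine of
    psi - psi z0; continuity keeps this difference within (-pi/2, pi/2). At z0 one has s = 0 and c =
    1, so the differential is that of s. *)
Lemma diff_angle V (psi P Q : V -> R) (z0 : V) : {for z0, continuous psi} ->
  (\forall z \near z0, cos (psi z) = P z /\ sin (psi z) = Q z) ->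
  differentiable P z0 -> differentiable Q z0 ->
  differentiable psi z0 /\ forall v, 'd psi z0 v = P z0 * 'd Q z0 v - Q z0 * 'd P z0 v.
Proof.
move=> cpsi PQ dP dQ; have [P0 Q0] := nbhs_singleton PQ.
pose s z := P z0 * Q z + - Q z0 * P z; pose c z := P z0 * P z + Q z0 * Q z.
have one : P z0 * P z0 + Q z0 * Q z0 = 1 by rewrite -P0 -Q0 -!expr2 cos2Dsin2.
have s0 : s z0 = 0 by rewrite /s mulNr mulrC subrr.
have c0 : c z0 = 1 := one.
have near_psi : \forall z \near z0, psi z0 + atan (s z / c z) = psi z.
  have pi2 : 0 < (pi / 2 : R) by rewrite divr_gt0 ?pi_gt0.
  have n1 : \forall z \near z0, `|psi z - psi z0| < pi / 2.
    have n2 : \forall t \near psi z0, `|t - psi z0| < pi / 2 by apply/near_normP; exists (pi / 2).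
    exact: cpsi _ n2.
  apply: filterS2 n1 PQ => z zb [cz sz].
  rewrite [RHS](@sin_sub_atan _ (psi z0)) -?ltr_norml// ?cz ?sz ?P0 ?Q0.
  by congr (_ + atan (_ / _)); rewrite /s /c; ring.
have dscale (r : R) (f : V -> R) : differentiable f z0 ->
    differentiable (fun z => r * f z) z0 /\ forall v, 'd (fun z => r * f z) z0 v = r * 'd f z0 v.
  move=> df; have [d E] := is_diff_scale (k := fun=> r) (differentiable_cst _ _) df.
  split=> [|v]; first exact: d.
  apply: (etrans (congr1 (fun L : V -> R => L v) E)).
  apply: (etrans (congr1 (fun L : V -> R => r *: 'd f z0 v + L v *: f z0) (diff_cst _ _))).
  by rewrite scale0r addr0; reflexivity.
have dadd (f h : V -> R) : differentiable f z0 -> differentiable h z0 ->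
    differentiable (fun z => f z + h z) z0 /\
    forall v, 'd (fun z => f z + h z) z0 v = 'd f z0 v + 'd h z0 v.
  move=> df dh; split; first exact: differentiableD.
  by move=> v; exact (congr1 (fun L : V -> R => L v) (diffD df dh)).
have [d1 E1] := dscale (P z0) Q dQ; have [d2 E2] := dscale (- Q z0) P dP.
have [d3 E3] := dscale (P z0) P dP; have [d4 E4] := dscale (Q z0) Q dQ.
have [ds Es] := dadd _ _ d1 d2; have [dc Ec] := dadd _ _ d3 d4.
have dci : differentiable (fun z => (c z)^-1) z0.
  by apply: (differentiableV dc); rewrite -/(c z0) c0 oner_neq0.
have [dq Eq] := is_diff_scale ds dci.
have Eqv v : 'd (fun z => s z / c z) z0 v = 'd s z0 v.
  apply: (etrans (congr1 (fun L : V -> R => L v) Eq)).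
  rewrite -/(s z0) -/(c z0) s0 c0 invr1 scale0r add0r.
  exact: mulr1.
have da : is_derive (s z0 / c z0) 1 (@atan R) 1.
  have := is_derive1_atan (s z0 / c z0); rewrite s0 mul0r expr0n addr0 invr1.
  exact.
have dat := differentiable_real_comp dq da.
have Eat v := diff_real_comp v dq da.
have dt : differentiable (fun z => psi z0 + atan (s z / c z)) z0.
  by apply: differentiableD => //; exact: dat.
split; first exact: near_eq_differentiable near_psi dt.
move=> v; apply: (etrans (congr1 (fun L : V -> R => L v) (near_eq_diff near_psi dt))).
have Ed := diffD (differentiable_cst (psi z0) z0) dat.
apply: (etrans (congr1 (fun L : V -> R => L v) Ed)).
apply: (etrans (congr1 (fun L : V -> R => L v + _) (diff_cst _ _))).
rewrite add0r; apply: (etrans (Eat v)); rewrite mul1r.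
apply: (etrans (Eqv v)); apply: (etrans (Es v)).
by apply: (etrans (congr2 +%R (E1 v) (E2 v))); rewrite mulNr; reflexivity.
Qed.

(** The right side of dpsi = P dQ - Q dP does not contain psi, so a merely continuous angle of a
    smooth direction is smooth. *)
Lemma Ck_angle V k (U : set V) (psi P Q : V -> R) : open U ->
  (forall z, U z -> {for z, continuous psi}) ->
  (forall z, U z -> cos (psi z) = P z /\ sin (psi z) = Q z) ->
  smooth_on U P -> smooth_on U Q -> Ck k U psi.
Proof.
move=> oU cpsi PQ SP SQ.
have D z : U z -> differentiable psi z /\
    forall v, 'd psi z v = P z * 'd Q z v - Q z * 'd P z v.
  move=> Uz; have dP := smooth_differentiable SP Uz; have dQ := smooth_differentiable SQ Uz.
  have n : \forall z' \near z, cos (psi z') = P z' /\ sin (psi z') = Q z'.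
    by apply: filterS (open_near oU Uz) => z' Uz'; exact: PQ.
  exact (diff_angle (cpsi z Uz) n dP dQ).
elim: k => [|k IH]; first exact: cpsi.
split=> [z Uz|v]; first by have [] := D z Uz.
have CP := SP k; have CQ := SQ k; have [_ /(_ v) DP] := SP k.+1; have [_ /(_ v) DQ] := SQ k.+1.
apply: (Ck_ext oU _ (CkD oU (CkM oU CP DQ) (CkN oU (CkM oU CQ DP)))) => z Uz.
have [d E] := D z Uz; have dP := smooth_differentiable SP Uz; have dQ := smooth_differentiable SQ Uz.
refine (etrans _ (esym (etrans (deriveE v d) (E v)))).
by rewrite (deriveE v dP) (deriveE v dQ); reflexivity.
Qed.

Lemma diff_const_line V (W : normedModType R) (f : V -> W) (z v : V) : differentiable f z ->
  (\forall t \near (0 : R), f (z + t *: v) = f z) -> 'd f z v = 0.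
Proof.
move=> df n; have df0 : differentiable f (z + 0 *: v) by rewrite scale0r addr0.
have [_ e] := is_derive_line df0.
have n' : \forall t \near (0 : R), f z = f (z + t *: v) by apply: filterS n => t ->.
have E := near_eq_diff n' (differentiable_cst (f z) (0 : R)).
have dl : differentiable (fun t : R => f (z + t *: v)) 0.
  exact: near_eq_differentiable n' (differentiable_cst (f z) (0 : R)).
have e0 : 'd f (z + 0 *: v) v = 0.
  rewrite -e (deriveE (1 : R) dl); apply: (etrans (congr1 (fun L : R -> W => L 1) E)).
  exact (congr1 (fun L : R -> W => L 1) (diff_cst _ _)).
by move: e0; rewrite scale0r addr0.
Qed.

(** Equal double angles mean (P, Q) = (c, s) or (P, Q) = -(c, s); the sign is the scalar product of
    these unit vectors. *)
Lemma half_angle_sign (P Q c s : R) : P * P + Q * Q = 1 -> c * c + s * s = 1 ->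
  c * c - s * s = P * P - Q * Q -> s * c + c * s = 2 * (P * Q) ->
  let e := P * c + Q * s in [/\ e * c = P, e * s = Q & e * e = 1].
Proof.
move=> PQ one cc cs /=.
have c2 : c * c = P * P by lra.
have s2 : s * s = Q * Q by lra.
have scE : s * c = P * Q by lra.
set e := _ + Q * s.
have ec : e * c = P.
  have -> : e * c = P * (c * c) + Q * (s * c) by rewrite /e; ring.
  by rewrite c2 scE -[RHS]mulr1 -PQ; ring.
have es : e * s = Q.
  have -> : e * s = P * (s * c) + Q * (s * s) by rewrite /e; ring.
  by rewrite s2 scE -[RHS]mulr1 -PQ; ring.
have ee : e * e = 1.
  have -> : e * e = P * (e * c) + Q * (e * s) by rewrite /e; ring.
  by rewrite ec es.
by [].
Qed.

(* The sign e relates the half of the lifted double angle to the angle of (P, Q);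
   it is a continuous expression, so that no choice of branch is needed. *)
Lemma half_angle (P Q t : R) : P * P + Q * Q = 1 ->
  cos t = P * P - Q * Q -> sin t = 2 * (P * Q) ->
  let e := P * cos (t / 2) + Q * sin (t / 2) in
  cos (t / 2 + pi / 2 * (1 - e)) = P /\ sin (t / 2 + pi / 2 * (1 - e)) = Q.
Proof.
move=> PQ ct st.
have t2 : t / 2 + t / 2 = t by lra.
have cc : cos (t / 2) * cos (t / 2) - sin (t / 2) * sin (t / 2) = P * P - Q * Q.
  by rewrite -cosD t2.
have cs : sin (t / 2) * cos (t / 2) + cos (t / 2) * sin (t / 2) = 2 * (P * Q).
  by rewrite -sinD t2.
have one : cos (t / 2) * cos (t / 2) + sin (t / 2) * sin (t / 2) = 1.
  by rewrite -!expr2 cos2Dsin2.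
have [ec es ee] := half_angle_sign PQ one cc cs.
move: (_ + Q * _) ec es ee => e ec es ee /=.
(* The added angle pi / 2 * (1 - e) is 0 for e = 1 and pi for e = -1. *)
have : (e - 1) * (e + 1) == 0 by apply/eqP; rewrite mulrBl mulrDr ee; ring.
rewrite mulf_eq0 => /orP[/eqP e1|/eqP e1].
  have {}e1 : e = 1 by lra.
  by move: ec es; rewrite e1 subrr mulr0 addr0 !mul1r.
have {}e1 : e = - 1 by lra.
move: ec es; rewrite e1 opprK !mulN1r.
have -> : pi / 2 * (1 + 1) = pi :> R by lra.
by rewrite cosDpi sinDpi.
Qed.

End AngleFunction.

Section QuatBar.
Variable R : realType.
Local Notation A := (lorentz R).
Implicit Types (x y q : lquat R) (e : R) (w : A).

Lemma qform_mulbar x y : qform (x * qbar y) (x * qbar y) = qform x x * qform y y.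
Proof. by rewrite qmulE /qform /qmul /qbar /mkQ /qc0 /qc1 /qc2 /qc3 /=; ring. Qed.

Lemma qinv_bar q : qform q q = 1 -> q^-1 = qbar q.
Proof.
by move=> q1; rewrite /GRing.inv /= /qinv /qunit q1 unitr1 invr1 qscale1.
Qed.

(** Written out in real components so that the coefficients of g' g^-1 inherit smoothness and
    constancy along null lines from g and g'. *)
Lemma pe_qc2_mulbar e x y : e * e = 1 -> pe e (qc2 (x * qbar y)) =
  pe e (qc2 x) * pe e (qc0 y) + pe e (qc1 x) * pe e (qc3 y)
  - pe e (qc0 x) * pe e (qc2 y) - pe e (qc3 x) * pe e (qc1 y).
Proof.
move=> ee; have -> : qc2 (x * qbar y) =
    qc2 x * qc0 y + qc1 x * qc3 y - qc0 x * qc2 y - qc3 x * qc1 y.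
  by rewrite qmulE /qmul /qbar /mkQ /qc0 /qc1 /qc2 /qc3 /=; ring.
by rewrite !linearB linearD /= !peM.
Qed.

Lemma pe_qc3_mulbar e x y : e * e = 1 -> pe e (qc3 (x * qbar y)) =
  pe e (qc3 x) * pe e (qc0 y) + pe e (qc2 x) * pe e (qc1 y)
  - pe e (qc1 x) * pe e (qc2 y) - pe e (qc0 x) * pe e (qc3 y).
Proof.
move=> ee; have -> : qc3 (x * qbar y) =
    qc3 x * qc0 y + qc2 x * qc1 y - qc1 x * qc2 y - qc0 x * qc3 y.
  by rewrite qmulE /qmul /qbar /mkQ /qc0 /qc1 /qc2 /qc3 /=; ring.
by rewrite !linearB linearD /= !peM.
Qed.

End QuatBar.

(** * The angle function of an adapted chart *)

Section AngleOfChart.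
Variables (R : realType) (M : surface R) (g : M -> lquat R).
Variable sig : M -> R * R -> (R * R)%type.
Local Notation A := (lorentz R).
Hypothesis Sg : msmooth setT g.
Hypothesis g_unit : forall x, qform (g x) (g x) = 1.
Hypothesis g_JK : forall x u, qc0 (mdiff g x u * qbar (g x)) = 0 /\
                              qc1 (mdiff g x u * qbar (g x)) = 0.

Section Chart.
Variables (U : set A) (a : A -> M) (g' : A -> lquat R).
Hypothesis ad : adapted_chart sig g U a g'.

(** [jcoef] and [kcoef] are the null projections of the coefficients of J and K in g' g^-1, [qbar]
    being the inverse on unit quaternions. *)
Definition jcoef (e : R) z : R := pe e (qc2 (g' z * qbar (g (a z)))).
Definition kcoef (e : R) z : R := pe e (qc3 (g' z * qbar (g (a z)))).

Lemma jcoefE e z : e * e = 1 -> jcoef e z =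
  pe e (qc2 (g' z)) * pe e (qc0 (g (a z))) + pe e (qc1 (g' z)) * pe e (qc3 (g (a z)))
  - pe e (qc0 (g' z)) * pe e (qc2 (g (a z))) - pe e (qc3 (g' z)) * pe e (qc1 (g (a z))).
Proof. exact: pe_qc2_mulbar. Qed.

Lemma kcoefE e z : e * e = 1 -> kcoef e z =
  pe e (qc3 (g' z)) * pe e (qc0 (g (a z))) + pe e (qc2 (g' z)) * pe e (qc1 (g (a z)))
  - pe e (qc1 (g' z)) * pe e (qc2 (g (a z))) - pe e (qc0 (g' z)) * pe e (qc3 (g (a z))).
Proof. exact: pe_qc3_mulbar. Qed.

Lemma adapted_open : open U. Proof. by have [[]] := ad. Qed.

Lemma adapted_quot z : U z ->
  [/\ qc0 (g' z * qbar (g (a z))) = 0, qc1 (g' z * qbar (g (a z))) = 0 &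
    forall e, e * e = 1 -> jcoef e z * jcoef e z + kcoef e z * kcoef e z = 1].
Proof.
move=> Uz; have [h0 h1] := g_JK (a z) (chart_diff a z (1 : A)).
have E := adapted_deriv Sg ad Uz; rewrite -E in h0 h1; split=> // e ee.
have [_ [_ [_ /(_ z Uz) n]]] := ad.
have := qform_mulbar (g' z) (g (a z)).
rewrite n g_unit mulr1 {1}/qform h0 h1 mul0r add0r add0r => /(congr1 (pe e)).
by rewrite linearD /= !peM// pe1.
Qed.

Lemma chart_g_smooth : smooth_on U (g \o a).
Proof.
have [b ch] := lorentz_chart_smooth ad.1.
move=> k; have := smooth_along_chart ch openT Sg k.
by apply: Ck_sub => z Uz; split.
Qed.

Lemma adapted_derive z : U z -> 'D_(1 : A) (g \o a) z = g' z.
Proof.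
move=> Uz; have [_ [_ [/(_ z Uz)[d E] _]]] := ad.
by rewrite (deriveE _ d) E qscale1.
Qed.

Lemma chart_pq_smooth e i : smooth_on U (fun z => pq e i (g (a z))) /\
  smooth_on U (fun z => pq e i (g' z)).
Proof.
have oU := adapted_open; split=> k.
  exact: (Ck_linear_comp oU (@pq_continuous R e i) (chart_g_smooth k)).
have [_ /(_ (1 : A)) C] := chart_g_smooth k.+1.
apply: (Ck_linear_comp oU (@pq_continuous R e i)).
exact: (Ck_ext oU adapted_derive C).
Qed.

Lemma jkcoef_smooth e : e * e = 1 -> smooth_on U (jcoef e) /\ smooth_on U (kcoef e).
Proof.
move=> ee; have oU := adapted_open.
have X i k := (chart_pq_smooth e i).2 k; have Y i k := (chart_pq_smooth e i).1 k.
pose i0 : 'I_4 := @Ordinal 4 0 isT; pose i1 : 'I_4 := @Ordinal 4 1 isT.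
pose i2 : 'I_4 := @Ordinal 4 2 isT; pose i3 : 'I_4 := @Ordinal 4 3 isT.
have T k i j : Ck k U (fun z => pq e i (g' z) * pq e j (g (a z))) := CkM oU (X i k) (Y j k).
split=> k.
  apply: (Ck_ext oU _ (CkD oU (CkD oU (CkD oU (T k i2 i0) (T k i1 i3))
    (CkN oU (T k i0 i2))) (CkN oU (T k i3 i1)))) => z _.
  exact: esym (jcoefE z ee).
apply: (Ck_ext oU _ (CkD oU (CkD oU (CkD oU (T k i3 i0) (T k i2 i1))
  (CkN oU (T k i1 i2))) (CkN oU (T k i0 i3)))) => z _.
exact: esym (kcoefE z ee).
Qed.

(* Conformality of g makes the component pq e i of g \o a locally constant in the
   direction c, hence so is its derivative, and this is the component of g'. *)
Lemma chart_pq_translate e i z (c : A) : e * e = 1 -> U z -> pe e c = 0 ->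
  \forall t \near (0 : R), pq e i (g (a (z + t *: c))) = pq e i (g (a z)) /\
    pq e i (g' (z + t *: c)) = pq e i (g' z).
Proof.
move=> ee Uz ec; pose k w := pq e i (g (a w)).
have /near_normP[r r0 rU] : \forall w \near z, U w := open_near adapted_open Uz.
have dk w : U w -> differentiable k w /\ forall v, 'd k w v = pe e v * pq e i (g' w).
  move=> Uw; have [_ [_ [/(_ w Uw)[d E] _]]] := ad.
  have [d1 E1] := diff_linear_comp (@pq_continuous R e i) d; split; first exact: d1.
  by move=> v; exact: (etrans (E1 v) (etrans (congr1 (pq e i) (E v)) (pq_qscale i v (g' w) ee))).
have Dk w : U w -> 'D_(1 : A) k w = pq e i (g' w).
  by move=> Uw; have [d E] := dk w Uw; rewrite (deriveE _ d) E pe1 mul1r.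
have zz : `|z - z| < r by rewrite subrr normr0.
have near_t : \forall t \near (0 : R), `|z + t *: c - z| < r.
  have [d _] := line_diff z c 0.
  have cl : {for (0 : R), continuous (fun s : R => z + s *: c)} := differentiable_continuous d.
  have n : \forall w \near z + (0 : R) *: c, `|w - z| < r.
    by rewrite scale0r addr0; apply/near_normP; exists r.
  exact: cl _ n.
apply: filterS near_t => t tr.
have K w : `|w - z| < r -> differentiable k w /\ 'd k w (t *: c) = 0.
  move=> wr; have [d E] := dk w (rU w wr); split=> //.
  have tc : pe e (t *: c) = 0 by rewrite linearZ /= ec scaler0.
  by rewrite E tc mul0r.
split; first exact: (eq_translate K zz tr).
have := derive_eq_translate K (1 : A) zz tr.
by rewrite (Dk _ (rU _ tr)) (Dk _ Uz).
Qed.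

Lemma jkcoef_diff e z (c : A) : e * e = 1 -> U z -> pe e c = 0 ->
  'd (jcoef e) z c = 0 /\ 'd (kcoef e) z c = 0.
Proof.
move=> ee Uz ec; have T i := chart_pq_translate i ee Uz ec.
have [Sj Sk] := jkcoef_smooth ee.
pose i0 : 'I_4 := @Ordinal 4 0 isT; pose i1 : 'I_4 := @Ordinal 4 1 isT.
pose i2 : 'I_4 := @Ordinal 4 2 isT; pose i3 : 'I_4 := @Ordinal 4 3 isT.
have T' : \forall t \near (0 : R), jcoef e (z + t *: c) = jcoef e z /\
    kcoef e (z + t *: c) = kcoef e z.
  apply: filterS (filterI (filterI (T i0) (T i1)) (filterI (T i2) (T i3))) => t [[[Y0 X0] [Y1 X1]] [[Y2 X2] [Y3 X3]]].
  rewrite (jcoefE (z + t *: c) ee) (jcoefE z ee) (kcoefE (z + t *: c) ee) (kcoefE z ee).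
  rewrite /pq /qcomp /= in X0 Y0 X1 Y1 X2 Y2 X3 Y3.
  by rewrite X0 Y0 X1 Y1 X2 Y2 X3 Y3.
have nj : \forall t \near (0 : R), jcoef e (z + t *: c) = jcoef e z.
  by apply: filterS T' => t [].
have nk : \forall t \near (0 : R), kcoef e (z + t *: c) = kcoef e z.
  by apply: filterS T' => t [].
split; [exact: (diff_const_line (smooth_differentiable Sj Uz) nj)|].
exact: (diff_const_line (smooth_differentiable Sk Uz) nk).
Qed.

(** The vector sigma w - e w is in the kernel of [pe e], hence a direction in which the two
    coefficients do not vary. *)
Lemma jkcoef_conformal e z (w : A) : e * e = 1 -> U z ->
  'd (jcoef e) z (lsigma * w) = e * 'd (jcoef e) z w /\
  'd (kcoef e) z (lsigma * w) = e * 'd (kcoef e) z w.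
Proof.
move=> ee Uz; have ec : pe e (lsigma * w + (- e) *: w) = 0.
  by rewrite linearD linearZ /= peM// pe_sigma scaleNr; exact: subrr.
have lin (L : {linear A -> R}) : L (lsigma * w + (- e) *: w) = 0 ->
    L (lsigma * w) = e * L w.
  by rewrite linearD linearZ /= scaleNr => /eqP; rewrite subr_eq0 => /eqP.
have [j0 k0] := jkcoef_diff ee Uz ec.
by split; [exact: (lin _ j0)|exact: (lin _ k0)].
Qed.

End Chart.

Lemma jkcoef_chart U1 a1 g1' z1 U2 a2 g2' z2 e :
  adapted_chart sig g U1 a1 g1' -> adapted_chart sig g U2 a2 g2' -> e * e = 1 ->
  U1 z1 -> U2 z2 -> a1 z1 = a2 z2 ->
  exists2 s : R, s * s = 1 & jcoef a1 g1' e z1 = s * jcoef a2 g2' e z2 /\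
    kcoef a1 g1' e z1 = s * kcoef a2 g2' e z2.
Proof.
move=> ad1 ad2 ee Uz1 Uz2 az; have [b2 ch2] := lorentz_chart_smooth ad2.1.
have [s ss [gE _]] := adapted_transition Sg ad1 ad2 ch2 Uz1 Uz2 az.
exists s => //.
have X c : c (s *: g2' z2) = s *: (c (g2' z2) : A) -> pe e (c (g1' z1)) = s * pe e (c (g2' z2)).
  by move=> cZ; rewrite gE cZ linearZ.
rewrite (jcoefE a1 g1' z1 ee) (jcoefE a2 g2' z2 ee).
rewrite (kcoefE a1 g1' z1 ee) (kcoefE a2 g2' z2 ee) az.
rewrite (X (@qc0 R) erefl) (X (@qc1 R) erefl) (X (@qc2 R) erefl) (X (@qc3 R) erefl).
by split; ring.
Qed.

Hypothesis charts : forall p, exists U a g', adapted_chart sig g U a g' /\ (a @` U) p.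
Hypothesis M_sc : simply_connected R M.

(* In two adapted charts the derivatives g' agree up to sign, so the double angle
   is a circle-valued function on all of M, and M is simply connected, whereas
   the domain U of a chart need not be. *)
Lemma double_angle_lift e : e * e = 1 -> exists chi : M -> R, continuous chi /\
  forall U a g', adapted_chart sig g U a g' -> forall z, U z ->
    cos (chi (a z)) = jcoef a g' e z * jcoef a g' e z - kcoef a g' e z * kcoef a g' e z /\
    sin (chi (a z)) = 2 * (jcoef a g' e z * kcoef a g' e z).
Proof.
move=> ee.
(* The real and imaginary parts of (p + i q)^2, insensitive to the sign of (p, q). *)
pose dbl (p q : R) : R * R := (p * p - q * q, 2 * (p * q)).
have loc x : exists r : R * R, exists U a g' z, [/\ adapted_chart sig g U a g', U z, a z = x &
    r = dbl (jcoef a g' e z) (kcoef a g' e z)].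
  have [U [a [g' [ad [z Uz az]]]]] := charts x.
  by exists (dbl (jcoef a g' e z) (kcoef a g' e z)), U, a, g', z.
have [v vP] := choice loc.
have vE U a g' : adapted_chart sig g U a g' -> forall z, U z ->
    v (a z) = dbl (jcoef a g' e z) (kcoef a g' e z).
  move=> ad z Uz; have [U2 [a2 [g2' [z2 [ad2 Uz2 az ->]]]]] := vP (a z).
  have [s ss [-> ->]] := jkcoef_chart ad2 ad ee Uz2 Uz az.
  move: (jcoef _ _ _ _) (kcoef _ _ _ _) => p q; rewrite /dbl.
  have m (x y : R) : s * x * (s * y) = x * y.
    by rewrite mulrACA ss mul1r.
  by rewrite !m.
have cv : continuous v.
  move=> x; have [U [a [g' [ad [z Uz az]]]]] := charts x.
  have [b [[oU oaU ca] [Sa ab Sb]]] := lorentz_chart_smooth ad.1.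
  have aUx : (a @` U) x by exists z.
  have cb : {for x, continuous b} := msmooth_continuous Sb aUx.
  have bx : b x = z by rewrite -az ab.
  have [Sj Sk] := jkcoef_smooth ad ee.
  have cj : {for b x, continuous (jcoef a g' e)} by rewrite bx; exact: (Sj 0%N).
  have ck : {for b x, continuous (kcoef a g' e)} by rewrite bx; exact: (Sk 0%N).
  have cjb := continuous_comp cb cj; have ckb := continuous_comp cb ck.
  have n : \forall y \near x, dbl ((jcoef a g' e \o b) y) ((kcoef a g' e \o b) y) = v y.
    by apply: filterS (open_near oaU aUx) => y [w Uw <-]; rewrite /= ab// (vE _ _ _ ad).
  have cd : {for x, continuous (fun y => dbl ((jcoef a g' e \o b) y) ((kcoef a g' e \o b) y))}.
    apply: (@cvg_pair _ _ _ _ (nbhs (dbl ((jcoef a g' e \o b) x) ((kcoef a g' e \o b) x)).1)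
      (nbhs (dbl ((jcoef a g' e \o b) x) ((kcoef a g' e \o b) x)).2)).
      by apply: cvgB; [exact: (cvgM cjb cjb)|exact: (cvgM ckb ckb)].
    by apply: cvgM; [exact: cvg_cst|exact: (cvgM cjb ckb)].
  rewrite /continuous_at -(nbhs_singleton n).
  by apply: cvg_trans cd; apply: near_eq_cvg; apply: filterS n.
have v1 x : (v x).1 * (v x).1 + (v x).2 * (v x).2 = 1.
  have [U [a [g' [z [ad Uz az ->]]]]] := vP x.
  have [_ _ /(_ e ee)] := adapted_quot ad Uz; rewrite /dbl /=.
  move: (jcoef _ _ _ _) (kcoef _ _ _ _) => p q pq1.
  have -> : (p * p - q * q) * (p * p - q * q) + 2 * (p * q) * (2 * (p * q)) =
    (p * p + q * q) * (p * p + q * q) by ring.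
  by rewrite pq1 mulr1.
have c1 : continuous (fun x => (v x).1).
  by move=> x; exact: (continuous_comp (cv x) (@fst_continuous R R R _)).
have c2 : continuous (fun x => (v x).2).
  by move=> x; exact: (continuous_comp (cv x) (@snd_continuous R R R _)).
have [chi [cchi chiP]] := global_lift M_sc c1 c2 v1.
exists chi; split=> // U a g' ad z Uz; have [-> ->] := chiP (a z).
by rewrite (vE _ _ _ ad z Uz).
Qed.

Lemma component_angle e U a g' : e * e = 1 -> adapted_chart sig g U a g' ->
  exists psi : A -> R, [/\ smooth_on U psi,
    forall z, U z -> cos (psi z) = jcoef a g' e z /\ sin (psi z) = kcoef a g' e z &
    forall z (w : A), U z -> 'd psi z (lsigma * w) = e * 'd psi z w].
Proof.
move=> ee ad; have [chi [cchi chiP]] := double_angle_lift ee.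
have oU := adapted_open ad; have [_ [_ [ca _]]] := ad.1.
have [Sj Sk] := jkcoef_smooth ad ee.
(* [chi] lives on M, whereas the sign [s], like [jcoef] and [kcoef], belongs to the chart. *)
pose t z := chi (a z) / 2.
pose s z := jcoef a g' e z * cos (t z) + kcoef a g' e z * sin (t z).
pose psi z := t z + pi / 2 * (1 - s z).
have ct z : U z -> {for z, continuous t}.
  move=> Uz; apply: cvgM; last exact: cvg_cst.
  exact: (continuous_comp (ca z Uz) (cchi _)).
have cpsi z : U z -> {for z, continuous psi}.
  move=> Uz; have ctz := ct z Uz; apply: cvgD; first exact: ctz.
  apply: cvgM; first exact: cvg_cst.
  apply: cvgB; first exact: cvg_cst.
  apply: cvgD; apply: cvgM.
  - exact: (Sj 0%N z Uz).
  - exact: (continuous_comp ctz (@continuous_cos R _)).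
  - exact: (Sk 0%N z Uz).
  - exact: (continuous_comp ctz (@continuous_sin R _)).
have psiP z : U z -> cos (psi z) = jcoef a g' e z /\ sin (psi z) = kcoef a g' e z.
  move=> Uz; have [cc ss] := chiP _ _ _ ad z Uz; have [_ _ /(_ e ee) n] := adapted_quot ad Uz.
  exact: half_angle n cc ss.
exists psi; split=> //; first by move=> k; exact: Ck_angle oU cpsi psiP Sj Sk.
move=> z w Uz.
have n : \forall z' \near z, cos (psi z') = jcoef a g' e z' /\ sin (psi z') = kcoef a g' e z'.
  by apply: filterS (open_near oU Uz) => z' Uz'; exact: psiP.
have [d E] := diff_angle (cpsi z Uz) n (smooth_differentiable Sj Uz) (smooth_differentiable Sk Uz).
have [Ej Ek] := jkcoef_conformal ad w ee Uz.
(* The form dpsi = P dQ - Q dP inherits the factor e from dP and dQ. *)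
have factor (p q x y : R) : p * (e * y) - q * (e * x) = e * (p * y - q * x) by ring.
apply: (etrans (E (lsigma * w))); apply: (etrans _ (congr1 ( *%R e) (esym (E w)))).
apply: (etrans _ (factor _ _ _ _)).
exact: (congr2 (fun x y => jcoef a g' e z * y - kcoef a g' e z * x) Ej Ek).
Qed.

(** Two real angles, one for each factor of A, are assembled into psi; conformality and the
    trigonometric formula are then checked factor by factor. *)
Lemma exists_angle_function U a g' : adapted_chart sig g U a g' ->
  exists psi, conformal_on_lorentz U psi /\ forall z, U z ->
    g' z * (g (a z))^-1 = qscale (lcos (psi z)) qJ + qscale (lsin (psi z)) qK.
Proof.
move=> ad; have oU := adapted_open ad.
have e2 : (-1) * (-1) = 1 :> R by rewrite mulrNN mulr1.
have [p1 [S1 P1 D1]] := component_angle (mulr1 1) ad.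
have [p2 [S2 P2 D2]] := component_angle e2 ad.
pose psi z : A := of_pe (p1 z) (p2 z).
have Spsi : smooth_on U psi.
  move=> k; have C1 := CkZ (2^-1 : R) oU (CkD oU (S1 k) (S2 k)).
  have C2 := CkZ (2^-1 : R) oU (CkD oU (S1 k) (CkN oU (S2 k))).
  apply: (Ck_ext oU _ (Ck_pair oU C1 C2)) => z _.
  by rewrite /psi /of_pe /mkL ![_ / 2]mulrC.
exists psi; split; first split=> //.
  move=> z Uz w; have d := smooth_differentiable Spsi Uz.
  have E (e : R) (p : A -> R) : (forall z, pe e (psi z) = p z) ->
      forall v, pe e ('d psi z v) = 'd p z v.
    move=> ep v; have [_ E] := diff_linear_comp (@pe_continuous R e) d.
    by rewrite -E; congr ('d _ z v); apply/funext.
  have E1 := E 1 p1 (fun z => pe_of_pe1 _ _); have E2 := E (-1) p2 (fun z => pe_of_peN1 _ _).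
  apply: pe_ext.
    by rewrite peM ?mulr1// pe_sigma !E1 D1.
  by rewrite peM// pe_sigma !E2 D2.
move=> z Uz; have [h0 h1 _] := adapted_quot ad Uz.
rewrite (qinv_bar (g_unit (a z))).
have [c1 s1] := P1 z Uz; have [c2 s2] := P2 z Uz.
have hc : lcos (psi z) = qc2 (g' z * qbar (g (a z))).
  by rewrite lcosE pe_of_pe1 pe_of_peN1 c1 c2 of_peK.
have hs : lsin (psi z) = qc3 (g' z * qbar (g (a z))).
  by rewrite lsinE pe_of_pe1 pe_of_peN1 s1 s2 of_peK.
rewrite hc hs; move: h0 h1; move: (g' z * _) => h h0 h1.
apply: lquat_ext.
- by change (qc0 h = qc2 h * 0 + qc3 h * 0); rewrite h0 !mulr0 addr0.
- by change (qc1 h = qc2 h * 0 + qc3 h * 0); rewrite h1 !mulr0 addr0.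
- by change (qc2 h = qc2 h * 1 + qc3 h * 0); rewrite mulr1 mulr0 addr0.
- by change (qc3 h = qc2 h * 0 + qc3 h * 1); rewrite mulr1 mulr0 add0r.
Qed.

End AngleOfChart.

(** * The Gauss map of a parallel spinor field *)

Section QuatCalculus.
Variable R : realType.
Local Notation A := (lorentz R).
Local Notation Q := (lquat R).
Implicit Types (x y q : Q).

Lemma qmulZl (r : R) x y : (r *: x : Q) * y = r *: (x * y).
Proof.
have Z (s : R) (a b : A) : (s *: a : A) * b = s *: (a * b) := scale_lmul s a b.
apply: lquat_ext; rewrite !qmulE /qmul /mkQ; rewrite /qc0 /qc1 /qc2 /qc3 /=;
  by rewrite !Z ?scalerDr ?scalerN.
Qed.

Lemma qmulZr (r : R) x y : x * (r *: y : Q) = r *: (x * y).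
Proof.
have Z (s : R) (a b : A) : a * (s *: b : A) = s *: (a * b).
  by rewrite mulrC scale_lmul mulrC.
apply: lquat_ext; rewrite !qmulE /qmul /mkQ; rewrite /qc0 /qc1 /qc2 /qc3 /=;
  by rewrite !Z ?scalerDr ?scalerN.
Qed.

Lemma qmul_is_bilinear :
  bilinear_for
    (GRing.Scale.Law.clone _ _ *:%R _) (GRing.Scale.Law.clone _ _ *:%R _)
    (@qmul R).
Proof.
by split=> [y|x] a u v /=; rewrite -!qmulE; [rewrite mulrDl qmulZl|rewrite mulrDr qmulZr].
Qed.

HB.instance Definition _ := bilinear_isBilinear.Build R Q Q Q _ _
  (@qmul R) qmul_is_bilinear.

Lemma lmul_continuous (T : topologicalType) (f h : T -> A) :
  continuous f -> continuous h -> continuous (fun t => f t * h t).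
Proof.
move=> cf ch.
have f1 t := continuous_comp (cf t) (@fst_continuous R R R _).
have f2 t := continuous_comp (cf t) (@snd_continuous R R R _).
have h1 t := continuous_comp (ch t) (@fst_continuous R R R _).
have h2 t := continuous_comp (ch t) (@snd_continuous R R R _).
apply: pair_continuous => t.
  exact: cvgD (cvgM (f1 t) (h1 t)) (cvgM (f2 t) (h2 t)).
exact: cvgD (cvgM (f1 t) (h2 t)) (cvgM (f2 t) (h1 t)).
Qed.

Lemma qcomp_continuous (T : topologicalType) (f : T -> Q) : continuous f ->
  [/\ continuous (fun t => qc0 (f t)), continuous (fun t => qc1 (f t)),
      continuous (fun t => qc2 (f t)) & continuous (fun t => qc3 (f t))].
Proof.
move=> cf.
have f1 : continuous (fun t => (f t).1).
  by move=> t; exact: (continuous_comp (cf t) (@fst_continuous R (A * A * A)%type A _)).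
have f3 : continuous (fun t => (f t).2).
  by move=> t; exact: (continuous_comp (cf t) (@snd_continuous R (A * A * A)%type A _)).
have f11 : continuous (fun t => (f t).1.1).
  by move=> t; exact: (continuous_comp (f1 t) (@fst_continuous R (A * A)%type A _)).
have f12 : continuous (fun t => (f t).1.2).
  by move=> t; exact: (continuous_comp (f1 t) (@snd_continuous R (A * A)%type A _)).
split=> //.
  by move=> t; exact: (continuous_comp (f11 t) (@fst_continuous R A A _)).
by move=> t; exact: (continuous_comp (f11 t) (@snd_continuous R A A _)).
Qed.

Lemma qmul_continuous : continuous (fun p : Q * Q => qmul p.1 p.2).
Proof.
have [x0 x1 x2 x3] := qcomp_continuous (@fst_continuous R Q Q).
have [y0 y1 y2 y3] := qcomp_continuous (@snd_continuous R Q Q).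
have m (f h : Q * Q -> A) : continuous f -> continuous h -> continuous (fun t => f t * h t).
  exact: lmul_continuous.
have D (f h : Q * Q -> A) : continuous f -> continuous h -> continuous (fun t => f t + h t).
  by move=> cf ch t; exact: cvgD (cf t) (ch t).
have B (f h : Q * Q -> A) : continuous f -> continuous h -> continuous (fun t => f t - h t).
  by move=> cf ch t; exact: cvgB (cf t) (ch t).
have c0 := B _ _ (B _ _ (B _ _ (m _ _ x0 y0) (m _ _ x1 y1)) (m _ _ x2 y2)) (m _ _ x3 y3).
have c1 := B _ _ (D _ _ (D _ _ (m _ _ x0 y1) (m _ _ x1 y0)) (m _ _ x2 y3)) (m _ _ x3 y2).
have c2 := D _ _ (D _ _ (B _ _ (m _ _ x0 y2) (m _ _ x1 y3)) (m _ _ x2 y0)) (m _ _ x3 y1).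
have c3 := D _ _ (B _ _ (D _ _ (m _ _ x0 y3) (m _ _ x1 y2)) (m _ _ x2 y1)) (m _ _ x3 y0).
exact: (pair_continuous (pair_continuous (pair_continuous c0 c1) c2) c3).
Qed.

Lemma diff_qmul (V : normedModType R) (f h : V -> Q) (x : V) :
  differentiable f x -> differentiable h x ->
  differentiable (fun t => f t * h t) x /\
  forall v, 'd (fun t => f t * h t) x v = f x * 'd h x v + 'd f x v * h x.
Proof.
move=> df dh; have dp := differentiable_pair df dh.
have db := @differentiable_bilin _ _ _ _ (@qmul R) (f x, h x) qmul_continuous.
have fE : (fun t => f t * h t) = (fun p : Q * Q => qmul p.1 p.2) \o (fun t => (f t, h t)) by [].
rewrite fE; split; first exact: differentiable_comp dp db.
have dc := diff_comp dp db.
have bE := @diff_bilin _ _ _ _ (@qmul R) (f x, h x) qmul_continuous.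
have pE := diff_pair df dh.
move=> v; apply: (etrans (congr1 (fun L : V -> Q => L v) dc)).
apply: (etrans (congr1 (fun L : Q * Q -> Q => L ('d (fun t => (f t, h t)) x v)) bE)).
exact (congr1 (fun L : V -> Q * Q => qmul (f x) (L v).2 + qmul (L v).1 (h x)) pE).
Qed.

Lemma qbar_linear : linear (@qbar R).
Proof.
move=> k x y; apply: lquat_ext; rewrite /qbar /mkQ /qc0 /qc1 /qc2 /qc3 /=;
  by rewrite ?opprD ?scalerN.
Qed.
HB.instance Definition _ := GRing.isLinear.Build R Q Q _ (@qbar R) qbar_linear.

Lemma qbar_continuous : continuous (@qbar R).
Proof.
have [x0 x1 x2 x3] := qcomp_continuous (fun x => @cvg_id Q (nbhs x)).
have N (f : Q -> A) : continuous f -> continuous (fun t => - f t).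
  by move=> cf t; exact: cvgN (cf t).
exact: (pair_continuous (pair_continuous (pair_continuous x0 (N _ x1)) (N _ x2)) (N _ x3)).
Qed.

Lemma qbarM x y : qbar (x * y) = qbar y * qbar x.
Proof.
by apply: lquat_ext; rewrite !qmulE /qbar /qmul /mkQ /qc0 /qc1 /qc2 /qc3 /=; ring.
Qed.

Lemma qbarK : involutive (@qbar R).
Proof. by move=> x; apply: lquat_ext; rewrite /qbar /mkQ /qc0 /qc1 /qc2 /qc3 /= ?opprK. Qed.

Lemma mul_qbar x : qform x x = 1 -> x * qbar x = 1.
Proof.
move=> x1; rewrite qmulE; apply: lquat_ext.
- by rewrite -[RHS]x1 /qform /qmul /qbar /mkQ /qc0 /qc1 /qc2 /qc3 /=; ring.
- by change (qc1 (qmul x (qbar x)) = 0); rewrite /qmul /qbar /mkQ /qc0 /qc1 /qc2 /qc3 /=; ring.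
- by change (qc2 (qmul x (qbar x)) = 0); rewrite /qmul /qbar /mkQ /qc0 /qc1 /qc2 /qc3 /=; ring.
- by change (qc3 (qmul x (qbar x)) = 0); rewrite /qmul /qbar /mkQ /qc0 /qc1 /qc2 /qc3 /=; ring.
Qed.

Lemma qform_qbar x : qform (qbar x) (qbar x) = qform x x.
Proof. by rewrite /qform /qbar /mkQ /qc0 /qc1 /qc2 /qc3 /=; ring. Qed.

Lemma qbar_mul x : qform x x = 1 -> qbar x * x = 1.
Proof. by move=> x1; rewrite -{2}[x]qbarK mul_qbar// qform_qbar. Qed.

Lemma lconjM (a b : A) : lconj (a * b) = lconj a * lconj b.
Proof. by apply: lorentz_ext => /=; ring. Qed.
Lemma lconjD (a b : A) : lconj (a + b) = lconj a + lconj b.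
Proof. by apply: lorentz_ext => /=; ring. Qed.
Lemma lconjN (a : A) : lconj (- a) = - lconj a.
Proof. by apply: lorentz_ext. Qed.
Lemma lconjK (a : A) : lconj (lconj a) = a.
Proof. by apply: lorentz_ext => //=; rewrite opprK. Qed.

Lemma qhatM x y : qhat (x * y) = qhat x * qhat y.
Proof.
by apply: lquat_ext; rewrite !qmulE /qhat /qmul /mkQ /qc0 /qc1 /qc2 /qc3 /=;
  rewrite !(lconjD, lconjN, lconjM).
Qed.

Lemma qhatK : involutive (@qhat R).
Proof. by move=> x; apply: lquat_ext; rewrite /qhat /mkQ /qc0 /qc1 /qc2 /qc3 /= lconjK. Qed.

Lemma qhat_bar x : qhat (qbar x) = qbar (qhat x).
Proof.
by apply: lquat_ext; rewrite /qhat /qbar /mkQ /qc0 /qc1 /qc2 /qc3 /= ?lconjN.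
Qed.

Lemma qform_qhat x : qform (qhat x) (qhat x) = lconj (qform x x).
Proof. by rewrite /qform /qhat /mkQ /qc0 /qc1 /qc2 /qc3 /= !lconjD !lconjM. Qed.

Lemma lconj1 : lconj (1 : A) = 1.
Proof. by apply: lorentz_ext => //=; rewrite oppr0. Qed.

Lemma lconj0 : lconj (0 : A) = 0.
Proof. by apply: lorentz_ext => //=; rewrite oppr0. Qed.

Lemma qscale_mull (w : A) x y : qscale w x * y = qscale w (x * y).
Proof.
by apply: lquat_ext; rewrite !qmulE /qscale /qmul /mkQ /qc0 /qc1 /qc2 /qc3 /=; ring.
Qed.

Lemma qscale_mulr (w : A) x y : x * qscale w y = qscale w (x * y).
Proof.
by apply: lquat_ext; rewrite !qmulE /qscale /qmul /mkQ /qc0 /qc1 /qc2 /qc3 /=; ring.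
Qed.

Lemma qhat_K : qhat (qK : Q) = qK.
Proof. by apply: lquat_ext; rewrite /qhat /qK /mkQ /qc0 /qc1 /qc2 /qc3 /= ?lconj1 ?lconj0. Qed.

Lemma qJK_I : qJ * qK = qI :> Q.
Proof. by apply: lquat_ext; rewrite qmulE /qmul /qI /qJ /qK /mkQ /qc0 /qc1 /qc2 /qc3 /=; ring. Qed.

End QuatCalculus.

(** * From the Dirac equation to the differentials of g and G *)

Section SpinorGaussMap.
Variables (R : realType) (M : surface R) (g G : M -> lquat R).
Local Notation A := (lorentz R).
Local Notation Q := (lquat R).
Hypothesis Sg : msmooth setT g.
Hypothesis g_unit : forall x, qform (g x) (g x) = 1.

Local Notation dgl x u := (mdiff g x u * qbar (g x)).

Lemma mdiff_gE x u : mdiff g x u = dgl x u * g x.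
Proof. by rewrite -mulrA qbar_mul// mulr1. Qed.

Lemma differentiable_g x : differentiable (g \o cinv (schart x)) (cmap (schart x) x).
Proof. exact: msmooth_differentiable Sg (schart_atlas x) (schart_dom x) _. Qed.

Lemma diff_qbar (V : normedModType R) (f : V -> Q) (z : V) : differentiable f z ->
  differentiable (fun t => qbar (f t)) z /\ forall v, 'd (fun t => qbar (f t)) z v = qbar ('d f z v).
Proof. exact: (diff_linear_comp (@qbar_continuous R)). Qed.

Lemma qc0_bar_eq0 (w : Q) : qbar w + w = 0 -> qc0 w = 0.
Proof.
move=> /(congr1 (@qc0 R)) h; have {h}h : qc0 w + qc0 w = 0 by exact h.
have half (a : A) : a + a = 0 -> a = 0.
  move=> /eqP aa; apply: lorentz_ext.
    by move: aa => /eqP /(congr1 (fun t : A => t.1)) /= aa; change (a.1 = 0); lra.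
  by move: aa => /eqP /(congr1 (fun t : A => t.2)) /= aa; change (a.2 = 0); lra.
exact: half.
Qed.

(** Differentiating g qbar(g) = 1 shows that w = dg g^-1 satisfies w + qbar w = 0. *)
Lemma dgl_qc0 x u : qc0 (dgl x u) = 0.
Proof.
set f := g \o cinv (schart x); set z := cmap (schart x) x.
have df : differentiable f z := differentiable_g x.
have [db Eb] := diff_qbar df; have [dm Em] := diff_qmul df db.
have one : (fun t => f t * qbar (f t)) = (fun=> 1 : Q).
  by apply/funext => t; exact: mul_qbar (g_unit _).
have fz : f z = g x by rewrite /f /z /= schart_cinv.
have E0 : f z * qbar ('d f z u) + 'd f z u * qbar (f z) = 0.
  apply: (etrans (congr1 (fun w : Q => f z * w + 'd f z u * qbar (f z)) (esym (Eb u)))).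
  apply: (etrans (esym (Em u))); rewrite one.
  exact (congr1 (fun L : R * R -> Q => L u) (diff_cst _ _)).
apply: qc0_bar_eq0; rewrite qbarM qbarK -fz; exact: E0.
Qed.

Hypothesis GE : forall x, G x = qbar (g x) * (qI * g x).

(* As G = g^-1 I g, its differential is g^-1 (gauss_rate (dg g^-1)) g. *)
Definition gauss_rate (w : Q) : Q := qbar w * qI + qI * w.

Lemma mdiff_G x u : mdiff G x u = qbar (g x) * (gauss_rate (dgl x u) * g x).
Proof.
set f := g \o cinv (schart x); set z := cmap (schart x) x.
have df : differentiable f z := differentiable_g x.
have fz : f z = g x by rewrite /f /z /= schart_cinv.
have [db Eb] := diff_qbar df.
have [dI EI] := diff_qmul (differentiable_cst (qI : Q) z) df.
have [dm Em] := diff_qmul db dI.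
have GcE : G \o cinv (schart x) = (fun t => qbar (f t) * (qI * f t)).
  by apply/funext => t; exact: GE.
have EI' v : 'd (fun t => qI * f t) z v = qI * 'd f z v.
  apply: (etrans (EI v)).
  apply: (etrans (congr1 (fun L : R * R -> Q => qI * 'd f z v + L v * f z) (diff_cst _ _))).
  by rewrite mul0r addr0; reflexivity.
have E1 : mdiff G x u = qbar (f z) * (qI * 'd f z u) + qbar ('d f z u) * (qI * f z).
  rewrite /mdiff GcE; apply: (etrans (Em u)).
  exact: (congr2 (fun w w' : Q => qbar (f z) * w + w' * (qI * f z)) (EI' u) (Eb u)).
apply: (etrans E1); rewrite fz; have dE : 'd f z u = dgl x u * g x := mdiff_gE x u.
rewrite dE; move: (dgl x u) => w.
by rewrite qbarM /gauss_rate mulrDl mulrDr addrC !mulrA.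
Qed.

Variables e2 e3 : M -> (R * R)%type.
Hypothesis e_basis : forall x, det2 (e2 x) (e3 x) != 0.
(** [B] stands for the coordinates of the mean curvature vector, which is normal and so lies in the
    span of 1 and I over A. *)
Variable B : M -> Q.
Hypothesis B_IJ : forall x, qc2 (B x) = 0 /\ qc3 (B x) = 0.
Hypothesis dirac : forall x,
  qJ * qhat (mdiff g x (e2 x)) + qK * qhat (mdiff g x (e3 x)) = B x * qhat (g x).

Lemma dirac_dgl x : qJ * qhat (dgl x (e2 x)) + qK * qhat (dgl x (e3 x)) = B x.
Proof.
have := dirac x; rewrite {1}mdiff_gE {1}(mdiff_gE x (e3 x)) !qhatM !mulrA -mulrDl.
move=> /(congr1 (fun q => q * qbar (qhat (g x)))).
by rewrite -!mulrA mul_qbar ?mulr1// qform_qhat g_unit lconj1.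
Qed.

Lemma lconj_eq0 (a : A) : lconj a = 0 -> a = 0.
Proof. by move=> h; rewrite -[a]lconjK h lconj0. Qed.

(** The J and K coefficients of J hat(c) + K hat(d) each mix the real part of one of c, d with the I
    part of the other. They vanish because [B] has none, and the real parts vanish by [dgl_qc0]. *)
Lemma dgl_qc1_frame x : qc1 (dgl x (e2 x)) = 0 /\ qc1 (dgl x (e3 x)) = 0.
Proof.
have := dirac_dgl x; have [b2 b3] := B_IJ x.
have := dgl_qc0 x (e2 x); have := dgl_qc0 x (e3 x).
move: (dgl x (e2 x)) (dgl x (e3 x)) (B x) b2 b3 => c d b b2 b3 d0 c0 E.
have E2 : qc2 (qJ * qhat c + qK * qhat d) = lconj (qc0 c) + lconj (qc1 d).
  by rewrite qD !qmulE /qmul /qJ /qK /qhat /mkQ /qc0 /qc1 /qc2 /qc3 /=; ring.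
have E3 : qc3 (qJ * qhat c + qK * qhat d) = lconj (qc0 d) - lconj (qc1 c).
  by rewrite qD !qmulE /qmul /qJ /qK /qhat /mkQ /qc0 /qc1 /qc2 /qc3 /=; ring.
move: E2 E3; rewrite E b2 b3 c0 d0 lconj0 add0r sub0r => E2 E3.
split; apply: lconj_eq0; last exact: esym.
by rewrite -[LHS]opprK -E3 oppr0.
Qed.

Lemma qc1D (p q : Q) : qc1 (p + q) = qc1 p + qc1 q. Proof. by []. Qed.
Lemma qc1Z (r : R) (p : Q) : qc1 (r *: p) = r *: qc1 p. Proof. by []. Qed.

Lemma mdiffD (W : normedModType R) (f : M -> W) x (s t : R) u v :
  mdiff f x (s *: u + t *: v) = s *: mdiff f x u + t *: mdiff f x v.
Proof. by rewrite /mdiff linearD !linearZ. Qed.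

Lemma dgl_JK x u : qc0 (dgl x u) = 0 /\ qc1 (dgl x u) = 0.
Proof.
split; first exact: dgl_qc0.
have [h2 h3] := dgl_qc1_frame x; rewrite -(cramerK u (e_basis x)) mdiffD.
by rewrite mulrDl !qmulZl qc1D !qc1Z h2 h3 !scaler0 addr0.
Qed.

(** Up to the factor 2 this is a quarter turn of the (J, K)-plane over A, injective and A-linear:
    hence conformality passes from G to g. *)
Lemma gauss_rateE (w : Q) : qc0 w = 0 -> qc1 w = 0 ->
  gauss_rate w = mkQ 0 0 (- (qc3 w + qc3 w)) (qc2 w + qc2 w).
Proof.
rewrite /gauss_rate !qmulE => w0 w1; rewrite qD; apply: lquat_ext;
  rewrite /qmul /qI /qbar /mkQ; move: w0 w1; rewrite /qc0 /qc1 /qc2 /qc3 /= => -> ->; ring.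
Qed.

Lemma mdiff_G_inj x u : injective (mdiff G x) -> mdiff g x u = 0 -> u = 0.
Proof.
move=> Ginj du; apply: Ginj.
have -> : mdiff G x 0 = 0 by exact: linear0.
by rewrite mdiff_G du mul0r /gauss_rate /= linear0 mul0r mulr0 addr0 mul0r mulr0.
Qed.

Lemma dbl_inj (a b : A) : a + a = b + b -> a = b.
Proof.
move=> ab; apply: lorentz_ext.
  by have /(congr1 (fun t : A => t.1)) /= := ab; lra.
by have /(congr1 (fun t : A => t.2)) /= := ab; lra.
Qed.

Lemma mdiff_g_conformal x (u v : R * R) :
  mdiff G x v = qscale lsigma (mdiff G x u) -> mdiff g x v = qscale lsigma (mdiff g x u).
Proof.
rewrite !mdiff_G => h; suff W : dgl x v = qscale lsigma (dgl x u).
  apply: (etrans (mdiff_gE x v)); rewrite W qscale_mull.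
  exact (congr1 (qscale lsigma) (esym (mdiff_gE x u))).
move: h; have [u0 u1] := dgl_JK x u; have [v0 v1] := dgl_JK x v.
rewrite (gauss_rateE u0 u1) (gauss_rateE v0 v1) => h.
have {}h := congr1 (fun q : Q => g x * q * qbar (g x)) h.
(* Conjugation by g can be undone on both sides, since it commutes with the multiplication by
   sigma. *)
have cancel (q : Q) : g x * (qbar (g x) * (q * g x)) * qbar (g x) = q.
  by rewrite !mulrA mul_qbar// mul1r -mulrA mul_qbar// mulr1.
move: h; rewrite qscale_mulr qscale_mull !cancel.
move: (dgl x u) (dgl x v) u0 u1 v0 v1 => w w' u0 u1 v0 v1 h.
apply: lquat_ext.
- by rewrite v0 /qscale /mkQ {1}/qc0 /= u0 mulr0.
- by rewrite v1 /qscale /mkQ {1}/qc1 /= u1 mulr0.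
- apply: dbl_inj; have := congr1 (@qc3 R) h.
  by change (qc2 w' + qc2 w' = lsigma * (qc2 w + qc2 w) ->
    qc2 w' + qc2 w' = lsigma * qc2 w + lsigma * qc2 w); rewrite mulrDr.
apply: dbl_inj; have := congr1 (fun q : Q => - qc2 q) h.
by change (- - (qc3 w' + qc3 w') = - (lsigma * - (qc3 w + qc3 w)) ->
  qc3 w' + qc3 w' = lsigma * qc3 w + lsigma * qc3 w); rewrite mulrN !opprK mulrDr.
Qed.

End SpinorGaussMap.

Lemma fibre_metric0 (R : realType) (M : surface R) sm (h : M -> R * R -> R * R -> R) x w :
  fibre_metric sm h -> h x 0 w = 0.
Proof.
move=> [lin _]; have := lin x 1 0 0 w; rewrite scaler0 addr0 mul1r.
by move: (h x 0 w) => r rr; apply: (addrI r); rewrite addr0 -rr.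
Qed.

(** * Coordinates in the parallel spin frame *)

Section ParallelSpinor.
Variables (R : realType) (M : surface R) (E : vbundle M).
Variables (gM hE : M -> R * R -> R * R -> R).
Variables (nM nE : M -> R * R -> (M -> (R * R)%type) -> (R * R)%type).
Hypothesis gM_metric : fibre_metric (@tsmooth R M) gM.
Hypothesis hE_metric : fibre_metric (vsmooth E) hE.
Variables (PE : spin_structure (vsmooth E) hE) (PM : spin_structure (@tsmooth R M) gM).
Variables (phi : PE -> PM -> lquat R) (s2 : M -> PE) (s1 : M -> PM).
Hypothesis s2_par : parallel_section nE s2.
Hypothesis s1_par : parallel_section nM s1.
Local Notation g := (fun x => phi (s2 x) (s1 x)).
Local Notation e2 x := (sp_frame (s1 x)).1.
Local Notation e3 x := (sp_frame (s1 x)).2.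

Lemma proj_s1 x : sp_proj (s1 x) = x. Proof. by have [[h _] _] := s1_par; exact: h. Qed.
Lemma proj_s2 x : sp_proj (s2 x) = x. Proof. by have [[h _] _] := s2_par; exact: h. Qed.
Lemma proj_s21 x : sp_proj (s2 x) = sp_proj (s1 x). Proof. by rewrite proj_s1 proj_s2. Qed.

Lemma frame_s1 x : pos_orthonormal gM x (e2 x) (e3 x).
Proof. by have := sp_frameP (s1 x); rewrite proj_s1. Qed.

Lemma coordM_frame x : coordM (s1 x) (e2 x) = qJ /\ coordM (s1 x) (e3 x) = qK.
Proof.
have [h22 [h33 [h23 _]]] := frame_s1 x; have [_ [sym _]] := gM_metric.
rewrite /coordM proj_s1 h22 h33 h23 (sym x (e3 x) (e2 x)) h23.
by rewrite !scale1r !scale0r addr0 add0r.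
Qed.

(** For parallel frames both connection forms vanish, and [spin_nabla] is the plain differential of
    the coordinates. *)
Lemma parallel_dirac Hv x : dirac_eq nE nM phi Hv ->
  qJ * qhat (mdiff g x (e2 x)) + qK * qhat (mdiff g x (e3 x)) =
  coordE (s2 x) (Hv x) * qhat (g x).
Proof.
move=> /(_ setT s2 s1 openT s2_par.1 s1_par.1 x I) /=; have [-> ->] := coordM_frame x.
have N u : spin_nabla nE nM phi s2 s1 x u = mdiff g x u.
  rewrite /spin_nabla (s2_par.2 x u).1 (s1_par.2 x u).1.
  by rewrite (fibre_metric0 _ _ hE_metric) (fibre_metric0 _ _ gM_metric) mul0r !scale0r !addr0.
by rewrite /clifford !N.
Qed.

(** Here v_2 = g^-1 J hat(g) and hat(v_3) = hat(g)^-1 K g; in the product the middle factors cancel,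
    and J K = I. *)
Lemma gauss_parallel G : unit_spinor phi -> gauss_map phi G ->
  forall x, G x = qbar (g x) * (qI * g x).
Proof.
move=> phi1 Gg x; have := Gg _ _ (proj_s21 x) (e2 x) (e3 x).
rewrite proj_s1 => /(_ (frame_s1 x)) ->; have [E2 E3] := coordM_frame x.
rewrite /xi_form /qpair /clifford E2 E3.
have g1 : qform (g x) (g x) = 1 by apply: phi1; exact: proj_s21.
move: (phi _ _) g1 => q q1; rewrite !qhatM qhatK qhat_bar qhat_K -!mulrA.
by rewrite [qhat q * _]mulrA mul_qbar ?qform_qhat ?q1 ?lconj1// mul1r [qJ * _]mulrA qJK_I.
Qed.

Lemma coordE_qc23 (q : PE) X : qc2 (coordE q X) = 0 /\ qc3 (coordE q X) = 0.
Proof.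
rewrite /coordE; move: (hE _ _ _) (hE _ _ _) => s r.
have Z : r *: (lsigma * (0 : lorentz R)) + s *: (0 : lorentz R) = 0.
  by rewrite mulr0 !scaler0 addr0.
by split; exact: Z.
Qed.

End ParallelSpinor.

Unset Implicit Arguments.
Theorem theorem2 (R : realType) (M : surface R)
  (M_sc : simply_connected R M)
  (gM : M -> R * R -> R * R -> R) (gM_metric : fibre_metric (@tsmooth R M) gM)
  (nM : M -> R * R -> (M -> (R * R)%type) -> (R * R)%type)
  (nM_LC : levi_civita gM nM)
  (E : vbundle M)
  (hE : M -> R * R -> R * R -> R) (hE_metric : fibre_metric (vsmooth E) hE)
  (nE : M -> R * R -> (M -> (R * R)%type) -> (R * R)%type)
  (nE_conn : metric_connection (vsmooth E) hE nE)
  (TM_flat : flat (@tsmooth R M) nM) (E_flat : flat (vsmooth E) nE)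
  (PE : spin_structure (vsmooth E) hE) (PM : spin_structure (@tsmooth R M) gM)
  (Hv : M -> (R * R)%type) (Hv_smooth : vsmooth E setT Hv)
  (phi : PE -> PM -> lquat R) (phi_section : spinor_section phi)
  (phi_dirac : dirac_eq nE nM phi Hv) (phi_unit : unit_spinor phi)
  (s2 : M -> PE) (s1 : M -> PM)
  (s2_par : parallel_section nE s2) (s1_par : parallel_section nM s1)
  (G : M -> lquat R) (G_gauss : gauss_map phi G) (G_reg : regular G)
  (sig : M -> R * R -> (R * R)%type) (S_ind : induced_lorentz G sig) :
  let g := fun x : M => phi (s2 x) (s1 x) in
  ((forall x, qform (g x) (g x) = 1) /\ conformal_on_surface sig g /\
   (forall p : M, exists U a g',
      adapted_chart sig g U a g' /\ (a @` U) p) /\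
   (forall U1 a1 g1' U2 a2 g2',
      adapted_chart sig g U1 a1 g1' -> adapted_chart sig g U2 a2 g2' ->
      forall W : set M, open W -> connected W ->
      W `<=` (a1 @` U1) `&` (a2 @` U2) ->
      exists2 t, group_G t &
        forall z, U1 z -> W (a1 z) -> U2 (t z) /\ a2 (t z) = a1 z) /\
   (forall U a g' t, adapted_chart sig g U a g' -> group_G t ->
      exists g'', adapted_chart sig g (t @^-1` U) (a \o t) g'')) /\
  (forall U a g', adapted_chart sig g U a g' ->
     exists psi, conformal_on_lorentz U psi /\
       forall z, U z -> g' z * (g (a z))^-1 =
         qscale (lcos (psi z)) qJ + qscale (lsin (psi z)) qK).

Proof.
move=> g.
have g_unit x : qform (g x) (g x) = 1 by apply: phi_unit; exact: proj_s21 s2_par s1_par x.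
have Sg : msmooth setT g := phi_section.2 setT s2 s1 openT s2_par.1 s1_par.1.
have GE : forall x, G x = qbar (g x) * (qI * g x) :=
  gauss_parallel gM_metric s2_par s1_par phi_unit G_gauss.
have dirac x := parallel_dirac gM_metric hE_metric s2_par s1_par x phi_dirac.
have e_basis x : det2 (sp_frame (s1 x)).1 (sp_frame (s1 x)).2 != 0.
  by have [_ [_ [_ d]]] := frame_s1 s1_par x; rewrite gt_eqF.
have JK := dgl_JK Sg g_unit e_basis (fun x => coordE_qc23 (s2 x) (Hv x)) dirac.
have [sig_lin [sigK [sig_neq [sig_conf _]]]] := S_ind.
have g_inj x u : mdiff g x u = 0 -> u = 0 := mdiff_G_inj Sg g_unit GE (G_reg x).
have g_conf x u : mdiff g x (sig x u) = qscale lsigma (mdiff g x u).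
  exact (mdiff_g_conformal Sg g_unit GE e_basis (fun x => coordE_qc23 (s2 x) (Hv x)) dirac
    (sig_conf x u)).
have charts := exists_adapted_chart Sg g_conf g_inj sig_lin sigK sig_neq.
split; last exact: exists_angle_function Sg g_unit JK charts M_sc.
split=> //; split; first by split.
split; first exact: charts.
split; first exact: adapted_unique Sg.
exact: adapted_group sig_lin.
Qed.
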